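(* (i) Let $\boldsymbol\Psi(\mathbf s,\mathbf t,\bar{\mathbf t};z)$, $\bar{\boldsymbol\Psi}(\mathbf s,\mathbf t,\bar{\mathbf t};z)$ be the wave functions and $\boldsymbol\Psi^*(\mathbf s,\mathbf t,\bar{\mathbf t};z)$, $\bar{\boldsymbol\Psi}^*(\mathbf s,\mathbf t,\bar{\mathbf t};z)$ the corresponding adjoint wave functions of a solution of the $N$-component Toda lattice hierarchy (all defined in the context). Then the bilinear identity $$\oint_{C_\infty}\boldsymbol\Psi(\mathbf s,\mathbf t,\bar{\mathbf t};z)\,\boldsymbol\Psi^*(\mathbf s',\mathbf t',\bar{\mathbf t}';z)\,dz=\oint_{C_0}\bar{\boldsymbol\Psi}(\mathbf s,\mathbf t,\bar{\mathbf t};z)\,\bar{\boldsymbol\Psi}^*(\mathbf s',\mathbf t',\bar{\mathbf t}';z)\,dz$$ holds for all $\mathbf s,\mathbf s'\in\mathbb Z^N$ and all $\mathbf t,\mathbf t',\bar{\mathbf t},\bar{\mathbf t}'$. (ii) Conversely, assume that $N\times N$-matrix-valued functions of the form $$\boldsymbol\Psi=\sum_{j\ge0}w_j(\mathbf s,\mathbf t,\bar{\mathbf t})\,\mathrm{diag}_\alpha\bigl(z^{s_\alpha-j}e^{\xi(\mathbf t_\alpha,z)}\bigr),\qquad \bar{\boldsymbol\Psi}=\sum_{j\ge0}\bar w_j(\mathbf s,\mathbf t,\bar{\mathbf t})\,\mathrm{diag}_\alpha\bigl(z^{s_\alpha+j}e^{\xi(\bar{\mathbf t}_\alpha,z^{-1})}\bigr),$$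 $$\boldsymbol\Psi^*=\sum_{j\ge0}\mathrm{diag}_\alpha\bigl(z^{-s_\alpha-j}e^{-\xi(\mathbf t_\alpha,z)}\bigr)w_j^*(\mathbf s,\mathbf t,\bar{\mathbf t}),\qquad \bar{\boldsymbol\Psi}^*=\sum_{j\ge0}\mathrm{diag}_\alpha\bigl(z^{-s_\alpha+j}e^{-\xi(\bar{\mathbf t}_\alpha,z^{-1})}\bigr)\bar w^*_j(\mathbf s,\mathbf t,\bar{\mathbf t}),$$ where $w_j,\bar w_j,w_j^*,\bar w_j^*$ are $N\times N$ matrices with $w_0=w_0^*=1_N$ and $\bar w_0,\bar w_0^*\in GL(N,\mathbb C)$, satisfy the bilinear identity $$\oint_{C_\infty}\boldsymbol\Psi(\mathbf s,\mathbf t,\bar{\mathbf t};z)\,\boldsymbol\Psi^*(\mathbf s',\mathbf t',\bar{\mathbf t}';z)\,dz=\oint_{C_0}\bar{\boldsymbol\Psi}(\mathbf s,\mathbf t,\bar{\mathbf t};z)\,\bar{\boldsymbol\Psi}^*(\mathbf s',\mathbf t',\bar{\mathbf t}';z)\,dz$$ for all $\mathbf s,\mathbf s',\mathbf t,\mathbf t',\bar{\mathbf t},\bar{\mathbf t}'$. Then they are wave functions and adjoint wave functions of the $N$-component Toda lattice hierarchy. Namely, put $\hat{\mathbf W}(\mathbf s)=\sum_{j\ge0}w_j(\mathbf s)e^{-j\partial_s}$ and $\hat{\bar{\mathbf W}}(\mathbf s)=\sum_{j\ge0}\bar w_j(\mathbf s)e^{j\partial_s}$. Then $$\hat{\mathbf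 W}^{-1}(\mathbf s)=\sum_{j\ge0}e^{-j\partial_s}w_j^*(\mathbf s+\mathbf 1),\qquad \hat{\bar{\mathbf W}}^{-1}(\mathbf s)=\sum_{j\ge0}e^{j\partial_s}\bar w_j^*(\mathbf s+\mathbf 1),$$ $\hat{\mathbf W},\hat{\bar{\mathbf W}}$ are wave operators, and the operators $$\mathbf L=\hat{\mathbf W}e^{\partial_s}\hat{\mathbf W}^{-1},\quad \mathbf U_\alpha=\hat{\mathbf W}E_\alpha\hat{\mathbf W}^{-1},\quad \mathbf Q_\alpha=\hat{\mathbf W}e^{-\partial_{s_\alpha}}\hat{\mathbf W}^{-1},$$ $$\bar{\mathbf L}=\hat{\bar{\mathbf W}}e^{-\partial_s}\hat{\bar{\mathbf W}}^{-1},\quad \bar{\mathbf U}_\alpha=\hat{\bar{\mathbf W}}E_\alpha\hat{\bar{\mathbf W}}^{-1},\quad \bar{\mathbf Q}_\alpha=\hat{\bar{\mathbf W}}e^{-\partial_{s_\alpha}}\hat{\bar{\mathbf W}}^{-1}\qquad(\alpha=1,\dots,N)$$ form a solution of the $N$-component Toda lattice hierarchy.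
   Context: **Notation.** Fix $N\ge1$. Variables: $\mathbf s=(s_1,\dots,s_N)\in\mathbb Z^N$, $\mathbf t=(t_{\alpha,k})$, $\bar{\mathbf t}=(\bar t_{\alpha,k})$ with $1\le\alpha\le N$, $k\ge1$; $\mathbf t_\alpha=(t_{\alpha,k})_{k\ge1}$ and similarly $\bar{\mathbf t}_\alpha$. All coefficients are $N\times N$ complex matrix functions of $(\mathbf s,\mathbf t,\bar{\mathbf t})$; dependence on $\mathbf t,\bar{\mathbf t}$ is often suppressed. $E_\alpha$ is the diagonal matrix unit with $1$ at position $(\alpha,\alpha)$, $1_N$ the unit matrix, $\mathbf 1=(1,\dots,1)$, $[1]_\alpha$ the $\alpha$-th standard basis vector. $e^{\partial_{s_\alpha}}f(\mathbf s)=f(\mathbf s+[1]_\alpha)$, $e^{\partial_s}=\prod_\alpha e^{\partial_{s_\alpha}}$, so $e^{\partial_s}f(\mathbf s)=f(\mathbf s+\mathbf 1)$. Difference operators are formal sums $A=\sum_j a_j(\mathbf s)e^{j\partial_s}$ (infinite in at most one direction), possibly multiplied by integer powers of the $e^{\partial_{s_\alpha}}$; $A_{\ge0}=\sum_{j\ge0}a_je^{j\partial_s}$, $A_{<0}=\sum_{j<0}a_je^{j\partial_s}$. $\xi(\mathbf t_\alpha,z)=\sum_{k\ge1}t_{\alpha,k}z^k$. **The hierarchy.** A solution of the $N$-component Toda lattice hierarchy is a collection of operators $\mathbf L=\sum_{j\ge0}b_j e^{(1-j)\partial_s}$, $b_0=1_N$; $\bar{\mathbf L}=\sum_{j\ge0}\bar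 b_je^{(j-1)\partial_s}$, $\bar b_0$ invertible; $\mathbf U_\alpha=\sum_{j\ge0}u_{\alpha,j}e^{-j\partial_s}$, $u_{\alpha,0}=E_\alpha$; $\bar{\mathbf U}_\alpha=\sum_{j\ge0}\bar u_{\alpha,j}e^{j\partial_s}$; $\mathbf Q_\alpha=e^{-\partial_{s_\alpha}}\mathbf P_\alpha$, $\mathbf P_\alpha=\sum_{j\ge0}p_{\alpha,j}e^{-j\partial_s}$, $p_{\alpha,0}=1_N$; $\bar{\mathbf Q}_\alpha=e^{-\partial_{s_\alpha}}\bar{\mathbf P}_\alpha$, $\bar{\mathbf P}_\alpha=\sum_{j\ge0}\bar p_{\alpha,j}e^{j\partial_s}$ ($\alpha=1,\dots,N$), satisfying for all $\alpha,\beta$ the algebraic conditions - $[\mathbf L,\mathbf U_\alpha]=[\mathbf L,\mathbf Q_\alpha]=[\mathbf U_\beta,\mathbf Q_\alpha]=[\mathbf Q_\alpha,\mathbf Q_\beta]=0$, $\mathbf U_\alpha\mathbf U_\beta=\delta_{\alpha\beta}\mathbf U_\beta$, $\sum_\alpha\mathbf U_\alpha=1_N$, $\prod_\alpha\mathbf Q_\alpha=\mathbf L^{-1}$; - $[\bar{\mathbf L},\bar{\mathbf U}_\alpha]=[\bar{\mathbf L},\bar{\mathbf Q}_\alpha]=[\bar{\mathbf U}_\beta,\bar{\mathbf Q}_\alpha]=[\bar{\mathbf Q}_\alpha,\bar{\mathbf Q}_\beta]=0$, $\bar{\mathbf U}_\alpha\bar{\mathbf U}_\beta=\delta_{\alpha\beta}\bar{\mathbf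 U}_\beta$, $\sum_\alpha\bar{\mathbf U}_\alpha=1_N$, $\prod_\alpha\bar{\mathbf Q}_\alpha=\bar{\mathbf L}$; - $\mathbf Q_\alpha\sum_\beta\mathbf U_\beta\mathbf L^{\delta_{\alpha\beta}}=\bar{\mathbf Q}_\alpha\sum_\beta\bar{\mathbf U}_\beta\bar{\mathbf L}^{-\delta_{\alpha\beta}}$; and the Lax equations $\partial_{t_{\alpha,n}}\mathbf A=[\mathbf B_{\alpha,n},\mathbf A]$, $\partial_{\bar t_{\alpha,n}}\mathbf A=[\bar{\mathbf B}_{\alpha,n},\mathbf A]$ for all $\alpha$, $n\ge1$ and every $\mathbf A\in\{\mathbf L,\bar{\mathbf L},\mathbf U_\beta,\bar{\mathbf U}_\beta,\mathbf Q_\beta,\bar{\mathbf Q}_\beta\}$, where $\mathbf B_{\alpha,n}=(\mathbf L^n\mathbf U_\alpha)_{\ge0}$, $\bar{\mathbf B}_{\alpha,n}=(\bar{\mathbf L}^n\bar{\mathbf U}_\alpha)_{<0}$. **Wave operators.** For a solution, wave operators are $\hat{\mathbf W}(\mathbf s)=\sum_{j\ge0}w_j(\mathbf s)e^{-j\partial_s}$, $w_0=1_N$, and $\hat{\bar{\mathbf W}}(\mathbf s)=\sum_{j\ge0}\bar w_j(\mathbf s)e^{j\partial_s}$, $\bar w_0\in GL(N,\mathbb C)$, such that $\mathbf L\hat{\mathbf W}=\hat{\mathbf W}e^{\partial_s}$, $\mathbf U_\alpha\hat{\mathbf W}=\hat{\mathbf W}E_\alpha$, $\mathbf Q_\alpha\hat{\mathbf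 W}=\hat{\mathbf W}e^{-\partial_{s_\alpha}}$, $\bar{\mathbf L}\hat{\bar{\mathbf W}}=\hat{\bar{\mathbf W}}e^{-\partial_s}$, $\bar{\mathbf U}_\alpha\hat{\bar{\mathbf W}}=\hat{\bar{\mathbf W}}E_\alpha$, $\bar{\mathbf Q}_\alpha\hat{\bar{\mathbf W}}=\hat{\bar{\mathbf W}}e^{-\partial_{s_\alpha}}$ and $\partial_{t_{\alpha,n}}\hat{\mathbf W}=\mathbf B_{\alpha,n}\hat{\mathbf W}-\hat{\mathbf W}e^{n\partial_s}E_\alpha$, $\partial_{\bar t_{\alpha,n}}\hat{\mathbf W}=\bar{\mathbf B}_{\alpha,n}\hat{\mathbf W}$, $\partial_{t_{\alpha,n}}\hat{\bar{\mathbf W}}=\mathbf B_{\alpha,n}\hat{\bar{\mathbf W}}$, $\partial_{\bar t_{\alpha,n}}\hat{\bar{\mathbf W}}=\bar{\mathbf B}_{\alpha,n}\hat{\bar{\mathbf W}}-\hat{\bar{\mathbf W}}e^{-n\partial_s}E_\alpha$. **Wave functions.** The wave functions are $\boldsymbol\Psi=\sum_jw_j\,\mathrm{diag}_\alpha(z^{s_\alpha-j}e^{\xi(\mathbf t_\alpha,z)})$ and $\bar{\boldsymbol\Psi}=\sum_j\bar w_j\,\mathrm{diag}_\alpha(z^{s_\alpha+j}e^{\xi(\bar{\mathbf t}_\alpha,z^{-1})})$. Writing $\hat{\mathbf W}^{-1}(\mathbf s)=\sum_je^{-j\partial_s}w_j^*(\mathbf s+\mathbf 1)$ and $\hat{\bar{\mathbf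 W}}^{-1}(\mathbf s)=\sum_je^{j\partial_s}\bar w_j^*(\mathbf s+\mathbf 1)$, the adjoint wave functions are $\boldsymbol\Psi^*=\sum_j\mathrm{diag}_\alpha(z^{-s_\alpha-j}e^{-\xi(\mathbf t_\alpha,z)})w_j^*(\mathbf s)$ and $\bar{\boldsymbol\Psi}^*=\sum_j\mathrm{diag}_\alpha(z^{-s_\alpha+j}e^{-\xi(\bar{\mathbf t}_\alpha,z^{-1})})\bar w_j^*(\mathbf s)$. **Integrals.** $C_\infty$ is a circle around $\infty$ (a big circle), $C_0$ a small circle around $0$, with the same orientation; both integrals mean $2\pi i$ times the coefficient of $z^{-1}$ of the formal series in the integrand, expanded as a formal power series in $\mathbf t-\mathbf t'$ and $\bar{\mathbf t}-\bar{\mathbf t}'$. *)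

(* Defs.v *)
From HB Require Import structures.
From mathcomp Require Import all_boot all_order all_algebra.
From mathcomp Require Import complex.
From mathcomp Require Import all_classical all_reals all_analysis.
Set Implicit Arguments.
Unset Strict Implicit.
Unset Printing Implicit Defensive.
Import Order.TTheory GRing.Theory Num.Theory.
Import numFieldNormedType.Exports.
Local Open Scope classical_set_scope.
Local Open Scope ring_scope.

(* [(false, alpha, k)] indexes t_{alpha,k+1} and [(true, alpha, k)] indexes
   \bar t_{alpha,k+1}: the second index of a time is k >= 1 on paper. *)
Definition tindex (N : nat) : Type := (bool * 'I_N * nat)%type.

(* A point (t, \bar t): all the (infinitely many) complex times. *)
Definition times (R : realType) (N : nat) : Type := tindex N -> R[i].

Definition tshift (R : realType) (N : nat) (x : times R N) (i : tindex N)
    (h : R[i]) : times R N :=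
  fun j => if j == i then x j + h else x j.

(* The time domain D on which the coefficients live is only required to be open
   along every coordinate line, which is what partial derivatives need. *)
Definition line_open (R : realType) (N : nat) (D : set (times R N)) : Prop :=
  forall x i, D x -> \forall h \near nbhs (0 : R[i]^o), D (tshift x i h).

Definition slice (R : realType) (N : nat) (f : times R N -> R[i])
    (i : tindex N) (x : times R N) : R[i]^o -> R[i]^o :=
  fun h => f (tshift x i h).

Definition pderiv (R : realType) (N : nat) (i : tindex N)
    (f : times R N -> R[i]) : times R N -> R[i] :=
  fun x => derive1 (slice f i x) 0.

Definition pderivs (R : realType) (N : nat) (l : seq (tindex N))
    (f : times R N -> R[i]) : times R N -> R[i] :=
  foldr (@pderiv R N) f l.

(* Infinitely differentiable in the times: all iterated partial derivatives
   exist at the points of D and mixed ones do not depend on the order. *)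
Definition smooth (R : realType) (N : nat) (D : set (times R N))
    (f : times R N -> R[i]) : Prop :=
  forall l : seq (tindex N),
    (forall i x, D x -> derivable (slice (pderivs l f) i x) 0 1) /\
    (forall i j x, D x ->
       pderivs [:: i, j & l] f x = pderivs [:: j, i & l] f x).

Definition coef (R : realType) (N : nat) : Type :=
  'rV[int]_N -> times R N -> 'M[R[i]]_N.

Definition smooth_coef (R : realType) (N : nat) (D : set (times R N))
    (a : coef R N) : Prop :=
  forall s k l, smooth D (fun x => a s x k l).

(* An operator is the family of its coefficients on the shifts e^{v.d_s}, v in
   Z^N: [A v] is the coefficient of prod_alpha e^{v_alpha d_{s_alpha}}, so that
   e^{j d_s} is the shift with v = (j, ..., j) = [const_mx j]. *)
Definition diffop (R : realType) (N : nat) : Type :=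
  'rV[int]_N -> coef R N.

(* (a e^{u.d_s}) (b e^{v.d_s}) = a(s) b(s + u) e^{(u+v).d_s}.  The sum over u is
   finite (it is the finitely supported sum of fsbigop) for any two operators
   that are infinite in at most one and the same direction. *)
Definition opmul (R : realType) (N : nat) (A B : diffop R N) : diffop R N :=
  fun v s x =>
    \sum_(u \in [set: 'rV[int]_N]) (A u s x *m B (v - u) (s + u) x).

Notation "A *o B" := (opmul A B) (at level 40, left associativity).

Definition opcoef (R : realType) (N : nat) (a : coef R N) : diffop R N :=
  fun v s x => if v == 0 then a s x else 0.

Definition opconst (R : realType) (N : nat) (M : 'M[R[i]]_N) : diffop R N :=
  opcoef (fun _ _ => M).

Definition op1 (R : realType) (N : nat) : diffop R N := opconst 1%:M.

Arguments op1 : clear implicits.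

Definition opE (R : realType) (N : nat) (alpha : 'I_N) : diffop R N :=
  opconst (delta_mx alpha alpha).

Arguments opE R {N} alpha.

(* e^{u.d_s} *)
Definition opshift (R : realType) (N : nat) (u : 'rV[int]_N) : diffop R N :=
  fun v s x => if v == u then 1%:M else 0.

Arguments opshift R {N} u.

(* e^{j d_s} *)
Definition opexp (R : realType) (N : nat) (j : int) : diffop R N :=
  opshift R (const_mx j).

Arguments opexp : clear implicits.

(* e^{- d_{s_alpha}} *)
Definition opdown (R : realType) (N : nat) (alpha : 'I_N) : diffop R N :=
  opshift R (- delta_mx 0 alpha).

Arguments opdown R {N} alpha.

Definition oppow (R : realType) (N : nat) (A : diffop R N) (n : nat) :
    diffop R N :=
  iter n (opmul A) (op1 R N).

Definition opseries (R : realType) (N : nat) (T : nat -> diffop R N) :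
    diffop R N :=
  fun v s x => \sum_(j \in [set: nat]) T j v s x.

(* sum_{j >= 0} a_j e^{(d - j) d_s} *)
Definition lower (R : realType) (N : nat) (d : int) (a : nat -> coef R N) :
    diffop R N :=
  opseries (fun j => opcoef (a j) *o opexp R N (d - j%:Z)).

(* sum_{j >= 0} a_j e^{(d + j) d_s} *)
Definition upper (R : realType) (N : nat) (d : int) (a : nat -> coef R N) :
    diffop R N :=
  opseries (fun j => opcoef (a j) *o opexp R N (d + j%:Z)).

(* sum_{j >= 0} e^{-j d_s} a_j(s + 1) *)
Definition adj_lower (R : realType) (N : nat) (a : nat -> coef R N) :
    diffop R N :=
  opseries (fun j =>
    opexp R N (- j%:Z) *o opcoef (fun s => a j (s + const_mx 1))).

(* sum_{j >= 0} e^{j d_s} a_j(s + 1) *)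
Definition adj_upper (R : realType) (N : nat) (a : nat -> coef R N) :
    diffop R N :=
  opseries (fun j =>
    opexp R N j%:Z *o opcoef (fun s => a j (s + const_mx 1))).

(* A_{>= 0} and A_{< 0}, for operators A = sum_j a_j e^{j d_s} *)
Definition oppos (R : realType) (N : nat) (A : diffop R N) : diffop R N :=
  fun v s x => if `[< exists j : nat, v = const_mx j%:Z >] then A v s x else 0.

Definition opneg (R : realType) (N : nat) (A : diffop R N) : diffop R N :=
  fun v s x =>
    if `[< exists j : nat, v = const_mx (- j.+1%:Z) >] then A v s x else 0.

Definition dop (R : realType) (N : nat) (i : tindex N) (A : diffop R N) :
    diffop R N :=
  fun v s x => \matrix_(k, l) pderiv i (fun y => A v s y k l) x.

Definition opeq (R : realType) (N : nat) (D : set (times R N))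
    (A B : diffop R N) : Prop :=
  forall v s x, D x -> A v s x = B v s x.

Definition opcomm (R : realType) (N : nat) (A B : diffop R N) : diffop R N :=
  A *o B - B *o A.

(* B = A^{-1}.  It is always used together with the shape of B (infinite in the
   same direction as A), which makes B unique. *)
Definition opinverse (R : realType) (N : nat) (D : set (times R N))
    (A B : diffop R N) : Prop :=
  opeq D (A *o B) (op1 R N) /\ opeq D (B *o A) (op1 R N).

Definition opB (R : realType) (N : nat) (L : diffop R N)
    (U : 'I_N -> diffop R N) (alpha : 'I_N) (n : nat) : diffop R N :=
  oppos (oppow L n *o U alpha).

Definition opBb (R : realType) (N : nat) (Lb : diffop R N)
    (Ub : 'I_N -> diffop R N) (alpha : 'I_N) (n : nat) : diffop R N :=
  opneg (oppow Lb n *o Ub alpha).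

Section Hierarchy.
Context (R : realType) (N : nat) (D : set (times R N)).
Context (L Lb : diffop R N) (U Ub Q Qb : 'I_N -> diffop R N).

Local Notation "A =o B" := (opeq D A B) (at level 70, no associativity).

(* n stands for the flow of t_{alpha,n+1}, resp. \bar t_{alpha,n+1}. *)
Definition lax_equations (A : diffop R N) : Prop :=
  forall (alpha : 'I_N) (n : nat),
    dop (false, alpha, n) A =o opcomm (opB L U alpha n.+1) A /\
    dop (true, alpha, n) A =o opcomm (opBb Lb Ub alpha n.+1) A.

Record toda_shape : Prop := {
  toda_shape_L : exists b : nat -> coef R N,
    [/\ forall j, smooth_coef D (b j),
        forall s x, D x -> b 0%N s x = 1%:M & L =o lower 1 b];
  toda_shape_Lb : exists b : nat -> coef R N,
    [/\ forall j, smooth_coef D (b j),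
        forall s x, D x -> b 0%N s x \in unitmx & Lb =o upper (- 1) b];
  toda_shape_U : forall alpha, exists u : nat -> coef R N,
    [/\ forall j, smooth_coef D (u j),
        forall s x, D x -> u 0%N s x = delta_mx alpha alpha
      & U alpha =o lower 0 u];
  toda_shape_Ub : forall alpha, exists u : nat -> coef R N,
    (forall j, smooth_coef D (u j)) /\ Ub alpha =o upper 0 u;
  toda_shape_Q : forall alpha, exists p : nat -> coef R N,
    [/\ forall j, smooth_coef D (p j),
        forall s x, D x -> p 0%N s x = 1%:M
      & Q alpha =o opdown R alpha *o lower 0 p];
  toda_shape_Qb : forall alpha, exists p : nat -> coef R N,
    (forall j, smooth_coef D (p j)) /\
    Qb alpha =o opdown R alpha *o upper 0 p
}.

Record toda_algebra : Prop := {
  toda_LU : forall alpha, opcomm L (U alpha) =o 0;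
  toda_LQ : forall alpha, opcomm L (Q alpha) =o 0;
  toda_UQ : forall alpha beta, opcomm (U beta) (Q alpha) =o 0;
  toda_QQ : forall alpha beta, opcomm (Q alpha) (Q beta) =o 0;
  toda_UU : forall alpha beta,
    U alpha *o U beta =o (if alpha == beta then U beta else 0);
  toda_sumU : \sum_alpha U alpha =o op1 R N;
  toda_prodQ : opinverse D L (\big[@opmul R N/op1 R N]_alpha Q alpha);
  toda_LbUb : forall alpha, opcomm Lb (Ub alpha) =o 0;
  toda_LbQb : forall alpha, opcomm Lb (Qb alpha) =o 0;
  toda_UbQb : forall alpha beta, opcomm (Ub beta) (Qb alpha) =o 0;
  toda_QbQb : forall alpha beta, opcomm (Qb alpha) (Qb beta) =o 0;
  toda_UbUb : forall alpha beta,
    Ub alpha *o Ub beta =o (if alpha == beta then Ub beta else 0);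
  toda_sumUb : \sum_alpha Ub alpha =o op1 R N;
  toda_prodQb : \big[@opmul R N/op1 R N]_alpha Qb alpha =o Lb;
  (* [upper 1 c] is \bar L^{-1}, and [oppow A (alpha == beta)] is
     A^{delta_{alpha beta}} *)
  toda_link : exists c : nat -> coef R N,
    [/\ forall j, smooth_coef D (c j),
        opinverse D Lb (upper 1 c)
      & forall alpha,
          Q alpha *o (\sum_beta U beta *o oppow L (alpha == beta)) =o
          Qb alpha *o (\sum_beta Ub beta *o oppow (upper 1 c) (alpha == beta))]
}.

Record toda_lax : Prop := {
  toda_lax_L : lax_equations L;
  toda_lax_Lb : lax_equations Lb;
  toda_lax_U : forall beta, lax_equations (U beta);
  toda_lax_Ub : forall beta, lax_equations (Ub beta);
  toda_lax_Q : forall beta, lax_equations (Q beta);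
  toda_lax_Qb : forall beta, lax_equations (Qb beta)
}.

Definition toda_solution : Prop := [/\ toda_shape, toda_algebra & toda_lax].

Record wave_operators (w wb : nat -> coef R N) : Prop := {
  wave_smooth : forall j, smooth_coef D (w j);
  wave_smoothb : forall j, smooth_coef D (wb j);
  wave_w0 : forall s x, D x -> w 0%N s x = 1%:M;
  wave_wb0 : forall s x, D x -> wb 0%N s x \in unitmx;
  wave_L : L *o lower 0 w =o lower 0 w *o opexp R N 1;
  wave_U : forall alpha, U alpha *o lower 0 w =o lower 0 w *o opE R alpha;
  wave_Q : forall alpha, Q alpha *o lower 0 w =o lower 0 w *o opdown R alpha;
  wave_Lb : Lb *o upper 0 wb =o upper 0 wb *o opexp R N (- 1);
  wave_Ub : forall alpha, Ub alpha *o upper 0 wb =o upper 0 wb *o opE R alpha;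
  wave_Qb : forall alpha,
    Qb alpha *o upper 0 wb =o upper 0 wb *o opdown R alpha;
  wave_dt : forall alpha (n : nat), dop (false, alpha, n) (lower 0 w) =o
    opB L U alpha n.+1 *o lower 0 w
      - lower 0 w *o opexp R N n.+1%:Z *o opE R alpha;
  wave_dtb : forall alpha (n : nat), dop (true, alpha, n) (lower 0 w) =o
    opBb Lb Ub alpha n.+1 *o lower 0 w;
  wave_dtW : forall alpha (n : nat), dop (false, alpha, n) (upper 0 wb) =o
    opB L U alpha n.+1 *o upper 0 wb;
  wave_dtbW : forall alpha (n : nat), dop (true, alpha, n) (upper 0 wb) =o
    opBb Lb Ub alpha n.+1 *o upper 0 wb
      - upper 0 wb *o opexp R N (- n.+1%:Z) *o opE R alpha
}.

End Hierarchy.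

(* With y = t - t' and \bar y = \bar t - \bar t', the two integrands are
     sum_{j,k} w_j(s,t) diag_alpha(z^{s_alpha - s'_alpha - j - k}
                                   e^{xi(y_alpha,z)}) w^*_k(s',t'),
     sum_{j,k} \bar w_j(s,t) diag_alpha(z^{s_alpha - s'_alpha + j + k}
                            e^{xi(\bar y_alpha,z^{-1})}) \bar w^*_k(s',t'),
   where (t', \bar t') = (t - y, \bar t - \bar y) is Taylor expanded at
   (t, \bar t).  They are formal power series in (y, \bar y) whose coefficients
   are Laurent series in z.  A monomial of (y, \bar y) involves finitely many
   variables, so it is given by some K and an exponent in [mexp N K]: the
   monomial in the variables y_{alpha,k+1} (index [(false, alpha, k)]) and
   \bar y_{alpha,k+1} (index [(true, alpha, k)]) with k < K. *)
Definition mindex (N K : nat) : finType := (bool * 'I_N * 'I_K)%type.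

Definition tindex_of (N K : nat) (i : mindex N K) : tindex N :=
  (i.1.1, i.1.2, val i.2).

Definition mexp (N K : nat) : Type := {ffun mindex N K -> nat}.

Definition mfact (N K : nat) (m : mexp N K) : nat := (\prod_i (m i)`!)%N.

Definition mderiv (R : realType) (N K : nat) (m : mexp N K)
    (f : times R N -> R[i]) : times R N -> R[i] :=
  foldr (fun i g => iter (m i) (pderiv (tindex_of i)) g) f (enum (mindex N K)).

(* coefficient of the monomial m in the Taylor expansion in (y, \bar y) of
   a(s; t - y, \bar t - \bar y) at x = (t, \bar t) *)
Definition taylor_coef (R : realType) (N K : nat) (m : mexp N K) (a : coef R N)
    (s : 'rV[int]_N) (x : times R N) : 'M[R[i]]_N :=
  \matrix_(k, l) ((-1) ^+ (\sum_i m i)%N / (mfact m)%:R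
                  * mderiv m (fun y => a s y k l) x).

(* coefficient of z^e times the monomial p in e^{xi(y_alpha, z)} (b = false),
   resp. e^{xi(\bar y_alpha, z^{-1})} (b = true): expanding the exponentials,
   e^{xi(y_alpha, z)} = prod_k sum_p y_{alpha,k}^p z^{k p} / p!  *)
Definition exp_xi_coef (R : realType) (N K : nat) (b : bool) (alpha : 'I_N)
    (p : mexp N K) (e : int) : R[i] :=
  let weight : nat := (\sum_i (val i.2).+1 * p i)%N in
  if [forall i, (p i != 0%N) ==> (i.1 == (b, alpha))]
     && (e == (-1) ^+ b * weight%:Z)
  then (mfact p)%:R^-1 else 0.

Arguments exp_xi_coef R {N K} b alpha p e.

(* coefficient of z^n times the monomial m in Psi(s,t,\bar t;z)
   Psi^*(s',t',\bar t';z) (b = false), resp. \bar Psi \bar Psi^* (b = true);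
   p runs over the exponents with p <= m, and the sum over (j, k) is finite. *)
Definition wave_product (R : realType) (N K : nat) (b : bool)
    (w ws : nat -> coef R N) (s s' : 'rV[int]_N) (x : times R N)
    (m : mexp N K) (n : int) : 'M[R[i]]_N :=
  \sum_(p : {dffun forall i : mindex N K, 'I_(m i).+1})
    \sum_(jk \in [set: nat * nat])
      (w jk.1 s x
       *m diag_mx (\row_alpha exp_xi_coef R b alpha
            ([ffun i => val (p i)] : mexp N K)
            (n - (s 0 alpha - s' 0 alpha - (-1) ^+ b * (jk.1 + jk.2)%N%:Z)))
       *m taylor_coef ([ffun i => (m i - p i)%N] : mexp N K) (ws jk.2) s' x).

Definition oint (R : realType) (N : nat) (F : int -> 'M[R[i]]_N) :
    'M[R[i]]_N :=
  (0 +i* (2 * pi))%C *: F (- 1).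

Definition bilinear_identity (R : realType) (N : nat) (D : set (times R N))
    (w wb ws wbs : nat -> coef R N) : Prop :=
  forall (s s' : 'rV[int]_N) (x : times R N), D x ->
  forall (K : nat) (m : mexp N K),
    oint (wave_product false w ws s s' x m)
    = oint (wave_product true wb wbs s s' x m).

(* Main.v *)
(* At a fixed point (t, \bar t) an operator is a family of coefficients indexed
   by Z^N x Z^N, and all constant operators that occur (shifts, E_alpha,
   exponential factors) are diagonal with one shift per entry.  For b = false
   (series in e^{-d_s}) and b = true (series in e^{d_s}) write W for the wave
   operator and V for the operator built from the adjoint coefficients.

   Expanding in y = t - t', the residue of Psi(s) Psi^*(s') at y^m is the
   coefficient of e^{(s' - s).d_s - d_s} in W Y_{s' - s} V_m, where
   Y_u = e^{u.d_s} sum_alpha E_alpha e^{- u_alpha d_s} and V_m is the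
   coefficient of y^m in e^{xi(y, e^{d_s})} V(t - y).  So the bilinear identity
   says that W Y_u V_m is the same operator for b = false and b = true, for all u
   and m.

   (i) The evolution equations turn V_m into V C_m with C_m a finite operator
   independent of b.  The remaining case m = 0 is the link condition when
   u = -e_alpha; it is multiplicative in u and Y_u only depends on u modulo
   (1, ..., 1), so it follows for all u.

   (ii) For u = 0 and m = 0, W V is at once a series in e^{-d_s} and in e^{d_s},
   hence 1; V W is then an idempotent with leading coefficient 1, hence 1.  For
   u = 0 and m of degree 1 the identity compares (dW) V with its barred analogue;
   taking nonnegative and negative parts yields the evolution equations.  For
   u = -e_alpha and m = 0 it is the link condition, and everything else holds
   because conjugation by W is multiplicative. *)
Require Import Defs.
From HB Require Import structures.
From mathcomp Require Import all_boot all_order all_algebra.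
From mathcomp Require Import complex.
From mathcomp Require Import all_classical all_reals all_analysis.
From mathcomp Require Import zify.
Set Implicit Arguments.
Unset Strict Implicit.
Unset Printing Implicit Defensive.
Import Order.TTheory GRing.Theory Num.Theory.
Import numFieldNormedType.Exports.
Local Open Scope classical_set_scope.
Local Open Scope ring_scope.

(** * Operators at a fixed point *)

(** An operator product is a sum over Z^N that takes the value 0 when its support is infinite, so
    associativity and distributivity are available only for operators infinite in a common
    direction. Every operator therefore carries a band condition, and a factor can be shared by the
    two sides only if it is finite. B_{alpha,n} is finite, being the truncation of a series infinite
    in one direction; this is why C_m can multiply both V and its barred analogue. C_m comes from a
    recursion. In coefficients of y, differentiation in y_i gives (m_i + 1) V_{m + e_i} = E V_m - d
    V_m, where E is the constant operator of the flow. Inserting V_m = V C_m and dV = E V - V B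
    makes E cancel and leaves (m_i + 1) C_{m + e_i} = B C_m - d C_m. Each monomial is reached by
    finitely many such steps, so the infinitely many times cause no convergence question. *)

Lemma fsum_seq (V : nmodType) (T : choiceType) (r : seq T) (f : T -> V) :
  uniq r -> (forall t, f t <> 0 -> t \in r) ->
  \sum_(t \in [set: T]) f t = \sum_(t <- r) f t.
Proof.
move=> ur fr.
have -> : \sum_(t \in [set: T]) f t = \sum_(t \in [set` r]) f t.
  apply/esym/fsbig_widen => // t [_ /= tr]; apply: contra_notP tr => ft.
  exact: fr.
exact: (esym (fsbig_seq _ _ ur)).
Qed.

Section PointwiseOperators.
Context (F : comNzRingType) (N : nat) (hN : (0 < N)%N).
Local Notation vec := ('rV[int]_N).
Local Notation pop := (vec -> vec -> 'M[F]_N).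
Implicit Types (A B C : pop) (S : seq vec) (b : bool).

(** Exponents of a one-sided series run through d - sg b * j, downwards for [false] and upwards for
    [true]; one parameter thus serves both the plain and the barred objects. *)
Definition sg b : int := (-1) ^+ b.

Lemma const_inj (e e' : int) :
  const_mx e = const_mx e' :> vec -> e = e'.
Proof. by move=> /matrixP/(_ 0 (Ordinal hN)); rewrite !mxE. Qed.

Lemma const0 : const_mx 0 = 0 :> vec.
Proof. by apply/matrixP => i j; rewrite !mxE. Qed.

Lemma sgP b : sg b = 1 \/ sg b = -1.
Proof. by case: b; [right|left]. Qed.

Lemma sgK b e : sg b * (sg b * e) = e.
Proof. by rewrite mulrA -expr2 sqrr_sign mul1r. Qed.

Lemma sg_inj b (i j : nat) : sg b * i%:Z = sg b * j%:Z -> i = j.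
Proof. by move=> /(congr1 ( *%R (sg b))); rewrite !sgK => -[]. Qed.

Definition pmul A B : pop :=
  fun v s => \sum_(u \in [set: vec]) (A u s *m B (v - u) (s + u)).

(** Support in finitely many rays of direction (1, ..., 1). Several starting points are allowed
    because the shifts e^{d_{s_alpha}} leave the line of the e^{j d_s}. *)
Definition bandF b S A := forall v s, A v s <> 0 ->
  exists2 f, f \in S & exists j : nat, v = f - const_mx (sg b * j%:Z).

(** If u lies on the ray from f and v - u on the ray from g, with parameters j and k, then sg b * (j
    + k) is f + g - v in every coordinate. One coordinate bounds j, and 0 < N provides one. *)
Definition window_size (f g v : vec) : nat :=
  absz (f 0 (Ordinal hN) + g 0 (Ordinal hN) - v 0 (Ordinal hN))%R.

Definition window b S S' (v : vec) : seq vec := undup (flatten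
  [seq flatten [seq [seq f - const_mx (sg b * j%:Z)
                    | j <- iota 0 (window_size f g v).+1]
               | g <- S'] | f <- S]).

Lemma window_uniq b S S' v : uniq (window b S S' v).
Proof. exact: undup_uniq. Qed.

Lemma mem_window b S S' (v u : vec) :
  (exists2 f, f \in S & exists j : nat, u = f - const_mx (sg b * j%:Z)) ->
  (exists2 g, g \in S' & exists j : nat, v - u = g - const_mx (sg b * j%:Z)) ->
  u \in window b S S' v.
Proof.
move=> [f fS [j ->]] [g gS' [k e]]; rewrite mem_undup.
apply/flattenP; eexists; first by apply/mapP; exists f.
apply/flattenP; eexists; first by apply/mapP; exists g.
apply/mapP; exists j => //; rewrite mem_iota add0n ltnS /=.
have /matrixP/(_ 0 (Ordinal hN)) := e; rewrite !mxE /window_size.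
have aux (x y z : int) : z - (x - sg b * j%:Z) = y - sg b * k%:Z ->
    (j <= absz (x + y - z)%R)%N.
  by have [->|->] := sgP b; lia.
exact: aux.
Qed.

Lemma mulmx_neq0l (A B : 'M[F]_N) : A *m B <> 0 -> A <> 0.
Proof. by move=> + A0; rewrite A0 mul0mx. Qed.

Lemma mulmx_neq0r (A B : 'M[F]_N) : A *m B <> 0 -> B <> 0.
Proof. by move=> + A0; rewrite A0 mulmx0. Qed.

Lemma mul_diagE (A : 'M[F]_N) d i j : (A *m diag_mx d) i j = A i j * d 0 j.
Proof. by rewrite mul_mx_diag mxE. Qed.

Lemma sum_neq0 (V : nmodType) (T : eqType) (r : seq T) (f : T -> V) :
  \sum_(t <- r) f t <> 0 -> exists2 t, t \in r & f t <> 0.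
Proof.
move=> h; apply: contrapT => k; apply: h; rewrite big_seq big1 // => t tr.
by apply: contrapT => ft; apply: k; exists t.
Qed.

Lemma pmulE b S S' A B v s : bandF b S A -> bandF b S' B ->
  pmul A B v s = \sum_(u <- window b S S' v) A u s *m B (v - u) (s + u).
Proof.
move=> hA hB; apply: fsum_seq (window_uniq _ _ _ _) _ => u h.
by apply: mem_window; [exact: hA (mulmx_neq0l h)|exact: hB (mulmx_neq0r h)].
Qed.

Definition addS S S' := flatten [seq [seq f + g | g <- S'] | f <- S].

Lemma bandF_mul b S S' A B : bandF b S A -> bandF b S' B ->
  bandF b (addS S S') (pmul A B).
Proof.
move=> hA hB v s; rewrite (pmulE _ _ hA hB) => /sum_neq0[u _ h].
have [f fS [j uE]] := hA _ _ (mulmx_neq0l h).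
have [g gS [k vE]] := hB _ _ (mulmx_neq0r h).
exists (f + g).
  apply/flattenP; eexists; first by apply/mapP; exists f.
  by apply/mapP; exists g.
exists (j + k)%N; rewrite -[v](subrK u) vE uE.
by apply/matrixP => x y; rewrite !mxE; lia.
Qed.

Lemma pmulA b S S' S'' A B C :
  bandF b S A -> bandF b S' B -> bandF b S'' C ->
  pmul A (pmul B C) = pmul (pmul A B) C.
Proof.
move=> hA hB hC; apply/funext => v; apply/funext => s.
have hAB := bandF_mul hA hB; have hBC := bandF_mul hB hC.
rewrite (pmulE _ _ hA hBC) (pmulE _ _ hAB hC).
(* Neither window depends on the summation variable of the other sum, so once both are inserted the
   order of summation can be exchanged. *)
set rt := window _ _ _ v; set ru := window _ _ _ v.
transitivity (\sum_(t <- rt) \sum_(u <- ru)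
  A t s *m B (u - t) (s + t) *m C (v - u) (s + u)).
  apply: eq_bigr => t _.
  (* The ray containing t is known only when A t s is nonzero; it is what places the inner support
     inside [ru]. *)
  have [->|/eqP At] := eqVneq (A t s) 0.
    by rewrite mul0mx big1 // => u _; rewrite !mul0mx.
  under [RHS]eq_bigr => u _ do rewrite -mulmxA.
  rewrite -mulmx_sumr; congr (_ *m _).
  rewrite /pmul (@fsum_seq _ _ [seq u - t | u <- ru]); last 2 first.
  - by rewrite map_inj_uniq ?window_uniq // => ? ? /addIr.
  - move=> r h; apply/mapP; exists (r + t); last by rewrite addrK.
    have [f fS [j tE]] := hA _ _ At.
    have [g gS [k rE]] := hB _ _ (mulmx_neq0l h).
    apply: mem_window; last first.
      by have := hC _ _ (mulmx_neq0r h); rewrite opprD addrA addrAC.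
    exists (f + g).
      apply/flattenP; eexists; first by apply/mapP; exists f.
      by apply/mapP; exists g.
    exists (j + k)%N; rewrite rE tE.
    by apply/matrixP => x y; rewrite !mxE; lia.
  rewrite big_map; apply: eq_bigr => u _; congr (_ *m C _ _).
    by rewrite opprB addrA subrK.
  by rewrite -addrA [t + _]addrC subrK.
rewrite exchange_big; apply: eq_bigr => u _ /=.
have [->|/eqP Cu] := eqVneq (C (v - u) (s + u)) 0.
  by rewrite mulmx0 big1 // => t _; rewrite mulmx0.
rewrite -mulmx_suml; congr (_ *m _).
rewrite /pmul (@fsum_seq _ _ rt) ?window_uniq // => t h.
apply: mem_window; first exact: hA (mulmx_neq0l h).
have [g gS [k rE]] := hB _ _ (mulmx_neq0r h).
have [g' gS' [k' rE']] := hC _ _ Cu.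
exists (g + g').
  apply/flattenP; eexists; first by apply/mapP; exists g.
  by apply/mapP; exists g'.
exists (k + k')%N; rewrite -[v](subrK u) rE' -addrA rE.
by apply/matrixP => x y; rewrite !mxE; lia.
Qed.

Definition bnd b A := exists S, bandF b S A.

Lemma bnd_mul b A B : bnd b A -> bnd b B -> bnd b (pmul A B).
Proof. by move=> [S hA] [S' hB]; exists (addS S S'); exact: bandF_mul. Qed.

Lemma popD A B v s : (A + B) v s = A v s + B v s. Proof. by []. Qed.
Lemma popN A v s : (- A) v s = - A v s. Proof. by []. Qed.

Lemma bandF_add b S S' A B : bandF b S A -> bandF b S' B ->
  bandF b (S ++ S') (A + B).
Proof.
move=> hA hB v s h; have [A0|/eqP A0] := eqVneq (A v s) 0.
  have /hB[f fS e] : B v s <> 0.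
    by move=> B0; apply: h; rewrite popD A0 B0 addr0.
  by exists f => //; rewrite mem_cat fS orbT.
by have [f fS e] := hA _ _ A0; exists f => //; rewrite mem_cat fS.
Qed.

Lemma bandF_opp b S A : bandF b S A -> bandF b S (- A).
Proof.
move=> hA v s h; apply: (hA v s) => A0; apply: h.
by rewrite popN A0 oppr0.
Qed.

Lemma bnd_add b A B : bnd b A -> bnd b B -> bnd b (A + B).
Proof. by move=> [S hA] [S' hB]; exists (S ++ S'); exact: bandF_add. Qed.

Lemma bnd_opp b A : bnd b A -> bnd b (- A).
Proof. by move=> [S hA]; exists S; exact: bandF_opp. Qed.

Lemma bnd_sub b A B : bnd b A -> bnd b B -> bnd b (A - B).
Proof. by move=> hA hB; apply: bnd_add => //; exact: bnd_opp. Qed.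

Lemma bnd0 b : bnd b (0 : pop).
Proof. by exists [::] => v s. Qed.

Lemma bnd_sum b (T : Type) (r : seq T) (P : pred T) (f : T -> pop) :
  (forall t, bnd b (f t)) -> bnd b (\sum_(t <- r | P t) f t).
Proof.
by move=> h; elim/big_ind: _ => // [|? ? ? ?]; [exact: bnd0|exact: bnd_add].
Qed.

Lemma bnd_pmulA b A B C : bnd b A -> bnd b B -> bnd b C ->
  pmul A (pmul B C) = pmul (pmul A B) C.
Proof. by move=> [S hA] [S' hB] [S'' hC]; exact: pmulA hA hB hC. Qed.

Lemma pmulDl b A B C : bnd b A -> bnd b B -> bnd b C ->
  pmul (A + B) C = pmul A C + pmul B C.
Proof.
move=> [S hA] [S' hB] [S'' hC]; apply/funext => v; apply/funext => s.
(* Both supports are enlarged to [S ++ S'] so that the three sums run over the same window. *)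
have hA' : bandF b (S ++ S') A.
  by rewrite -[A]addr0; apply: bandF_add.
have hB' : bandF b (S ++ S') B.
  by rewrite -[B]add0r; apply: bandF_add.
rewrite popD.
rewrite (pmulE _ _ (bandF_add hA hB) hC) (pmulE _ _ hA' hC) (pmulE _ _ hB' hC).
by rewrite -big_split; apply: eq_bigr => u _; rewrite popD mulmxDl.
Qed.

Lemma pmulDr b A B C : bnd b A -> bnd b B -> bnd b C ->
  pmul C (A + B) = pmul C A + pmul C B.
Proof.
move=> [S hA] [S' hB] [S'' hC]; apply/funext => v; apply/funext => s.
have hA' : bandF b (S ++ S') A.
  by rewrite -[A]addr0; apply: bandF_add.
have hB' : bandF b (S ++ S') B.
  by rewrite -[B]add0r; apply: bandF_add.
rewrite popD.
rewrite (pmulE _ _ hC (bandF_add hA hB)) (pmulE _ _ hC hA') (pmulE _ _ hC hB').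
by rewrite -big_split; apply: eq_bigr => u _; rewrite popD mulmxDr.
Qed.

Lemma pmul0l A : pmul 0 A = 0.
Proof.
apply/funext => v; apply/funext => s; rewrite /pmul fsbig1 // => u _.
by rewrite mul0mx.
Qed.

Lemma pmul0r A : pmul A 0 = 0.
Proof.
apply/funext => v; apply/funext => s; rewrite /pmul fsbig1 // => u _.
by rewrite mulmx0.
Qed.

Lemma pmulNl b A B : bnd b A -> bnd b B -> pmul (- A) B = - pmul A B.
Proof.
move=> hA hB; apply/eqP; rewrite -addr_eq0 -(pmulDl (b := b)) ?addNr ?pmul0l //.
exact: bnd_opp.
Qed.

Lemma pmulNr b A B : bnd b A -> bnd b B -> pmul A (- B) = - pmul A B.
Proof.
move=> hA hB; apply/eqP; rewrite -addr_eq0 -(pmulDr (b := b)) ?addNr ?pmul0r //.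
exact: bnd_opp.
Qed.

Lemma pmul_suml b (T : Type) (r : seq T) (f : T -> pop) B :
  (forall t, bnd b (f t)) -> bnd b B ->
  pmul (\sum_(t <- r) f t) B = \sum_(t <- r) pmul (f t) B.
Proof.
move=> hf hB; elim: r => [|t r IH]; first by rewrite !big_nil pmul0l.
by rewrite !big_cons (pmulDl (b := b)) ?IH //; exact: bnd_sum.
Qed.

Lemma pmul_sumr b (T : Type) (r : seq T) (f : T -> pop) B :
  (forall t, bnd b (f t)) -> bnd b B ->
  pmul B (\sum_(t <- r) f t) = \sum_(t <- r) pmul B (f t).
Proof.
move=> hf hB; elim: r => [|t r IH]; first by rewrite !big_nil pmul0r.
by rewrite !big_cons (pmulDr (b := b)) ?IH //; exact: bnd_sum.
Qed.

Lemma bnd_natmul b A n : bnd b A -> bnd b (A *+ n).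
Proof.
by move=> h; elim: n => [|n IH]; rewrite ?mulr0n ?mulrS; [exact: bnd0|exact: bnd_add].
Qed.

Lemma pmulnr b A B n : bnd b A -> bnd b B -> pmul A (B *+ n) = pmul A B *+ n.
Proof.
move=> h h'; elim: n => [|n IH]; first by rewrite !mulr0n pmul0r.
by rewrite !mulrS (pmulDr (b := b)) ?IH //; exact: bnd_natmul.
Qed.

Lemma pmulnl b A B n : bnd b A -> bnd b B -> pmul (A *+ n) B = pmul A B *+ n.
Proof.
move=> h h'; elim: n => [|n IH]; first by rewrite !mulr0n pmul0l.
by rewrite !mulrS (pmulDl (b := b)) ?IH //; exact: bnd_natmul.
Qed.

(* Every constant operator of the hierarchy is diagonal, with at most one shift
   in each diagonal entry. *)
Definition dm (a : 'I_N -> F) (u : 'I_N -> vec) : pop :=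
  fun v s => diag_mx (\row_al (a al *+ (v == u al))).

Lemma bnd_dm b a u : bnd b (dm a u).
Proof.
exists [seq u al | al <- enum 'I_N] => v s h; exists v; last first.
  by exists 0%N; rewrite mulr0 const0 subr0.
apply/mapP; apply: contrapT => k; apply: h; apply/matrixP => i j.
rewrite !mxE; case: (v =P u i) => [vE|_]; last by rewrite mulr0n mul0rn.
by case: k; exists i; rewrite ?mem_enum.
Qed.

(** A diagonal operator has finite support, so no band condition on [B] is needed; row i meets the
    single shift u i. For multiplication on the right, the column decides. *)
Lemma dmul_dmE a u B v s i j :
  pmul (dm a u) B v s i j = a i * B (v - u i) (s + u i) i j.
Proof.
pose r := undup [seq u al | al <- enum 'I_N].
have ur : uniq r by exact: undup_uniq.
have inr al : u al \in r.
  by rewrite mem_undup; apply/mapP; exists al; rewrite ?mem_enum.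
rewrite /pmul (fsum_seq ur) => [|t /mulmx_neq0l h]; last first.
  rewrite mem_undup; apply: contrapT => k; apply: h; apply/matrixP => x y.
  rewrite !mxE; case: (t =P u x) => [vE|_]; last by rewrite mulr0n mul0rn.
  by case: k; apply/mapP; exists x; rewrite ?mem_enum.
rewrite summxE (bigD1_seq (u i)) //= [X in _ + X]big1 => [|t tu].
  by rewrite addr0 mul_diag_mx !mxE eqxx mulr1n.
by rewrite mul_diag_mx !mxE (negPf tu) mulr0n mul0r.
Qed.

Lemma mul_dmE a u A v s i j :
  pmul A (dm a u) v s i j = A (v - u j) s i j * a j.
Proof.
pose r := undup [seq v - u al | al <- enum 'I_N].
have ur : uniq r by exact: undup_uniq.
have inr al : v - u al \in r.
  by rewrite mem_undup; apply/mapP; exists al; rewrite ?mem_enum.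
rewrite /pmul (fsum_seq ur) => [|t /mulmx_neq0r h]; last first.
  rewrite mem_undup; apply: contrapT => k; apply: h; apply/matrixP => x y.
  rewrite !mxE; case: (v - t =P u x) => [vE|_]; last by rewrite mulr0n mul0rn.
  by case: k; apply/mapP; exists x; rewrite ?mem_enum // -vE subKr.
rewrite summxE (bigD1_seq (v - u j)) //= [X in _ + X]big1 => [|t tu].
  by rewrite addr0 mul_mx_diag !mxE subKr eqxx mulr1n.
rewrite mul_mx_diag !mxE; case: eqP => [e|]; last by rewrite mulr0n mulr0.
by rewrite -e subKr eqxx in tu.
Qed.

Lemma dm_mul a u a' u' :
  pmul (dm a u) (dm a' u') = dm (fun al => a al * a' al)
                                (fun al => u al + u' al).
Proof.
apply/funext => v; apply/funext => s; apply/matrixP => i j.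
by rewrite dmul_dmE !mxE subr_eq [u' i + _]addrC !mulrnAr.
Qed.

Lemma dm_comm a u a' u' :
  pmul (dm a u) (dm a' u') = pmul (dm a' u') (dm a u).
Proof.
rewrite !dm_mul; congr dm; apply/funext => al; [exact: mulrC|exact: addrC].
Qed.

Definition dm1 : pop := dm (fun=> 1) (fun=> 0).

Lemma mul1dm A : pmul dm1 A = A.
Proof.
apply/funext => v; apply/funext => s; apply/matrixP => i j.
by rewrite dmul_dmE mul1r subr0 addr0.
Qed.

Lemma muldm1 A : pmul A dm1 = A.
Proof.
apply/funext => v; apply/funext => s; apply/matrixP => i j.
by rewrite mul_dmE mulr1 subr0.
Qed.

Lemma bnd_pmulA4 b A B C E : bnd b A -> bnd b B -> bnd b C -> bnd b E ->
  pmul (pmul A B) (pmul C E) = pmul (pmul A (pmul B C)) E.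
Proof.
move=> hA hB hC hE.
by rewrite (bnd_pmulA (bnd_mul hA hB) hC hE) -(bnd_pmulA hA hB hC).
Qed.

Lemma conj_mul b W V A B : bnd b W -> bnd b V -> bnd b A -> bnd b B ->
  pmul V W = dm1 ->
  pmul (pmul (pmul W A) V) (pmul (pmul W B) V) = pmul (pmul W (pmul A B)) V.
Proof.
move=> hW hV hA hB VW.
have [hWA hWB] := (bnd_mul hW hA, bnd_mul hW hB).
rewrite -(bnd_pmulA hWA hV (bnd_mul hWB hV)) (bnd_pmulA hV hWB hV) (bnd_pmulA hV hW hB).
by rewrite VW mul1dm (bnd_pmulA hWA hB hV) -(bnd_pmulA hW hA hB).
Qed.

End PointwiseOperators.

Section OperatorsAtAPoint.
Context (R : realType) (N : nat) (hN : (0 < N)%N).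
Local Notation vec := ('rV[int]_N).
Local Notation C := R[i].
Implicit Types (A B : diffop R N) (b : bool) (d : int) (x : times R N).

(** Freezing the times turns [opmul] into [pmul] by computation, which separates the algebra from
    the calculus. *)
Definition pt x A : vec -> vec -> 'M[C]_N := fun v s => A v s x.

Lemma pt_mul x A B : pt x (A *o B) = pmul (pt x A) (pt x B).
Proof. by []. Qed.

Lemma pt_shift x u : pt x (opshift R u) = dm (fun=> 1) (fun=> u).
Proof.
apply/funext => v; apply/funext => s; apply/matrixP => i j.
rewrite /pt /opshift !mxE; case: eqP => _; first by rewrite mxE mulr1n.
by rewrite mxE mulr0n mul0rn.
Qed.

Lemma pt_exp x e : pt x (opexp R N e) = dm (fun=> 1) (fun=> const_mx e).
Proof. exact: pt_shift. Qed.

Lemma pt_down x al :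
  pt x (opdown R al) = dm (fun=> 1) (fun=> - delta_mx 0 al).
Proof. exact: pt_shift. Qed.

Lemma pt_1 x : pt x (op1 R N) = @dm1 _ N.
Proof.
apply/funext => v; apply/funext => s; apply/matrixP => i j.
rewrite /pt /op1 /opconst /opcoef !mxE; case: eqP => _.
  by rewrite mxE mulr1n.
by rewrite mxE mulr0n mul0rn.
Qed.

Lemma pt_E x (al : 'I_N) :
  pt x (opE R al) = dm (fun be => (be == al)%:R) (fun=> 0).
Proof.
apply/funext => v; apply/funext => s; apply/matrixP => i j.
rewrite /pt /opE /opconst /opcoef !mxE; case: eqP => _; last first.
  by rewrite mxE mulr0n mul0rn.
rewrite mxE mulr1n; case: (i =P al) => [->|] /=; last by rewrite mul0rn.
by rewrite eq_sym; case: eqP.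
Qed.

Definition one_sided b d (a : nat -> coef R N) := if b then upper d a else lower d a.

Definition adj_one_sided b (a : nat -> coef R N) := if b then adj_upper a else adj_lower a.

Lemma genE b d a v s x : one_sided b d a v s x =
  \sum_(j \in [set: nat])
    (if v == const_mx (d - sg b * j%:Z) then a j s x else 0).
Proof.
rewrite /one_sided; case: b; rewrite /sg ?expr1 ?expr0; apply: eq_fsbigr => j _;
  apply/matrixP => i k;
  rewrite -[LHS]/(pmul (pt x (opcoef (a j))) (pt x (opexp R N _)) v s i k)
    pt_exp mul_dmE mulr1 /pt /opcoef subr_eq0 ?mulN1r ?opprK ?mul1r //.
Qed.

Lemma adjE b a v s x : adj_one_sided b a v s x =
  \sum_(j \in [set: nat])
    (if v == const_mx (- (sg b * j%:Z)) then a j (s + v + const_mx 1) x else 0).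
Proof.
rewrite /adj_one_sided; case: b; rewrite /sg ?expr1 ?expr0; apply: eq_fsbigr => j _;
  apply/matrixP => i k;
  rewrite -[LHS]/(pmul (pt x (opexp R N _)) (pt x (opcoef _)) v s i k)
    pt_exp dmul_dmE mul1r /pt /opcoef subr_eq0 ?mulN1r ?opprK ?mul1r;
  by case: eqP => // ->.
Qed.

Lemma gen_at b d a j s x : one_sided b d a (const_mx (d - sg b * j%:Z)) s x = a j s x.
Proof.
rewrite genE (@fsum_seq _ _ [:: j]) // ?big_seq1 ?eqxx // => k.
case: eqP => // /(const_inj hN)/addrI/oppr_inj/sg_inj -> _.
exact: mem_head.
Qed.

Lemma adj_at b a j s x : adj_one_sided b a (const_mx (- (sg b * j%:Z))) s x =
  a j (s + const_mx (- (sg b * j%:Z)) + const_mx 1) x.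
Proof.
rewrite adjE (@fsum_seq _ _ [:: j]) // ?big_seq1 ?eqxx // => k.
case: eqP => // /(const_inj hN)/oppr_inj/sg_inj -> _.
exact: mem_head.
Qed.

Lemma gen_supp b d a v s x : one_sided b d a v s x <> 0 ->
  exists j : nat, v = const_mx (d - sg b * j%:Z).
Proof.
rewrite genE => h; apply: contrapT => k; apply: h; apply: fsbig1 => j _.
by case: eqP => // vE; case: k; exists j.
Qed.

Lemma adj_supp b a v s x : adj_one_sided b a v s x <> 0 ->
  exists j : nat, v = const_mx (- (sg b * j%:Z)).
Proof.
rewrite adjE => h; apply: contrapT => k; apply: h; apply: fsbig1 => j _.
by case: eqP => // vE; case: k; exists j.
Qed.

Lemma bandF_gen b d a x : bandF b [:: const_mx d] (pt x (one_sided b d a)).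
Proof.
move=> v s /gen_supp[j ->]; exists (const_mx d); first exact: mem_head.
by exists j; apply/matrixP => i k; rewrite !mxE.
Qed.

Lemma bandF_adj b a x : bandF b [:: 0] (pt x (adj_one_sided b a)).
Proof.
move=> v s /adj_supp[j ->]; exists 0; first exact: mem_head.
by exists j; apply/matrixP => i k; rewrite !mxE add0r.
Qed.

Lemma bnd_gen b d a x : bnd b (pt x (one_sided b d a)).
Proof. by exists [:: const_mx d]; exact: bandF_gen. Qed.

Lemma bnd_adj b a x : bnd b (pt x (adj_one_sided b a)).
Proof. by exists [:: 0]; exact: bandF_adj. Qed.

(** The shapes of the operators of the hierarchy are established by reading coefficients off along a
    single ray. *)
Lemma gen_intro (D : set (times R N)) b d A :
  (forall v s x, D x -> A v s x <> 0 ->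
     exists j : nat, v = const_mx (d - sg b * j%:Z)) ->
  opeq D A (one_sided b d (fun j => A (const_mx (d - sg b * j%:Z)))).
Proof.
move=> h v s x Dx; have [[j ->]|k] := pselect (exists j : nat,
  v = const_mx (d - sg b * j%:Z)); first by rewrite gen_at.
transitivity (0 : 'M[C]_N).
  by apply: contrapT => /h; apply: contra_not k; exact.
by apply: esym; apply: contrapT => /gen_supp.
Qed.

(* The coefficients of W X W'^{-1} for a constant operator X, in the form in
   which they appear in the bilinear identity. *)
Lemma gen_dm_adjE b w ws c u v s x :
  pmul (pmul (pt x (one_sided b 0 w)) (dm c u)) (pt x (adj_one_sided b ws)) v s =
  \sum_(jk \in [set: nat * nat])
    (w jk.1 s x
     *m diag_mx (\row_al (c al *+
          (v + const_mx (sg b * (jk.1 + jk.2)%N%:Z) == u al)))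
     *m ws jk.2 (s + v + const_mx 1) x).
Proof.
have [J boundJ] : exists J : nat, forall (j k : nat) al,
    v + const_mx (sg b * (j + k)%N%:Z) = u al -> (j < J)%N /\ (k < J)%N.
  (* A contributing pair has j + k equal to the absolute value of a coordinate of u_alpha - v; the
     sum over alpha bounds all of these at once. *)
  exists (\sum_al absz ((u al - v) 0 (Ordinal hN))%R)%N.+1 => j k al e.
  have : (absz ((u al - v) 0 (Ordinal hN))%R <
      (\sum_al absz ((u al - v) 0 (Ordinal hN))%R)%N.+1)%N.
    by rewrite ltnS (bigD1 al) //= leq_addr.
  move: (bigop.body _ _ _).+1 => J; rewrite -e !mxE.
  have aux (z : int) : (absz (z + sg b * (j + k)%N%:Z - z)%R < J)%N ->
      (j < J)%N /\ (k < J)%N.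
    by have [->|->] := sgP b; lia.
  exact: aux.
pose r := [seq (j, k) | j <- iota 0 J, k <- iota 0 J].
rewrite (@fsum_seq _ _ r); last 2 first.
- by apply: allpairs_uniq; rewrite ?iota_uniq // => -[? ?] [? ?].
- move=> [j k] /mulmx_neq0l/mulmx_neq0r/= h; apply/allpairsP; exists (j, k).
  suff [? ?] : (j < J)%N /\ (k < J)%N by rewrite !mem_iota.
  apply: contrapT => n; apply: h; apply/matrixP => i l; rewrite !mxE.
  case: eqP => [/boundJ//|_]; by rewrite mulr0n mul0rn.
rewrite big_allpairs exchange_big /=.
have vshift (k : nat) : v - (v + const_mx (sg b * k%:Z)) =
    const_mx (- (sg b * k%:Z)) :> vec.
  by rewrite opprD addNKr; apply/matrixP => i l; rewrite !mxE.
rewrite {1}/pmul.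
(* The right factor is nonzero at the shift v - t only if t is v plus sg b * k in each coordinate,
   so the shift sum is indexed by k. For fixed k and column, at most one j contributes. *)
rewrite (@fsum_seq _ _ [seq v + const_mx (sg b * k%:Z) | k <- iota 0 J]).
- rewrite big_map; apply: eq_bigr => k _.
  rewrite -mulmx_suml vshift /pt adj_at; congr (_ *m _); last first.
    congr (ws k _ x); rewrite -!addrA; congr (s + (v + _)).
    by apply/matrixP => i l; rewrite !mxE addNKr.
  apply/matrixP => i l; rewrite mul_dmE summxE.
  under eq_bigr => j _ do rewrite mul_diagE mxE.
  have E (j : nat) : (v + const_mx (sg b * (j + k)%N%:Z) == u l) =
      (v + const_mx (sg b * k%:Z) - u l == const_mx (0 - sg b * j%:Z)).
    rewrite -subr_eq0 -[RHS]subr_eq0; congr (_ == _).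
    by apply/matrixP => y z; rewrite !mxE; lia.
  have [[j e]|n] := pselect (exists j : nat,
      v + const_mx (sg b * (j + k)%N%:Z) = u l).
    have [jJ _] := boundJ _ _ _ e.
    rewrite (bigD1_seq j) ?iota_uniq ?mem_iota //= e eqxx mulr1n big1.
      by move/eqP: e; rewrite E => /eqP ->; rewrite gen_at addr0.
    move=> j' jj'; case: eqP => [e'|]; last by rewrite mulr0n mulr0.
    case/eqP: jj'; have := etrans e' (esym e) => /addrI/(const_inj hN)/sg_inj.
    exact: addIn.
  rewrite big1 => [|j _]; last first.
    by case: eqP => [e|]; [case: n; exists j|rewrite mulr0n mulr0].
  suff -> : one_sided b 0 w (v + const_mx (sg b * k%:Z) - u l) s x = 0.
    by rewrite mxE mul0r.
  apply: contrapT => /gen_supp[j /eqP e]; case: n; exists j.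
  by apply/eqP; rewrite E.
- by rewrite map_inj_uniq ?iota_uniq // => j k /addrI/(const_inj hN)/sg_inj.
move=> t h; have [k tE] := adj_supp (mulmx_neq0r h).
have {}tE : t = v + const_mx (sg b * k%:Z).
  by rewrite -[t](subKr v) tE; apply/matrixP => i l; rewrite !mxE opprK.
apply/mapP; exists k => //; rewrite mem_iota add0n leq0n /=.
apply: contrapT => n; apply: (mulmx_neq0l h); apply/matrixP => i l.
rewrite mul_dmE tE mxE; suff -> : pt x (one_sided b 0 w)
  (v + const_mx (sg b * k%:Z) - u l) s = 0 by rewrite mxE mul0r.
apply: contrapT => /gen_supp[j e]; apply: n.
suff /boundJ[] : v + const_mx (sg b * (j + k)%N%:Z) = u l by [].
rewrite -[u l](subKr (v + const_mx (sg b * k%:Z))) e.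
by apply/matrixP => y z; rewrite !mxE; lia.
Qed.

End OperatorsAtAPoint.

(** * Calculus in the times *)

(* Stated over an abstract field because unification of the structures of R[i]
   unfolds the construction of the complex numbers. *)
Section OneVariable.
Context (K : numFieldType).
Implicit Types f g : K^o -> K^o.

Lemma derive1_near f g : (\forall h \near nbhs (0 : K^o), f h = g h) ->
  derive1 f 0 = derive1 g 0.
Proof. by move=> fg; rewrite !derive1E; exact: near_eq_derive. Qed.

Lemma derivable_near f g : (\forall h \near nbhs (0 : K^o), f h = g h) ->
  derivable f 0 1 -> derivable g 0 1.
Proof. exact: near_eq_derivable. Qed.

(** Entries of operator products are finite sums of products of scalar functions, so this one
    Leibniz rule covers them all. *)
Lemma derive1_sumM (I : Type) (r : seq I) (f g : I -> K^o -> K^o) :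
  (forall k, derivable (f k) 0 1) -> (forall k, derivable (g k) 0 1) ->
  derivable ((fun t => \sum_(k <- r) f k t * g k t) : K^o -> K^o) 0 1 /\
  derive1 ((fun t => \sum_(k <- r) f k t * g k t) : K^o -> K^o) 0 =
    \sum_(k <- r) (derive1 (f k) 0 * g k 0 + f k 0 * derive1 (g k) 0).
Proof.
move=> df dg; rewrite derive1E.
have -> : (fun t => \sum_(k <- r) f k t * g k t : K^o) =
    \sum_(k <- r) ((f k : K^o -> K^o) * g k).
  by apply/funext => t; rewrite fct_sumE.
elim: r => [|k r [IH1 IH2]].
  by rewrite !big_nil; split; [exact: derivable_cst|exact: derive_cst].
rewrite !big_cons; split.
  by apply: derivableD IH1; apply: derivableM.
rewrite deriveD ?IH2 //; last exact: derivableM.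
rewrite deriveM // !derive1E; congr (_ + _).
by rewrite addrC; congr (_ + _); rewrite [LHS]mulrC.
Qed.

Lemma derive1_cst0 (c : K) : derive1 ((fun=> c) : K^o -> K^o) 0 = 0.
Proof. by rewrite derive1E; exact: derive_cst. Qed.

Lemma derivable_cst0 (c : K) : derivable ((fun=> c) : K^o -> K^o) 0 1.
Proof. exact: derivable_cst. Qed.

Lemma derive1D0 f g : derivable f 0 1 -> derivable g 0 1 ->
  derive1 ((fun t => f t + g t) : K^o -> K^o) 0 = derive1 f 0 + derive1 g 0.
Proof. by move=> df dg; rewrite !derive1E; exact: deriveD. Qed.

Lemma derive1_cstM0 (c : K) f : derivable f 0 1 ->
  derive1 ((fun t => c * f t) : K^o -> K^o) 0 = c * derive1 f 0.
Proof.
move=> df; rewrite !derive1E.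
have -> : ((fun t => c * f t) : K^o -> K^o) = (cst c : K^o -> K^o) * f by [].
by rewrite deriveM // derive_cst scaler0 addr0.
Qed.

(** Groups a second derivative of a sum of products so that exchanging the two derivatives merely
    swaps the mixed terms, which is then handled by [leibniz_swap]. *)
Lemma sum_sumType2 (J : finType) (F G : J + J -> K) :
  \sum_k F k + \sum_k G k =
  \sum_k (F (inl k) + G (inl k) + (F (inr k) + G (inr k))).
Proof. by rewrite !big_sumType !big_split; exact: addrACA. Qed.

Lemma leibniz_swap (a a' b b' c d e f : K) : a = a' -> b = b' ->
  a * c + d + (e + f * b) = a' * c + e + (d + f * b').
Proof. by move=> -> ->; exact: addrACA. Qed.

End OneVariable.

Section Calculus.
Context (R : realType) (N : nat) (D : set (times R N)) (hD : line_open D).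
Local Notation C := R[i].
Local Notation fn := (times R N -> C).
Implicit Types (f g : fn) (i j : tindex N) (l : seq (tindex N)) (x : times R N).

Lemma tshift0 x i : tshift x i 0 = x.
Proof. by apply/funext => j; rewrite /tshift addr0; case: ifP. Qed.

(** Openness of D along coordinate lines enters here: equality on D gives equality near 0 on each
    slice, hence equal partial derivatives at the points of D. *)
Lemma slice_near f g i x : (forall y, D y -> f y = g y) -> D x ->
  \forall h \near nbhs (0 : R[i]^o), slice f i x h = slice g i x h.
Proof.
by move=> fg Dx; apply: filterS (hD i Dx) => h; exact: fg.
Qed.

Lemma pderiv_congr f g i x : (forall y, D y -> f y = g y) -> D x ->
  pderiv i f x = pderiv i g x.
Proof. by move=> fg Dx; apply: derive1_near; exact: slice_near. Qed.

#[local] Opaque pderiv.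

Lemma derivable_congr f g i x : (forall y, D y -> f y = g y) -> D x ->
  derivable (slice f i x) 0 1 -> derivable (slice g i x) 0 1.
Proof. by move=> fg Dx; apply: derivable_near; exact: slice_near. Qed.

Lemma pderivs_congr l f g x : (forall y, D y -> f y = g y) -> D x ->
  pderivs l f x = pderivs l g x.
Proof.
move=> fg; elim: l x => [|i l IH] x Dx /=; first exact: fg.
by apply: pderiv_congr => // y; exact: IH.
Qed.

Lemma smooth_congr f g : (forall y, D y -> f y = g y) -> smooth D f -> smooth D g.
Proof.
move=> fg sf l; have [df cf] := sf l; split=> [i x Dx|i j x Dx].
  apply: derivable_congr (df i x Dx) => // y Dy; exact: pderivs_congr.
by rewrite -!(pderivs_congr _ fg Dx) cf.
Qed.

Lemma smooth_derivable f i x : smooth D f -> D x -> derivable (slice f i x) 0 1.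
Proof. by move=> sf Dx; exact: (sf [::]).1 i x Dx. Qed.

Lemma smooth_pderivC f i j x : smooth D f -> D x ->
  pderiv i (pderiv j f) x = pderiv j (pderiv i f) x.
Proof. by move=> sf Dx; exact: (sf [::]).2 i j x Dx. Qed.

Lemma pderivs_pderiv l i f : pderivs l (pderiv i f) = pderivs (rcons l i) f.
Proof. by rewrite /pderivs foldr_rcons. Qed.

Lemma smooth_pderiv f i : smooth D f -> smooth D (pderiv i f).
Proof.
move=> sf l; have [df cf] := sf (rcons l i).
split=> [j x Dx|j k x Dx]; first by rewrite pderivs_pderiv; exact: df.
by have := cf j k x Dx; rewrite /= !pderivs_pderiv.
Qed.

Lemma smooth_pderivs f l : smooth D f -> smooth D (pderivs l f).
Proof.
move=> sf; elim: l => [|i l IH]; [exact: sf|exact: smooth_pderiv].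
Qed.

(** Iterated derivatives of [f] stay in [P], so the quantification over lists of derivatives reduces
    to one check on first and mixed second derivatives. *)
Lemma smooth_coind (P : fn -> Prop) :
  (forall f, P f ->
    [/\ forall i x, D x -> derivable (slice f i x) 0 1,
        forall i, P (pderiv i f)
      & forall i j x, D x ->
          pderiv i (pderiv j f) x = pderiv j (pderiv i f) x]) ->
  forall f, P f -> smooth D f.
Proof.
move=> h f Pf l; have : P (pderivs l f).
  elim: l => [|i l IH]; first exact: Pf.
  by have [_ + _] := h _ IH; exact.
by move=> /h[d _ c]; split; [exact: d|exact: c].
Qed.

#[local] Opaque smooth.

Lemma pderiv_sumM (I : Type) (r : seq I) (g h : I -> fn) i x :
  (forall k, derivable (slice (g k) i x) 0 1) ->
  (forall k, derivable (slice (h k) i x) 0 1) ->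
  derivable (slice (fun y => \sum_(k <- r) g k y * h k y) i x) 0 1 /\
  pderiv i (fun y => \sum_(k <- r) g k y * h k y) x =
    \sum_(k <- r) (pderiv i (g k) x * h k x + g k x * pderiv i (h k) x).
Proof.
move=> dg dh; have [h1 h2] := derive1_sumM r dg dh.
split; first exact: h1.
apply: etrans h2 _; apply: eq_bigr => k _.
by rewrite /slice !tshift0.
Qed.

Lemma pderiv_cst (c : C) i x : pderiv i (fun=> c) x = 0.
Proof. exact: derive1_cst0. Qed.

Lemma derivable_slice_cst (c : C) i x : derivable (slice (fun=> c) i x) 0 1.
Proof. exact: (@derivable_cst0 C c). Qed.

Lemma smooth_cst (c : C) : smooth D (fun=> c).
Proof.
apply: (smooth_coind (P := fun f => exists c, f = fun=> c)); last by exists c.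
move=> _ [{}c ->]; have E i (a : C) : pderiv i (fun=> a) = (fun=> 0 : C).
  by apply/funext => x; exact: pderiv_cst.
split=> [i x _|i|i j x _]; [exact: derivable_cst0| |by rewrite !E].
by rewrite E; exists 0.
Qed.

(* The class of finite sums of products of smooth functions is stable under
   pderiv, which makes it a witness for [smooth_coind]. *)
Lemma smooth_sumM (I : finType) (g h : I -> fn) :
  (forall k, smooth D (g k)) -> (forall k, smooth D (h k)) ->
  smooth D (fun x => \sum_k g k x * h k x).
Proof.
move=> sg sh; pose P f := exists (J : finType) (u v : J -> fn),
  [/\ forall k, smooth D (u k), forall k, smooth D (v k)
    & forall x, D x -> f x = \sum_k u k x * v k x].
apply: (smooth_coind (P := P)); last by exists I, g, h.
have pd f (J : finType) (u v : J -> fn) i x :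
    (forall k, smooth D (u k)) -> (forall k, smooth D (v k)) ->
    (forall x, D x -> f x = \sum_k u k x * v k x) -> D x ->
    pderiv i f x = \sum_k pderiv i (u k) x * v k x
                   + \sum_k u k x * pderiv i (v k) x.
  move=> su sv fE Dx; rewrite (pderiv_congr _ fE) // -big_split /=.
  by apply: (pderiv_sumM _ _ _).2 => k; exact: smooth_derivable.
move=> f [J [u [v [su sv fE]]]]; split.
- move=> i x Dx; apply: (derivable_congr _ Dx) => [y Dy|].
    by symmetry; exact: fE.
  by apply: (pderiv_sumM _ _ _).1 => k; exact: smooth_derivable.
(* Leibniz doubles the index set: left summands differentiate the first factor, right summands the
   second. *)
- move=> i; exists (J + J)%type,
    (fun k => match k with inl k => pderiv i (u k) | inr k => u k end),
    (fun k => match k with inl k => v k | inr k => pderiv i (v k) end).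
  split=> [[]k|[]k|x Dx]; rewrite ?big_sumType; [exact: smooth_pderiv|exact: su|
    exact: sv|exact: smooth_pderiv|exact: pd].
- have pd2 i j x : D x -> pderiv i (pderiv j f) x =
      \sum_k (pderiv i (pderiv j (u k)) x * v k x
              + pderiv j (u k) x * pderiv i (v k) x
              + (pderiv i (u k) x * pderiv j (v k) x
                 + u k x * pderiv i (pderiv j (v k)) x)).
    move=> Dx; pose u' (k : J + J) := match k with
      inl k => pderiv j (u k) | inr k => u k end.
    pose v' (k : J + J) := match k with
      inl k => v k | inr k => pderiv j (v k) end.
    have su' k : smooth D (u' k) by case: k => k; [exact: smooth_pderiv|exact: su].
    have sv' k : smooth D (v' k) by case: k => k; [exact: sv|exact: smooth_pderiv].
    have jE y : D y -> pderiv j f y = \sum_k u' k y * v' k y.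
      by move=> Dy; rewrite big_sumType; exact: pd.
    apply: etrans (pd _ _ _ _ i x su' sv' jE Dx) _.
    exact: sum_sumType2.
  move=> i j x Dx; rewrite (pd2 i j x Dx) (pd2 j i x Dx); apply: eq_bigr => k _.
  exact: leibniz_swap (smooth_pderivC i j (su k) Dx)
    (smooth_pderivC i j (sv k) Dx).
Qed.

Lemma smooth_sumM_seq (I : Type) (r : seq I) (g h : I -> fn) :
  (forall k, smooth D (g k)) -> (forall k, smooth D (h k)) ->
  smooth D (fun x => \sum_(k <- r) g k x * h k x).
Proof.
move=> sg sh; have := @smooth_sumM 'I_(size r)
  (fun k => g (tnth (in_tuple r) k)) (fun k => h (tnth (in_tuple r) k))
  (fun k => sg _) (fun k => sh _).
by apply: smooth_congr => x _; rewrite [RHS]big_tnth.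
Qed.

Lemma smooth_sum (I : Type) (r : seq I) (g : I -> fn) :
  (forall k, smooth D (g k)) -> smooth D (fun x => \sum_(k <- r) g k x).
Proof.
move=> sg; have := smooth_sumM_seq r sg (fun k => smooth_cst 1).
by apply: smooth_congr => x _; apply: eq_bigr => k _; rewrite mulr1.
Qed.

Lemma smoothM f g : smooth D f -> smooth D g -> smooth D (fun x => f x * g x).
Proof.
move=> sf sg; have := @smooth_sumM_seq unit [:: tt] (fun=> f) (fun=> g)
  (fun=> sf) (fun=> sg).
by apply: smooth_congr => x _; rewrite big_seq1.
Qed.

Lemma smoothD f g : smooth D f -> smooth D g -> smooth D (fun x => f x + g x).
Proof.
move=> sf sg; have := @smooth_sum bool [:: true; false]
  (fun b => if b then f else g) (fun b => if b as b return
     smooth D (if b then f else g) then sf else sg).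
by apply: smooth_congr => x _; rewrite big_cons big_seq1.
Qed.

Lemma smoothN f : smooth D f -> smooth D (fun x => - f x).
Proof.
move=> sf; have := smoothM (smooth_cst (-1)) sf.
by apply: smooth_congr => x _; rewrite mulN1r.
Qed.

Lemma pderivD f g i x : smooth D f -> smooth D g -> D x ->
  pderiv i (fun y => f y + g y) x = pderiv i f x + pderiv i g x.
Proof.
move=> sf sg Dx; exact: (derive1D0 (smooth_derivable (i := i) sf Dx)
  (smooth_derivable (i := i) sg Dx)).
Qed.

Lemma pderiv_cstM (c : C) f i x : smooth D f -> D x ->
  pderiv i (fun y => c * f y) x = c * pderiv i f x.
Proof.
move=> sf Dx; exact: (derive1_cstM0 c (smooth_derivable (i := i) sf Dx)).
Qed.

Lemma pderivs_perm l l' f x : perm_eq l l' -> smooth D f -> D x ->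
  pderivs l f x = pderivs l' f x.
Proof.
move=> pll' sf.
have mid i l1 l2 y : D y ->
    pderivs (l1 ++ i :: l2) f y = pderivs (i :: l1 ++ l2) f y.
  elim: l1 y => [|j l1 IH] y Dy; first by [].
  apply: etrans (pderiv_congr j IH Dy) _.
  exact: smooth_pderivC (smooth_pderivs _ sf) Dy.
elim: l l' pll' x => [|i l IH] l' pll' x Dx.
  by move: pll'; rewrite perm_sym => /perm_nilP ->.
have : i \in l' by rewrite -(perm_mem pll') mem_head.
move=> /splitPr il'; case: l' / il' pll' => l1 l2.
rewrite perm_sym -cat1s perm_catCA perm_cons perm_sym => pll'.
apply: etrans (esym (mid _ _ _ _ Dx)).
by apply: (pderiv_congr i _ Dx) => y; exact: IH.
Qed.

End Calculus.

(** * Derivatives and smoothness of operator products *)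

Section MatrixSums.
Context (K : comNzRingType) (n : nat) (I : eqType).

(** Merges the sum over shifts with the inner sum of the matrix product, so that an entry of an
    operator product becomes a single sum to which the Leibniz rule applies. *)
Definition pairs (r : seq I) := [seq (u, j) | u <- r, j <- enum 'I_n].

Lemma sum_mulmxE (r : seq I) (A B : I -> 'M[K]_n) k l :
  (\sum_(u <- r) A u *m B u) k l =
  \sum_(p <- pairs r) A p.1 k p.2 * B p.1 p.2 l.
Proof.
rewrite /pairs big_allpairs summxE; apply: eq_bigr => u _.
by rewrite mxE big_enum.
Qed.

Lemma sum_mulmx_leibniz (r : seq I) (A B A' B' : I -> 'M[K]_n) k l :
  \sum_(p <- pairs r) (A' p.1 k p.2 * B p.1 p.2 l + A p.1 k p.2 * B' p.1 p.2 l)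
  = (\sum_(u <- r) A' u *m B u + \sum_(u <- r) A u *m B' u) k l.
Proof. by rewrite big_split mxE !sum_mulmxE. Qed.

End MatrixSums.

Section OperatorCalculus.
#[local] Opaque pderiv smooth.
Context (R : realType) (N : nat) (hN : (0 < N)%N).
Context (D : set (times R N)) (hD : line_open D).
Local Notation vec := ('rV[int]_N).
Local Notation C := R[i].
Implicit Types (A B : diffop R N) (b : bool) (x : times R N) (i : tindex N).

Definition eqD A B := forall x, D x -> pt x A = pt x B.

Lemma opeqP A B : opeq D A B <-> eqD A B.
Proof.
split=> [h x Dx|h v s x Dx]; last by rewrite -[LHS]/(pt x A v s) h.
by apply/funext => v; apply/funext => s; exact: h.
Qed.

(** The starting points must not depend on x: a derivative at x involves nearby times, and the
    finite sum being differentiated has to keep the same range there. *)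
Definition ubandF b S A := forall x, D x -> bandF b S (pt x A).
Definition ubnd b A := exists S, ubandF b S A.
Definition smop A := forall v, smooth_coef D (A v).

Lemma ubnd_bnd b A x : ubnd b A -> D x -> bnd b (pt x A).
Proof. by move=> [S h] Dx; exists S; exact: h. Qed.

Lemma ubnd_mul b A B : ubnd b A -> ubnd b B -> ubnd b (A *o B).
Proof.
move=> [S hA] [S' hB]; exists (addS S S') => x Dx.
exact (bandF_mul hN (hA x Dx) (hB x Dx)).
Qed.

Lemma ubnd_add b A B : ubnd b A -> ubnd b B -> ubnd b (A + B).
Proof.
move=> [S hA] [S' hB]; exists (S ++ S') => x Dx.
exact (bandF_add (hA x Dx) (hB x Dx)).
Qed.

Lemma ubnd_opp b A : ubnd b A -> ubnd b (- A).
Proof. by move=> [S hA]; exists S => x Dx; exact (bandF_opp (hA x Dx)). Qed.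

Lemma ubnd_gen b d a : ubnd b (one_sided b d a).
Proof. by exists [:: const_mx d] => x Dx; exact: bandF_gen. Qed.

Lemma ubnd_adj b a : ubnd b (adj_one_sided b a).
Proof. by exists [:: 0] => x Dx; exact: bandF_adj. Qed.

Lemma ubnd_eqD b A B : eqD A B -> ubnd b A -> ubnd b B.
Proof. by move=> e [S h]; exists S => x Dx; rewrite -e //; exact: h. Qed.

Lemma dopE i A v s x k l :
  pt x (dop i A) v s k l = pderiv i (fun y => A v s y k l) x.
Proof. by rewrite /pt /dop mxE. Qed.

Lemma dop_eqD i A B : eqD A B -> eqD (dop i A) (dop i B).
Proof.
move=> h x Dx; apply/funext => v; apply/funext => s; apply/matrixP => k l.
apply: etrans (dopE _ _ _ _ _ _ _) (etrans _ (esym (dopE _ _ _ _ _ _ _))).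
apply: (pderiv_congr hD i _ Dx) => y Dy.
by rewrite -[A v s y]/(pt y A v s) h.
Qed.

Lemma ubandF_dop b S A i : ubandF b S A -> ubandF b S (dop i A).
Proof.
move=> h x Dx v s nz.
have [//|k] := pselect (exists2 f, f \in S &
  exists j : nat, v = f - const_mx (sg b * j%:Z)).
case: nz; apply/matrixP => p q; rewrite [RHS]mxE; apply: etrans (dopE _ _ _ _ _ _ _) _.
apply: etrans (pderiv_cst 0 i x); apply: (pderiv_congr hD _ _ Dx) => y Dy.
suff -> : A v s y = 0 by rewrite mxE.
by apply: contrapT => nz; apply: k; exact: h y Dy v s nz.
Qed.

Lemma ubnd_dop b A i : ubnd b A -> ubnd b (dop i A).
Proof. by move=> [S h]; exists S; exact: ubandF_dop. Qed.

Lemma opmul_entry b S S' A B v s x k l : ubandF b S A -> ubandF b S' B ->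
  D x -> (A *o B) v s x k l =
  \sum_(p <- pairs N (window hN b S S' v))
    A p.1 s x k p.2 * B (v - p.1) (s + p.1) x p.2 l.
Proof.
move=> hA hB Dx.
rewrite -[(A *o B) v s x]/(pmul (pt x A) (pt x B) v s).
rewrite (pmulE hN _ _ (hA x Dx) (hB x Dx)).
exact: (sum_mulmxE _ (fun u => A u s x) (fun u => B (v - u) (s + u) x)).
Qed.

Lemma smop_mul b A B : ubnd b A -> ubnd b B -> smop A -> smop B ->
  smop (A *o B).
Proof.
move=> [S hA] [S' hB] sA sB v s k l.
have E x Dx := opmul_entry v s (x := x) k l hA hB Dx.
apply: (smooth_congr hD (fun x Dx => esym (E x Dx))).
by apply: (smooth_sumM_seq hD) => p; [exact: sA|exact: sB].
Qed.

Lemma dopM b A B i x : ubnd b A -> ubnd b B -> smop A -> smop B -> D x ->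
  pt x (dop i (A *o B)) =
  pmul (pt x (dop i A)) (pt x B) + pmul (pt x A) (pt x (dop i B)).
Proof.
move=> [S hA] [S' hB] sA sB Dx.
apply/funext => v; apply/funext => s; apply/matrixP => k l.
rewrite popD.
rewrite (pmulE hN _ _ (ubandF_dop (i := i) hA Dx) (hB x Dx)).
rewrite (pmulE hN _ _ (hA x Dx) (ubandF_dop (i := i) hB Dx)).
apply: etrans (dopE _ _ _ _ _ _ _) _.
have E y Dy := opmul_entry v s (x := y) k l hA hB Dy.
apply: etrans (pderiv_congr hD i E Dx) _.
have [_ ->] := pderiv_sumM (pairs N (window hN b S S' v))
  (g := fun p y => A p.1 s y k p.2)
  (h := fun p y => B (v - p.1) (s + p.1) y p.2 l) (i := i) (x := x)
  (fun p => smooth_derivable (i := i) (sA p.1 s k p.2) Dx)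
  (fun p => smooth_derivable (i := i) (sB (v - p.1) (s + p.1) p.2 l) Dx).
rewrite -sum_mulmx_leibniz; apply: eq_bigr => p _.
by congr (_ * _ + _ * _); exact: esym (dopE _ _ _ _ _ _ _).
Qed.

Lemma smop_add A B : smop A -> smop B -> smop (A + B).
Proof.
move=> sA sB v s k l.
apply: (smooth_congr hD (f := fun x => A v s x k l + B v s x k l)).
  by move=> x _; rewrite [RHS]mxE.
by apply: (smoothD hD); [exact: sA|exact: sB].
Qed.

Lemma smop_opp A : smop A -> smop (- A).
Proof.
move=> sA v s k l.
apply: (smooth_congr hD (f := fun x => - A v s x k l)).
  by move=> x _; rewrite [RHS]mxE.
by apply: (smoothN hD); exact: sA.
Qed.

Lemma smop_dop A i : smop A -> smop (dop i A).
Proof.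
move=> sA v s k l.
apply: (smooth_congr hD (f := pderiv i (fun x => A v s x k l))).
  by move=> x _; rewrite [RHS]mxE.
by apply: smooth_pderiv; exact: sA.
Qed.

Lemma smop_eqD A B : eqD A B -> smop A -> smop B.
Proof.
move=> e sA v s k l; apply: (smooth_congr hD _ (sA v s k l)) => x Dx.
by rewrite -[A v s x]/(pt x A v s) e.
Qed.

Lemma smop_gen b d a : (forall j, smooth_coef D (a j)) -> smop (one_sided b d a).
Proof.
move=> sa v s k l.
have [[j ->]|n] := pselect (exists j : nat, v = const_mx (d - sg b * j%:Z)).
  by apply: (smooth_congr hD _ (sa j s k l)) => x _; rewrite gen_at.
apply: (smooth_congr hD _ (@smooth_cst R N D 0)) => x _.
suff -> : one_sided b d a v s x = 0 by rewrite mxE.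
by apply: contrapT => /gen_supp.
Qed.

Lemma smop_adj b a : (forall j, smooth_coef D (a j)) -> smop (adj_one_sided b a).
Proof.
move=> sa v s k l.
have [[j ->]|n] := pselect (exists j : nat, v = const_mx (- (sg b * j%:Z))).
  by apply: (smooth_congr hD _ (sa j _ k l)) => x _; rewrite adj_at.
apply: (smooth_congr hD _ (@smooth_cst R N D 0)) => x _.
suff -> : adj_one_sided b a v s x = 0 by rewrite mxE.
by apply: contrapT => /adj_supp.
Qed.

Definition const_op (A : vec -> vec -> 'M[C]_N) : diffop R N := fun v s _ => A v s.

Lemma smop_const_op (A : vec -> vec -> 'M[C]_N) : smop (const_op A).
Proof. by move=> v s k l; exact: smooth_cst. Qed.

Lemma ubnd_dm b a u : ubnd b (const_op (dm a u)).
Proof.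
by have [S h] := bnd_dm b (a : 'I_N -> C) u; exists S => x _.
Qed.

Lemma dop_const_op i (A : vec -> vec -> 'M[C]_N) : dop i (const_op A) = 0.
Proof.
apply/funext => v; apply/funext => s; apply/funext => x.
apply/matrixP => k l; rewrite [RHS]mxE.
by apply: etrans (dopE i (const_op A) v s x k l) _; exact: pderiv_cst.
Qed.

Lemma dopD i A B x : smop A -> smop B -> D x ->
  pt x (dop i (A + B)) = pt x (dop i A) + pt x (dop i B).
Proof.
move=> sA sB Dx; apply/funext => v; apply/funext => s; apply/matrixP => k l.
rewrite popD [RHS]mxE; apply: etrans (dopE _ _ _ _ _ _ _) _.
apply: etrans (congr2 +%R (esym (dopE i A v s x k l))
                          (esym (dopE i B v s x k l))).
apply: etrans (pderivD i (sA v s k l) (sB v s k l) Dx).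
by apply: (pderiv_congr hD _ _ Dx) => y _; rewrite [LHS]mxE.
Qed.

End OperatorCalculus.

(** * Exponential factors and Taylor expansion *)

Lemma foldr_iter (I T X : Type) (n : I -> nat) (t : I -> T) (g : T -> X -> X)
    (r : seq I) (x : X) :
  foldr (fun i => iter (n i) (g (t i))) x r =
  foldr g x (flatten [seq nseq (n i) (t i) | i <- r]).
Proof.
elim: r => //= i r ->; rewrite foldr_cat.
by elim: (n i) => //= k ->.
Qed.

Section MultiIndices.
Context (N K : nat).
Implicit Types (m p q : mexp N K) (i : mindex N K).

Definition madd m i : mexp N K := [ffun j => (m j + (j == i))%N].
Definition msub m q : mexp N K := [ffun j => (m j - q j)%N].
Definition mseq m : seq (mexp N K) :=
  [seq [ffun i => val (p i)] | p : {dffun forall i : mindex N K, 'I_(m i).+1}].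
Definition weight p : nat := (\sum_i (val i.2).+1 * p i)%N.
Definition mlist m : seq (tindex N) :=
  flatten [seq nseq (m i) (tindex_of i) | i <- enum (mindex N K)].

Lemma mem_mseq m q : (q \in mseq m) = [forall i, (q i <= m i)%N].
Proof.
apply/mapP/forallP => [[p _ ->] i|h].
  by rewrite ffunE -ltnS ltn_ord.
exists [ffun i => inord (q i)]; first by rewrite mem_enum.
by apply/ffunP => i; rewrite !ffunE /= inordK // ltnS.
Qed.

Lemma mseq_uniq m : uniq (mseq m).
Proof.
rewrite map_inj_uniq ?enum_uniq // => p p' /ffunP e.
by apply/ffunP => i; apply/val_inj; have := e i; rewrite !ffunE.
Qed.

Lemma madd_inj i : injective (madd^~ i).
Proof.
move=> p q /ffunP e; apply/ffunP => j; have := e j.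
by rewrite !ffunE => /addIn.
Qed.

(** The product rule for d/dy_i in coefficients: a convolution over q <= m + e_i is weighted by m_i
    + 1 = q_i + (m_i + 1 - q_i). The first weight kills the terms with q_i = 0, leaving q = p + e_i
    with p <= m; the second kills those with q_i = m_i + 1, leaving q <= m. *)
Lemma sum_mseq_madd (V : zmodType) (f : mexp N K -> V) m i :
  (\sum_(q <- mseq (madd m i)) f q) *+ (m i).+1 =
  \sum_(q <- mseq m) f (madd q i) *+ (q i).+1 +
  \sum_(q <- mseq m) f q *+ (m i - q i).+1.
Proof.
have maddE : madd m i i = (m i).+1 by rewrite ffunE eqxx addn1.
rewrite -sumrMnl.
transitivity (\sum_(q <- mseq (madd m i)) (f q *+ q i + f q *+ ((m i).+1 - q i))).
  apply: eq_big_seq => q; rewrite mem_mseq => /forallP/(_ i); rewrite maddE => h.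
  by rewrite -mulrnDr subnKC.
rewrite big_split /=; congr (_ + _).
  transitivity (\sum_(q <- [seq madd q i | q <- mseq m]) f q *+ q i); last first.
    by rewrite big_map; apply: eq_bigr => q _; rewrite ffunE eqxx addn1.
  transitivity (\sum_(q <- [seq q : mexp N K <- mseq (madd m i) | 0 < q i]%N) f q *+ q i).
    rewrite big_filter [RHS]big_mkcond; apply: eq_bigr => q _.
    by case: (q i) => //=; rewrite mulr0n.
  apply/perm_big/uniq_perm => [||q].
  - by rewrite filter_uniq // mseq_uniq.
  - by rewrite map_inj_uniq ?mseq_uniq //; exact: madd_inj.
  rewrite mem_filter mem_mseq; apply/andP/mapP => [[q0 /forallP h]|[p + ->]].
    exists [ffun j => (q j - (j == i))%N].
      rewrite mem_mseq; apply/forallP => j; have := h j; rewrite !ffunE.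
      by case: eqP => [->|_] /=; lia.
    apply/ffunP => j; rewrite !ffunE; case: eqP => [->|_] /=; last by lia.
    by rewrite subnK.
  rewrite mem_mseq => /forallP h; rewrite ffunE eqxx addn1; split=> //.
  by apply/forallP => j; rewrite !ffunE leq_add2r.
transitivity (\sum_(q <- [seq q : mexp N K <- mseq (madd m i) | q i <= m i]%N)
    f q *+ ((m i).+1 - q i)).
  rewrite big_filter [RHS]big_mkcond; apply: eq_big_seq => q.
  rewrite mem_mseq => /forallP/(_ i); rewrite maddE leq_eqVlt ltnS.
  by case: leqP => [//|? /orP[/eqP ->|//]]; rewrite subnn mulr0n.
transitivity (\sum_(q <- mseq m) f q *+ ((m i).+1 - q i)); last first.
  apply: eq_big_seq => q; rewrite mem_mseq => /forallP/(_ i) h.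
  by rewrite subSn.
apply/perm_big/uniq_perm => [||q].
- by rewrite filter_uniq // mseq_uniq.
- exact: mseq_uniq.
rewrite mem_filter !mem_mseq; apply/andP/forallP => [[qi /forallP h] j|h].
  by have := h j; rewrite ffunE; case: eqP => [->|_] //; rewrite addn0.
split; first exact: h.
by apply/forallP => j; rewrite ffunE (leq_trans (h j)) // leq_addr.
Qed.

Lemma msub_madd m q i : (q i <= m i)%N -> msub (madd m i) q = madd (msub m q) i.
Proof.
move=> h; apply/ffunP => j; rewrite !ffunE.
by case: eqP => [->|_] /=; rewrite ?addn0 ?addn1 ?subSn.
Qed.

Lemma msub_madd2 m q i : msub (madd m i) (madd q i) = msub m q.
Proof. by apply/ffunP => j; rewrite !ffunE subnDr. Qed.

Lemma weight_madd p i : weight (madd p i) = (weight p + (val i.2).+1)%N.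
Proof.
rewrite /weight (bigD1 i) //= [in RHS](bigD1 i) //= ffunE eqxx addn1 mulnS.
rewrite [RHS]addnAC [(_ * _ + _)%N]addnC; congr (_ + _)%N.
by apply: eq_bigr => j /negPf ji; rewrite ffunE ji addn0.
Qed.

Lemma mfact_madd p i : mfact (madd p i) = ((p i).+1 * mfact p)%N.
Proof.
rewrite /mfact (bigD1 i) //= [in RHS](bigD1 i) //= ffunE eqxx addn1 factS.
rewrite -mulnA; congr (_ * (_ * _))%N.
by apply: eq_bigr => j /negPf ji; rewrite ffunE ji addn0.
Qed.

Lemma total_madd p i : (\sum_j madd p i j = (\sum_j p j).+1)%N.
Proof.
rewrite (bigD1 i) //= [in RHS](bigD1 i) //= ffunE eqxx addn1 addSn.
congr (_ + _).+1.
by apply: eq_bigr => j /negPf ji; rewrite ffunE ji addn0.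
Qed.

Lemma mlist_madd p i : perm_eq (mlist (madd p i)) (tindex_of i :: mlist p).
Proof.
have cnt (q : mexp N K) (P : pred (tindex N)) :
    count P (mlist q) = (\sum_j P (tindex_of j) * q j)%N.
  rewrite /mlist count_flatten -map_comp sumnE big_map big_enum /=.
  by apply: eq_bigr => j _; rewrite count_nseq.
apply/permP => P; rewrite /= !cnt (bigD1 i) //= [in RHS](bigD1 i) //= ffunE.
rewrite eqxx addn1 mulnS -addnA; congr (_ + (_ + _))%N.
by apply: eq_bigr => j /negPf ji; rewrite ffunE ji addn0.
Qed.

Lemma mderivE (R : realType) m (f : times R N -> R[i]) :
  mderiv m f = pderivs (mlist m) f.
Proof.
exact: foldr_iter.
Qed.

End MultiIndices.

Section ExponentialFactors.
Context (F : numFieldType) (N K : nat).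
Local Notation vec := ('rV[int]_N).
Implicit Types (m p q : mexp N K) (i : mindex N K) (b : bool).

(* coefficient of y^p in diag_alpha e^{xi(y_alpha, Z)}, where Z is e^{d_s}
   (b = false) or e^{-d_s} (b = true) *)
Definition exp_coef b p : vec -> vec -> 'M[F]_N :=
  dm (fun al => if [forall i, (p i != 0%N) ==> (i.1 == (b, al))]
                then (mfact p)%:R^-1 else 0)
     (fun=> const_mx (sg b * (weight p)%:Z)).

(* t_{alpha,n} acts on the exponential factors through e^{n d_s} E_alpha and
   \bar t_{alpha,n} through e^{-n d_s} E_alpha *)
Definition bare b (t : tindex N) : vec -> vec -> 'M[F]_N :=
  dm (fun al => (t.1 == (b, al))%:R) (fun=> const_mx (sg b * t.2.+1%:Z)).

(** Coefficient form of d/dy_i diag(e^{xi}) = Z^n E_alpha diag(e^{xi}), where i stands for the time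
    y_{alpha,n}. If y_i belongs to the other family of times, both sides vanish. *)
Lemma bare_exp_coef b p i :
  pmul (bare b (tindex_of i)) (exp_coef b p) =
  exp_coef b (madd p i) *+ (p i).+1.
Proof.
rewrite /bare /exp_coef dm_mul.
have -> (a : 'I_N -> F) (u : 'I_N -> vec) n :
    dm a u *+ n = dm (fun al => a al *+ n) u.
  apply/funext => v; apply/funext => s; apply/matrixP => k l.
  rewrite !natmulfctE mulmxnE !mxE.
  by rewrite mulrnAC; congr (_ *+ _); rewrite mulrnAC.
congr dm; apply/funext => al; last first.
  apply/matrixP => k l; rewrite !mxE weight_madd PoszD mulrDr addrC.
  by [].
have -> : [forall j, (madd p i j != 0%N) ==> (j.1 == (b, al))] =
    (i.1 == (b, al)) && [forall j, (p j != 0%N) ==> (j.1 == (b, al))].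
  apply/forallP/andP => [h|[ib /forallP h] j].
    split; first by have := h i; rewrite ffunE eqxx addn1.
    apply/forallP => j; apply/implyP => pj; have := h j.
    by rewrite ffunE addn_eq0 (negPf pj).
  rewrite ffunE; case: (j =P i) => [->|_]; first by rewrite ib implybT.
  by rewrite addn0.
have -> : (tindex_of i).1 = i.1 by rewrite /tindex_of; case: i.1.
case: (i.1 == _); rewrite ?mul1r ?mul0r ?mul0rn //.
case: ifP => _; last by rewrite mul0rn.
rewrite mfact_madd natrM -[RHS]mulr_natl invfM mulrA mulfV ?mul1r //.
Qed.

End ExponentialFactors.

(** Scalar part of [dop_taylor]: raising the exponent k of one variable changes the sign and
    multiplies the factorial by k + 1. *)
Lemma taylor_scalar (F : numFieldType) (n k f : nat) (a : F) : (0 < f)%N ->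
  - ((-1) ^+ n / f%:R * a) = ((-1) ^+ n.+1 / (k.+1 * f)%N%:R * a) *+ k.+1.
Proof.
move=> f0; rewrite exprS mulN1r !mulNr mulNrn; congr (- _).
rewrite -mulrnAl; congr (_ * _); rewrite -mulrnAr; congr (_ * _).
rewrite natrM invfM -[RHS]mulr_natl mulrA mulfV ?mul1r //.
Qed.

Lemma mfact_gt0 (N K : nat) (q : mexp N K) : (0 < mfact q)%N.
Proof. by rewrite /mfact prodn_gt0 // => i; exact: fact_gt0. Qed.

Section TaylorExpansion.
#[local] Opaque pderiv smooth.
Context (R : realType) (N : nat) (hN : (0 < N)%N).
Context (D : set (times R N)) (hD : line_open D) (K : nat).
Local Notation vec := ('rV[int]_N).
Local Notation C := R[i].
Implicit Types (A B : diffop R N) (b : bool) (x : times R N).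
Implicit Types (m p q : mexp N K) (i : mindex N K).

Definition taylor_op q A : diffop R N := fun v => taylor_coef q (A v).

Lemma taylor_opE q A v s x k l : pt x (taylor_op q A) v s k l =
  (-1) ^+ (\sum_i q i)%N / (mfact q)%:R
  * pderivs (mlist q) (fun y => A v s y k l) x.
Proof. by rewrite /pt /taylor_op /taylor_coef mxE mderivE. Qed.

Lemma pderivs_cst0 l x : pderivs l (fun _ : times R N => 0 : C) x = 0.
Proof.
elim: l x => [|i l IH] x; first by [].
have E : pderivs l (fun _ : times R N => 0 : C) = fun=> 0 by exact/funext.
exact: etrans (congr1 (fun g => pderiv i g x) E) (pderiv_cst 0 i x).
Qed.

Lemma ubandF_taylor b S A q : ubandF D b S A -> ubandF D b S (taylor_op q A).
Proof.
move=> h x Dx v s nz.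
have [//|k] := pselect (exists2 f, f \in S &
  exists j : nat, v = f - const_mx (sg b * j%:Z)).
case: nz; apply/matrixP => y z; rewrite [RHS]mxE.
apply: etrans (taylor_opE _ _ _ _ _ _ _) _.
have -> : pderivs (mlist q) (fun y0 => A v s y0 y z) x = 0.
  apply: etrans (pderivs_cst0 (mlist q) x).
  apply: (pderivs_congr hD _ _ Dx) => t Dt.
  suff -> : A v s t = 0 by rewrite mxE.
  by apply: contrapT => nz; apply: k; exact: h t Dt v s nz.
exact: mulr0.
Qed.

Lemma ubnd_taylor b A q : ubnd D b A -> ubnd D b (taylor_op q A).
Proof. by move=> [S h]; exists S; exact: ubandF_taylor. Qed.

Lemma smop_taylor q A : smop D A -> smop D (taylor_op q A).
Proof.
move=> sA v s k l.
have E x : D x -> (-1) ^+ (\sum_i q i)%N / (mfact q)%:R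
    * pderivs (mlist q) (fun y => A v s y k l) x = taylor_op q A v s x k l.
  by move=> _; exact: esym (taylor_opE _ _ _ _ _ _ _).
apply: (smooth_congr hD E); apply: (smoothM hD); first exact: smooth_cst.
by apply: smooth_pderivs; exact: sA.
Qed.

(** A function of t - y satisfies d/dt_i = - d/dy_i, and the coefficient of y^q in a y_i-derivative
    is q_i + 1 times the original coefficient of y^{q + e_i}. *)
Lemma dop_taylor q A i x : smop D A -> D x ->
  - pt x (dop (tindex_of i) (taylor_op q A)) =
  pt x (taylor_op (madd q i) A) *+ (q i).+1.
Proof.
move=> sA Dx; apply/funext => v; apply/funext => s; apply/matrixP => k l.
rewrite popN !natmulfctE mxE mulmxnE.
have sf := sA v s k l; set f := (fun y => A v s y k l) in sf.
have E y : D y -> taylor_op q A v s y k l =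
    (-1) ^+ (\sum_i q i)%N / (mfact q)%:R * pderivs (mlist q) f y.
  by move=> _; exact: taylor_opE.
have E1 := etrans (dopE (tindex_of i) (taylor_op q A) v s x k l)
  (etrans (pderiv_congr hD (tindex_of i) E Dx)
    (@pderiv_cstM R N D _ _ (tindex_of i) x (smooth_pderivs (mlist q) sf) Dx)).
apply: etrans (congr1 (fun z => - z) E1) _.
have E2 := taylor_opE (madd q i) A v s x k l.
rewrite (pderivs_perm hD (mlist_madd q i) sf Dx) mfact_madd total_madd in E2.
apply: etrans (congr1 (fun z => z *+ (q i).+1) (esym E2)).
exact: taylor_scalar (mfact_gt0 q).
Qed.

Lemma taylor_adj b ws q :
  taylor_op q (adj_one_sided b ws) = adj_one_sided b (fun j => taylor_coef q (ws j)).
Proof.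
apply/funext => v; apply/funext => s; apply/funext => x.
have [[j ->]|n] := pselect (exists j : nat, v = const_mx (- (sg b * j%:Z))).
  rewrite adj_at // /taylor_op /taylor_coef; apply/matrixP => k l.
  rewrite mxE [RHS]mxE; congr (_ * mderiv q _ x); apply/funext => y.
  by rewrite adj_at.
have z y : adj_one_sided b ws v s y = 0 by apply: contrapT => /adj_supp.
have -> : adj_one_sided b (fun j => taylor_coef q (ws j)) v s x = 0.
  by apply: contrapT => /adj_supp.
apply/matrixP => k l; apply: etrans (taylor_opE q (adj_one_sided b ws) v s x k l) _.
rewrite [RHS]mxE.
have -> : (fun y => adj_one_sided b ws v s y k l) = fun=> 0.
  by apply/funext => y; rewrite z mxE.
by rewrite pderivs_cst0; exact: mulr0.
Qed.

(* If A is the operator whose coefficients are those of a (barred) adjoint wave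
   function, [twist b m A] is the coefficient of the monomial m in the expansion
   of that adjoint wave function, exponential factors included, at t - y. *)
Definition twist b m A : diffop R N :=
  \sum_(q <- mseq m) const_op (exp_coef C b q) *o taylor_op (msub m q) A.

Lemma pt_sum (I : Type) (r : seq I) (f : I -> diffop R N) x :
  pt x (\sum_(k <- r) f k) = \sum_(k <- r) pt x (f k).
Proof. by elim: r => [|k r IH]; rewrite ?big_nil // !big_cons -IH. Qed.

Lemma smop0 : smop D (0 : diffop R N).
Proof.
move=> v s k l; apply: (smooth_congr hD _ (@smooth_cst R N D 0)) => x _.
by rewrite [RHS]mxE.
Qed.

Lemma smop_sum (I : Type) (r : seq I) (f : I -> diffop R N) :
  (forall k, smop D (f k)) -> smop D (\sum_(k <- r) f k).
Proof.
move=> h; elim: r => [|k r IH]; first by rewrite big_nil; exact: smop0.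
by rewrite big_cons; exact: smop_add (h k) IH.
Qed.

Lemma dop_sum (I : Type) (r : seq I) (f : I -> diffop R N) t x :
  (forall k, smop D (f k)) -> D x ->
  pt x (dop t (\sum_(k <- r) f k)) = \sum_(k <- r) pt x (dop t (f k)).
Proof.
move=> h Dx; elim: r => [|k r IH].
  rewrite !big_nil; apply/funext => v; apply/funext => s; apply/matrixP => i j.
  apply: etrans (dopE _ _ _ _ _ _ _) _; rewrite [RHS]mxE.
  apply: etrans (pderiv_cst 0 t x); apply: (pderiv_congr hD _ _ Dx) => y _.
  by rewrite mxE.
rewrite !big_cons -IH; exact: (dopD hD t (h k) (smop_sum r h) Dx).
Qed.

Lemma ubnd_exp b b' q : ubnd D b (const_op (exp_coef C b' q)).
Proof. exact: ubnd_dm. Qed.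

(** Product rule in y_i for e^{xi(y, Z)} A(t - y): the exponential contributes the bare operator,
    and the Taylor part contributes minus the derivative in t. The exponential coefficients are
    constant in t, so [dop] acts on the Taylor part alone. Both directions of the theorem rest on
    this recursion over monomials. *)
Lemma twist_madd b m i A x : ubnd D b A -> smop D A -> D x ->
  pt x (twist b (madd m i) A) *+ (m i).+1 =
  pmul (bare C b (tindex_of i)) (pt x (twist b m A))
  - pt x (dop (tindex_of i) (twist b m A)).
Proof.
move=> hA sA Dx; rewrite /twist.
have hT q : bnd b (pt x (taylor_op q A)).
  exact: (ubnd_bnd (ubnd_taylor q hA) Dx).
have hE q : bnd b (exp_coef C b q) by exact: bnd_dm.
have hB : bnd b (bare C b (tindex_of i)) by exact: bnd_dm.
have sT q : smop D (taylor_op q A) by exact: smop_taylor.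
have sET q : smop D (const_op (exp_coef C b q) *o taylor_op (msub m q) A).
  apply: (smop_mul hN hD (b := b)) (smop_const_op _ _) (sT _).
    exact: ubnd_exp.
  exact: ubnd_taylor.
rewrite (dop_sum _ _ sET Dx) !pt_sum.
pose f q := pmul (exp_coef C b q) (pt x (taylor_op (msub (madd m i) q) A)).
apply: etrans (sum_mseq_madd f m i) _; congr (_ + _).
  rewrite (pmul_sumr hN _ (fun q => bnd_mul hN (hE q) (hT (msub m q))) hB).
  apply: eq_bigr => q _.
  rewrite /f msub_madd2 (bnd_pmulA hN hB (hE q) (hT _)).
  by rewrite bare_exp_coef (pmulnl hN _ (hE _) (hT _)).
rewrite -sumrN; apply: eq_big_seq => q; rewrite mem_mseq => /forallP/(_ i) h.
have hdT := ubnd_bnd (ubnd_dop hD (tindex_of i) (ubnd_taylor (msub m q) hA)) Dx.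
rewrite (dopM hN hD _ (ubnd_exp b b q) (ubnd_taylor _ hA) (smop_const_op _ _) (sT _) Dx).
rewrite dop_const_op [X in - (X + _)](_ : _ = 0) ?add0r; last exact: pmul0l.
rewrite -(pmulNr hN (hE q) hdT) (dop_taylor _ _ sA Dx).
by rewrite (pmulnr hN _ (hE q) (hT _)) /f msub_madd // ffunE.
Qed.

End TaylorExpansion.

(** * The bilinear identity in terms of operators *)

Section BilinearIdentity.
#[local] Opaque pderiv smooth pmul dm.
Context (R : realType) (N : nat) (hN : (0 < N)%N).
Context (D : set (times R N)) (hD : line_open D).
Local Notation vec := ('rV[int]_N).
Local Notation C := R[i].
Implicit Types (b : bool) (x : times R N) (u v s : vec).
Implicit Types (w ws : nat -> coef R N).

(* e^{u.d_s} sum_alpha E_alpha e^{- u_alpha d_s}: the residue of Psi Psi^* at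
   s' = s + u picks the coefficients of W (sector u) W^{-1}. *)
Definition sector (F : comNzRingType) u : vec -> vec -> 'M[F]_N :=
  dm (fun=> 1) (fun al => u - const_mx (u 0 al)).

Lemma sector_const (F : comNzRingType) u e :
  sector F (u + const_mx e) = sector F u.
Proof.
congr dm; apply/funext => al; apply/matrixP => i j.
by rewrite !mxE opprD addrACA subrr addr0.
Qed.

Lemma sector_mul (F : comNzRingType) u u' :
  pmul (sector F u) (sector F u') = sector F (u + u').
Proof.
rewrite /sector dm_mul; congr dm; apply/funext => al; first exact: mulr1.
by apply/matrixP => i j; rewrite !mxE opprD addrACA.
Qed.

Lemma sector0 (F : comNzRingType) : sector F 0 = @dm1 _ N.
Proof.
by congr dm; apply/funext => al; rewrite mxE const0 subr0.
Qed.

Definition exp_scalar (F : numFieldType) K b (q : mexp N K) (al : 'I_N) : F :=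
  if [forall i, (q i != 0%N) ==> (i.1 == (b, al))]
  then (mfact q)%:R^-1 else 0.

Lemma sector_exp_coef (F : numFieldType) K b (q : mexp N K) u :
  pmul (sector F u) (exp_coef F b q) =
  dm (exp_scalar F b q)
     (fun al => u - const_mx (u 0 al) + const_mx (sg b * (weight q)%:Z)).
Proof.
by rewrite dm_mul; congr dm; apply/funext => al; rewrite mul1r.
Qed.

Lemma twist_entry K b (m : mexp N K) w ws x u v s :
  pmul (pmul (pt x (one_sided b 0 w)) (sector _ u)) (pt x (twist b m (adj_one_sided b ws))) v s =
  \sum_(q <- mseq m) \sum_(jk \in [set: nat * nat])
    (w jk.1 s x
     *m diag_mx (\row_al (exp_scalar _ b q al *+
          (v + const_mx (sg b * (jk.1 + jk.2)%N%:Z) ==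
           u - const_mx (u 0 al) + const_mx (sg b * (weight q)%:Z))))
     *m taylor_coef (msub m q) (ws jk.2) (s + v + const_mx 1) x).
Proof.
have hW := bnd_gen b 0 w x.
have hS : bnd b (sector C u) by exact: bnd_dm.
have hT q : bnd b (pt x (taylor_op (msub m q) (adj_one_sided b ws))).
  by rewrite taylor_adj //; exact: bnd_adj.
have hE (q : mexp N K) : bnd b (exp_coef C b q : vec -> vec -> 'M[C]_N) by exact: bnd_dm.
have hWS := bnd_mul hN hW hS.
rewrite /twist pt_sum.
rewrite (pmul_sumr hN _ (fun q => bnd_mul hN (hE q) (hT q)) hWS).
rewrite !fct_sumE; apply: eq_bigr => q _.
apply: etrans (congr1 (fun A => A v s) (bnd_pmulA4 hN hW hS (hE q) (hT q))) _.
have SE : pmul (sector C u) (exp_coef C b q) = dm (exp_scalar C b q)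
    (fun al => u - const_mx (u 0 al) + const_mx (sg b * (weight q)%:Z)).
  exact: sector_exp_coef.
rewrite SE.
apply: etrans (congr1 (fun A => pmul _ (pt x A) v s) (taylor_adj hN _ _ _)) _.
exact: gen_dm_adjE.
Qed.

Lemma wave_productE K b (m : mexp N K) w ws x s s' :
  wave_product b w ws s s' x m (-1) =
  pmul (pmul (pt x (one_sided b 0 w)) (sector _ (s' - s)))
       (pt x (twist b m (adj_one_sided b ws))) (s' - s - const_mx 1) s.
Proof.
rewrite twist_entry /mseq big_map big_enum /wave_product /=.
apply: eq_bigr => p _; apply: eq_fsbigr => -[j k] _ /=.
set q := [ffun i => _ (p i)].
have -> : [ffun i => (m i - p i)%N] = msub m q.
  by apply/ffunP => i; rewrite !ffunE.
(* The shift by -1 coming from the residue compensates the s + 1 in the adjoint coefficients, which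
   are thus taken at s'. *)
have -> : s + (s' - s - const_mx 1) + const_mx 1 = s'.
  by rewrite -addrA subrK addrC subrK.
congr (_ *m diag_mx _ *m _); apply/matrixP => i al; rewrite !mxE.
rewrite /exp_xi_coef /exp_scalar -/(weight q) -/(sg b).
(* Both vectors differ from s' - s by a multiple of (1, ..., 1), so one coordinate decides the
   equality. *)
have -> : (s' - s - const_mx 1 + const_mx (sg b * (j + k)%N%:Z) ==
    s' - s - const_mx (s' 0 al - s 0 al) + const_mx (sg b * (weight q)%:Z)) =
  (-1 - (s 0 al - s' 0 al - sg b * (j + k)%N%:Z) == sg b * (weight q)%:Z).
  apply/eqP/eqP.
    move=> /matrixP/(_ 0 (Ordinal hN)); rewrite !mxE.
    have aux (a a' c c' d e : int) : a' - a - 1 + d = a' - a - (c' - c) + e ->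
      -1 - (c - c' - d) = e by lia.
    exact: aux.
  move=> e; apply/matrixP => y z; rewrite !mxE -e.
  have aux (a a' c c' d : int) : a' - a - 1 + d =
      a' - a - (c' - c) + (-1 - (c - c' - d)) by lia.
  exact: aux.
case: [forall _, _] => /=; last by rewrite mul0rn.
by case: eqP.
Qed.

Lemma oint_inj (F G : int -> 'M[C]_N) : oint F = oint G -> F (-1) = G (-1).
Proof.
apply: scalerI; rewrite eq_complex /= negb_and mulf_neq0 ?orbT //.
by rewrite gt_eqF // pi_gt0.
Qed.

(** The residues see the coefficients at shifts in u + Z (1, ..., 1), and s' is free to reach each
    of them. At any other shift both products vanish, so nothing is lost in passing to full
    operators. *)
Lemma bilinear_identity_sectors w wb ws wbs :
  bilinear_identity D w wb ws wbs <->
  forall x, D x -> forall K (m : mexp N K) u,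
    pmul (pmul (pt x (one_sided false 0 w)) (sector _ u))
         (pt x (twist false m (adj_one_sided false ws))) =
    pmul (pmul (pt x (one_sided true 0 wb)) (sector _ u))
         (pt x (twist true m (adj_one_sided true wbs))).
Proof.
split=> h; last first.
  move=> s s' x Dx K m; rewrite /oint (wave_productE false).
  by rewrite (wave_productE true) (h x Dx).
move=> x Dx K m u; apply/funext => v; apply/funext => s.
have [[e ->]|n] := pselect (exists e, v = u + const_mx e).
  (* With this s' the shift v is s' - s - (1, ..., 1), and s' - s differs from u by e + 1 in every
     coordinate, which does not change the sector. *)
  pose s' := s + (u + const_mx e) + const_mx 1.
  have vE : u + const_mx e = s' - s - const_mx 1.
    by rewrite /s' [s + _]addrC [_ + s + _]addrAC !addrK.
  have uE : sector C u = sector C (s' - s).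
    rewrite -(sector_const _ u (e + 1)); congr sector.
    have := vE; move=> /(congr1 (fun z => z + const_mx 1)); rewrite subrK => <-.
    by apply/matrixP => y z; rewrite !mxE addrA.
  rewrite uE vE -!wave_productE.
  exact: oint_inj (h s s' x Dx K m).
have z b w' ws' :
  pmul (pmul (pt x (one_sided b 0 w')) (sector _ u))
       (pt x (twist b m (adj_one_sided b ws'))) v s = 0.
  rewrite twist_entry big1 // => q _; apply: fsbig1 => jk _.
  set d := diag_mx _; suff -> : d = 0 by rewrite mulmx0 mul0mx.
  apply/matrixP => y al; rewrite !mxE.
  case: (v + _ =P _) => [E|_]; last by rewrite mulr0n mul0rn.
  case: n; exists (sg b * (weight q)%:Z - u 0 y
                   - sg b * (jk.1 + jk.2)%N%:Z).
  rewrite -[v](addrK (const_mx (sg b * (jk.1 + jk.2)%N%:Z))) E.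
  apply/matrixP => i t; rewrite !mxE.
  have aux (a a' c c' : int) : a - a' + c - c' = a + (c - a' - c') by lia.
  exact: aux.
by rewrite !z.
Qed.

End BilinearIdentity.

(** * Dressing by wave operators *)

Section Dressing.
Context (F : comNzRingType) (N : nat) (hN : (0 < N)%N).
Local Notation vec := ('rV[int]_N).
Local Notation pop := (vec -> vec -> 'M[F]_N).
Local Notation one := (@dm1 F N).
Implicit Types (A B C E Q W V : pop) (b : bool).

(** Differentiating V W = 1 gives dV = - V dW V. *)
Lemma inverse_evolution b W V dW dV B E :
  bnd b W -> bnd b V -> bnd b dW -> bnd b dV -> bnd b B -> bnd b E ->
  pmul W V = one -> pmul V W = one ->
  dW = pmul B W - pmul W E -> pmul dV W + pmul V dW = 0 ->
  dV = pmul E V - pmul V B.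
Proof.
move=> hW hV hdW hdV hB hE WV VW dWE /eqP; rewrite addr_eq0 => /eqP VdW.
have [hBW hWE] := (bnd_mul hN hB hW, bnd_mul hN hW hE).
rewrite -[LHS]muldm1 -WV (bnd_pmulA hN hdV hW hV) VdW dWE.
rewrite (pmulDr hN hBW (bnd_opp hWE) hV) (pmulNr hN hV hWE) opprB.
rewrite (bnd_pmulA hN hV hW hE) VW mul1dm.
rewrite (pmulDl hN hE (bnd_opp (bnd_mul hN hV hBW)) hV).
rewrite (pmulNl hN (bnd_mul hN hV hBW) hV); congr (_ - _).
by rewrite (bnd_pmulA hN hV hB hW) -(bnd_pmulA hN (bnd_mul hN hV hB) hW hV) WV muldm1.
Qed.

(** [E], the part of the evolution that differs between the two sides, cancels; what remains to the
    right of V involves only [B], [C] and [dC], which both sides share. *)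
Lemma twist_step b V B C dV dC E :
  bnd b V -> bnd b B -> bnd b C -> bnd b dV -> bnd b dC -> bnd b E ->
  dV = pmul E V - pmul V B ->
  pmul E (pmul V C) - (pmul dV C + pmul V dC) = pmul V (pmul B C - dC).
Proof.
move=> hV hB hC hdV hdC hE ->.
have [hEV hVB] := (bnd_mul hN hE hV, bnd_mul hN hV hB).
have hBC := bnd_mul hN hB hC.
rewrite (pmulDl hN hEV (bnd_opp hVB) hC) (pmulNl hN hVB hC).
rewrite (pmulDr hN hBC (bnd_opp hdC) hV) (pmulNr hN hV hdC).
rewrite (bnd_pmulA hN hE hV hC) (bnd_pmulA hN hV hB hC).
by rewrite opprD opprB addrA addrCA subrr addr0.
Qed.

Lemma dressed b W V A a : bnd b W -> bnd b V -> bnd b A -> pmul W V = one ->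
  pmul A W = pmul W a -> A = pmul (pmul W a) V.
Proof.
move=> hW hV hA WV <-.
by rewrite -(bnd_pmulA hN hA hW hV) WV muldm1.
Qed.

Lemma intertwine_mul b W A B a a' :
  bnd b W -> bnd b A -> bnd b B -> bnd b a -> bnd b a' ->
  pmul A W = pmul W a -> pmul B W = pmul W a' ->
  pmul (pmul A B) W = pmul W (pmul a a').
Proof.
move=> hW hA hB ha ha' AW BW.
by rewrite -(bnd_pmulA hN hA hB hW) BW (bnd_pmulA hN hA hW ha') AW (bnd_pmulA hN hW ha ha').
Qed.

Lemma intertwine_sum b W (I : Type) (r : seq I) (A a : I -> pop) :
  bnd b W -> (forall k, bnd b (A k)) -> (forall k, bnd b (a k)) ->
  (forall k, pmul (A k) W = pmul W (a k)) ->
  pmul (\sum_(k <- r) A k) W = pmul W (\sum_(k <- r) a k).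
Proof.
move=> hW hA ha AW.
rewrite (pmul_suml hN _ hA hW) (pmul_sumr hN _ ha hW).
by apply: eq_bigr => k _.
Qed.

(** In row i the left side shifts by -e_alpha + delta_{i alpha} (1, ..., 1); for u = -e_alpha this
    is u - u_i (1, ..., 1). *)
Lemma link_sector (al : 'I_N) :
  pmul (dm (fun=> 1) (fun=> - delta_mx 0 al))
    (\sum_be pmul (dm (fun ga => (ga == be)%:R) (fun=> 0))
                  (dm (fun=> 1) (fun=> const_mx (al == be)%:Z))) =
  sector F (- delta_mx 0 al).
Proof.
apply/funext => v; apply/funext => s; apply/matrixP => i j.
rewrite dmul_dmE mul1r !fct_sumE summxE (bigD1 i) //= big1 => [|be bei].
  rewrite addr0 dm_mul !mxE !eqxx mulr1 add0r subr_eq addrC.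
  congr (_ *+ (v == _ + _) *+ _); apply/matrixP => y z; rewrite !mxE.
  by rewrite eq_sym; case: (i == al); rewrite ?oppr0 ?opprK.
by rewrite dm_mul !mxE eq_sym (negPf bei) mul0r !mul0rn.
Qed.

End Dressing.

Section SectorEquality.
Context (F : comNzRingType) (N : nat) (hN : (0 < N)%N).
Local Notation vec := ('rV[int]_N).
Local Notation pop := (vec -> vec -> 'M[F]_N).
Context (W V Wb Vb : pop).
Context (hW : bnd false W) (hV : bnd false V).
Context (hWb : bnd true Wb) (hVb : bnd true Vb).
Context (WV : pmul W V = @dm1 F N) (VW : pmul V W = @dm1 F N).
Context (WVb : pmul Wb Vb = @dm1 F N) (VWb : pmul Vb Wb = @dm1 F N).

Let agree u := pmul (pmul W (sector F u)) V = pmul (pmul Wb (sector F u)) Vb.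

(* Sectors only depend on u modulo (1, ..., 1), and every class modulo
   (1, ..., 1) contains a nonnegative combination of the -e_alpha. *)
Lemma sectors_agree : (forall al, agree (- delta_mx 0 al)) -> forall u, agree u.
Proof.
move=> h; have agreeD u u' : agree u -> agree u' -> agree (u + u').
  move=> au au'; rewrite /agree -!sector_mul.
  rewrite -(conj_mul hN hW hV (bnd_dm _ _ _) (bnd_dm _ _ _) VW).
  by rewrite -(conj_mul hN hWb hVb (bnd_dm _ _ _) (bnd_dm _ _ _) VWb) au au'.
have agree0 : agree 0 by rewrite /agree sector0 !muldm1 WV WVb.
have agreeMn u n : agree u -> agree (u *+ n).
  move=> au; elim: n => [|n IH]; first by rewrite mulr0n.
  by rewrite mulrS; exact: agreeD.
(* c dominates all |u_alpha|, so u - c (1, ..., 1) has coordinates <= 0, and it defines the same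
   sector as u. *)
move=> u; pose c := (\sum_al absz (u 0 al)%R)%N.
rewrite /agree -(sector_const F u (- c%:Z)) -/(agree _).
have -> : u + const_mx (- c%:Z) =
    \sum_al (- delta_mx 0 al) *+ absz (c%:Z - u 0 al)%R.
  apply/matrixP => i al; rewrite summxE (bigD1 al) //= big1 => [|be bal].
    rewrite ord1 mulmxnE !mxE !eqxx addr0.
    have : (absz (u 0 al)%R <= c)%N by rewrite /c (bigD1 al) //= leq_addr.
    have aux (a : int) : (absz a <= c)%N -> a - c%:Z = - 1 *+ absz (c%:Z - a)%R.
      by rewrite mulNrn -mulr_natl mulr1 natz; lia.
    exact: aux.
  by rewrite mulmxnE !mxE [al == be]eq_sym (negPf bal) andbF oppr0 mul0rn.
by apply: big_ind => // al _; exact/agreeMn/h.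
Qed.

End SectorEquality.

Section Bare.
Context (F : numFieldType) (N : nat).

Lemma bare_diag b (al : 'I_N) n : bare F b (b, al, n) =
  pmul (dm (fun=> 1) (fun=> const_mx (sg b * n.+1%:Z)))
       (dm (fun be => (be == al)%:R) (fun=> 0)).
Proof.
rewrite dm_mul; congr dm; apply/funext => be; last by rewrite addr0.
by rewrite mul1r xpair_eqE eqxx /= eq_sym.
Qed.

Lemma bare_off b (t : tindex N) : t.1.1 != b -> bare F b t = 0.
Proof.
move=> tb; apply/funext => v; apply/funext => s; apply/matrixP => i j.
rewrite !mxE; case: t.1 tb => a al /= /negPf ab.
by rewrite xpair_eqE ab mul0rn mul0rn.
Qed.

(** Division by n + 1 in the form of a right factor, so that it can be absorbed into the operator
    C_m. *)
Lemma natmul_dm (A B : 'rV[int]_N -> 'rV[int]_N -> 'M[F]_N) n :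
  A *+ n.+1 = B -> A = pmul B (dm (fun=> n.+1%:R^-1) (fun=> 0)).
Proof.
move=> <-; apply/funext => v; apply/funext => s; apply/matrixP => i j.
rewrite mul_dmE subr0 !natmulfctE mulmxnE.
by rewrite -[X in X / _]mulr_natr mulfK // pnatr_eq0.
Qed.

End Bare.

Section PositiveNegativeParts.
#[local] Opaque pderiv smooth pmul dm.
Context (R : realType) (N : nat) (D : set (times R N)) (hD : line_open D).
Implicit Types (A : diffop R N).

(** Truncation bounds the operator on one side and [A] on the other, so the result may multiply
    series of either direction. *)
Lemma ubnd_oppos b A : ubnd D false A -> ubnd D b (oppos A).
Proof.
case: b => [_|[S hA]].
  exists [:: 0] => x _ v s; rewrite /pt /oppos.
  case: asboolP => // -[j ->] _; exists 0; first exact: mem_head.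
  by exists j; apply/matrixP => k l; rewrite !mxE mulN1r opprK add0r.
exists S => x Dx v s; rewrite /pt /oppos; case: asboolP => // _.
exact: hA x Dx v s.
Qed.

Lemma ubnd_opneg b A : ubnd D true A -> ubnd D b (opneg A).
Proof.
case: b => [[S hA]|_].
  exists S => x Dx v s; rewrite /pt /opneg; case: asboolP => // _.
  exact: hA x Dx v s.
exists [:: 0] => x _ v s; rewrite /pt /opneg.
case: asboolP => // -[j ->] _; exists 0; first exact: mem_head.
by exists j.+1; apply/matrixP => k l; rewrite !mxE mul1r add0r.
Qed.

Lemma smop_oppos A : smop D A -> smop D (oppos A).
Proof.
move=> sA v s k l.
have [c|c] := pselect (exists j : nat, v = const_mx j%:Z).
  apply: (smooth_congr hD _ (sA v s k l)) => x _.
  by rewrite /oppos; case: asboolP.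
apply: (smooth_congr hD _ (@smooth_cst R N D 0)) => x _.
by rewrite /oppos; case: asboolP => // _; rewrite mxE.
Qed.

Lemma smop_opneg A : smop D A -> smop D (opneg A).
Proof.
move=> sA v s k l.
have [c|c] := pselect (exists j : nat, v = const_mx (- j.+1%:Z)).
  apply: (smooth_congr hD _ (sA v s k l)) => x _.
  by rewrite /opneg; case: asboolP.
apply: (smooth_congr hD _ (@smooth_cst R N D 0)) => x _.
by rewrite /opneg; case: asboolP => // _; rewrite mxE.
Qed.

Lemma eqD_pt A B x : opeq D A B -> D x -> pt x A = pt x B.
Proof. by move=> h Dx; apply/(opeqP D A B).1. Qed.

Lemma pt_const_op (M : 'rV[int]_N -> 'rV[int]_N -> 'M[R[i]]_N) x : pt x (const_op M) = M.
Proof. by []. Qed.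

End PositiveNegativeParts.

Section Twist0.
#[local] Opaque pderiv smooth pmul dm.
Context (R : realType) (N K : nat) (hN : (0 < N)%N).
Implicit Types (A : diffop R N) (x : times R N).

Definition mexp0 : mexp N K := [ffun=> 0%N].

Lemma mseq_zero : perm_eq (mseq mexp0) [:: mexp0].
Proof.
apply: uniq_perm; rewrite ?mseq_uniq // => q; rewrite mem_mseq inE.
apply/forallP/eqP => [h|-> //]; apply/ffunP => i.
by have := h i; rewrite ffunE leqn0 => /eqP ->.
Qed.

Lemma exp_coef_zero (F : numFieldType) b : exp_coef F b mexp0 = @dm1 F N.
Proof.
congr dm; apply/funext => al.
  have -> : [forall i, (mexp0 i != 0%N) ==> (i.1 == (b, al))].
    by apply/forallP => i; rewrite ffunE.
  by rewrite /mfact big1 ?invr1 // => i _; rewrite ffunE.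
rewrite /weight big1 ?mulr0 ?const0 // => i _; by rewrite ffunE muln0.
Qed.

Lemma taylor_zero A x : pt x (taylor_op mexp0 A) = pt x A.
Proof.
apply/funext => v; apply/funext => s; apply/matrixP => k l.
have ml : mlist mexp0 = [::].
  rewrite /mlist; elim: (enum _) => //= i r ->.
  by rewrite ffunE.
apply: etrans (taylor_opE _ _ _ _ _ _ _) _; rewrite ml.
have -> : (\sum_i mexp0 i = 0)%N by apply: big1 => i _; rewrite ffunE.
have -> : mfact mexp0 = 1%N by apply: big1 => i _; rewrite ffunE.
by rewrite expr0 divr1 mul1r.
Qed.

Lemma twist_zero b A x : pt x (twist b mexp0 A) = pt x A.
Proof.
rewrite /twist (perm_big _ mseq_zero) big_seq1.
have -> : msub mexp0 mexp0 = mexp0 by apply/ffunP => i; rewrite !ffunE.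
have E := congr1 (fun B => pmul B (pt x (taylor_op mexp0 A)))
  (exp_coef_zero R[i] b).
by apply: etrans E _; rewrite mul1dm; exact: taylor_zero.
Qed.

End Twist0.

(** * From solutions to the bilinear identity *)

Section Powers.
#[local] Opaque pderiv smooth pmul dm.
Context (R : realType) (N : nat) (hN : (0 < N)%N).
Context (D : set (times R N)) (hD : line_open D).
Implicit Types (A : diffop R N) (b : bool).

Lemma ubnd_const b A a u : (forall x, pt x A = dm a u) -> ubnd D b A.
Proof.
by move=> h; have [S hS] := ubnd_dm D b a u; exists S => x Dx; rewrite h; exact: hS x Dx.
Qed.

Lemma smop_const A a u : (forall x, pt x A = dm a u) -> smop D A.
Proof.
move=> h; apply: (smop_eqD hD _ (smop_const_op D (dm a u))) => x _.
exact: esym (h x).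
Qed.

Lemma ubnd_pow b A n : ubnd D b A -> ubnd D b (oppow A n).
Proof.
move=> hA; elim: n => [|n IH]; first exact: ubnd_const (@pt_1 R N).
exact: ubnd_mul.
Qed.

Lemma smop_pow b A n : ubnd D b A -> smop D A -> smop D (oppow A n).
Proof.
move=> hA sA; elim: n => [|n IH]; first exact: smop_const (@pt_1 R N).
exact: (smop_mul hN hD hA (ubnd_pow n hA) sA IH).
Qed.

End Powers.

Section SolutionToBilinear.
#[local] Opaque pderiv smooth pmul dm.
Context (R : realType) (N : nat) (hN : (0 < N)%N).
Context (D : set (times R N)) (hD : line_open D).
Context (L Lb : diffop R N) (U Ub Q Qb : 'I_N -> diffop R N).
Context (w wb ws wbs : nat -> coef R N).
Context (sol : toda_solution D L Lb U Ub Q Qb).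
Context (wav : wave_operators D L Lb U Ub Q Qb w wb).
Context (sws : forall j, smooth_coef D (ws j)).
Context (swbs : forall j, smooth_coef D (wbs j)).
Context (inv : opinverse D (lower 0 w) (adj_lower ws)).
Context (invb : opinverse D (upper 0 wb) (adj_upper wbs)).
Local Notation C := R[i].
Local Notation one := (@dm1 C N).
Implicit Types (x : times R N) (b : bool) (t : tindex N).

Let W b := one_sided b 0 (if b then wb else w).
Let V b := adj_one_sided b (if b then wbs else ws).

Let hW b : ubnd D b (W b). Proof. exact: ubnd_gen. Qed.
Let hV b : ubnd D b (V b). Proof. exact: ubnd_adj. Qed.

Let sW b : smop D (W b).
Proof.
apply: (smop_gen hN hD); case: b; [exact: wave_smoothb wav|exact: wave_smooth wav].
Qed.

Let sV b : smop D (V b).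
Proof. by apply: (smop_adj hN hD); case: b. Qed.

Let WV b x : D x -> pmul (pt x (W b)) (pt x (V b)) = one.
Proof.
move=> Dx; rewrite -(pt_1 x).
by case: b; [exact: (eqD_pt invb.1 Dx)|exact: (eqD_pt inv.1 Dx)].
Qed.

Let VW b x : D x -> pmul (pt x (V b)) (pt x (W b)) = one.
Proof.
move=> Dx; rewrite -(pt_1 x).
by case: b; [exact: (eqD_pt invb.2 Dx)|exact: (eqD_pt inv.2 Dx)].
Qed.

Let shapeL : ubnd D false L /\ smop D L.
Proof.
have [[c [sc _ E]] _ _ _ _ _] := let: And3 s _ _ := sol in s.
have {}E : eqD D (one_sided false 1 c) L by move=> x Dx; exact: esym (eqD_pt E Dx).
split; first exact: ubnd_eqD E (ubnd_gen _ _ _ _).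
exact: (smop_eqD hD E (smop_gen hN hD _ _ sc)).
Qed.

Let shapeLb : ubnd D true Lb /\ smop D Lb.
Proof.
have [_ [c [sc _ E]] _ _ _ _] := let: And3 s _ _ := sol in s.
have {}E : eqD D (one_sided true (-1) c) Lb by move=> x Dx; exact: esym (eqD_pt E Dx).
split; first exact: ubnd_eqD E (ubnd_gen _ _ _ _).
exact: (smop_eqD hD E (smop_gen hN hD _ _ sc)).
Qed.

Let shapeU al : ubnd D false (U al) /\ smop D (U al).
Proof.
have [_ _ h _ _ _] := let: And3 s _ _ := sol in s.
have [c [sc _ E]] := h al.
have {}E : eqD D (one_sided false 0 c) (U al) by move=> x Dx; exact: esym (eqD_pt E Dx).
split; first exact: ubnd_eqD E (ubnd_gen _ _ _ _).
exact: (smop_eqD hD E (smop_gen hN hD _ _ sc)).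
Qed.

Let shapeUb al : ubnd D true (Ub al) /\ smop D (Ub al).
Proof.
have [_ _ _ h _ _] := let: And3 s _ _ := sol in s.
have [c [sc E]] := h al.
have {}E : eqD D (one_sided true 0 c) (Ub al) by move=> x Dx; exact: esym (eqD_pt E Dx).
split; first exact: ubnd_eqD E (ubnd_gen _ _ _ _).
exact: (smop_eqD hD E (smop_gen hN hD _ _ sc)).
Qed.

Let hQ al : ubnd D false (Q al).
Proof.
have [_ _ _ _ h _] := let: And3 s _ _ := sol in s.
have [c [_ _ E]] := h al.
have {}E : eqD D (opdown R al *o one_sided false 0 c) (Q al).
  by move=> x Dx; exact: esym (eqD_pt E Dx).
apply: ubnd_eqD E _; apply: (ubnd_mul hN); last exact: ubnd_gen.
exact: ubnd_const (fun x => pt_down x al).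
Qed.

Let hQb al : ubnd D true (Qb al).
Proof.
have [_ _ _ _ _ h] := let: And3 s _ _ := sol in s.
have [c [_ E]] := h al.
have {}E : eqD D (opdown R al *o one_sided true 0 c) (Qb al).
  by move=> x Dx; exact: esym (eqD_pt E Dx).
apply: ubnd_eqD E _; apply: (ubnd_mul hN); last exact: ubnd_gen.
exact: ubnd_const (fun x => pt_down x al).
Qed.

Let B t : diffop R N :=
  if t.1.1 then opBb Lb Ub t.1.2 t.2.+1 else opB L U t.1.2 t.2.+1.

Let hB b t : ubnd D b (B t).
Proof.
have [[hL _] [hLb _]] := (shapeL, shapeLb).
rewrite /B; case: t => -[[] al] n /=.
  by apply/ubnd_opneg/ubnd_mul/(shapeUb al).1 => //; exact: ubnd_pow.
by apply/ubnd_oppos/ubnd_mul/(shapeU al).1 => //; exact: ubnd_pow.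
Qed.

Let sB t : smop D (B t).
Proof.
have [[hL sL] [hLb sLb]] := (shapeL, shapeLb).
have [hU sU] := shapeU t.1.2; have [hUb sUb] := shapeUb t.1.2.
rewrite /B; case: ifP => _.
  apply: (smop_opneg hD); apply: (smop_mul hN hD (ubnd_pow hN _ hLb) hUb _ sUb).
  exact: (smop_pow hN hD _ hLb sLb).
apply: (smop_oppos hD); apply: (smop_mul hN hD (ubnd_pow hN _ hL) hU _ sU).
exact: (smop_pow hN hD _ hL sL).
Qed.

Let bE b t x : bnd b (bare C b t). Proof. exact: bnd_dm. Qed.

(** The four evolution equations in one: the bare operator vanishes unless the flow t belongs to
    side b. *)
Let evolution b t x : D x -> pt x (dop t (W b)) =
  pmul (pt x (B t)) (pt x (W b)) - pmul (pt x (W b)) (bare C b t).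
Proof.
move=> Dx; have bW := ubnd_bnd (hW b) Dx.
have nobare : t.1.1 != b -> pmul (pt x (W b)) (bare C b t) = 0.
  by move=> tb; rewrite bare_off // pmul0r.
have barE al n : pmul (pt x (W b)) (bare C b (b, al, n)) =
    pmul (pmul (pt x (W b)) (pt x (opexp R N (sg b * n.+1%:Z))))
         (pt x (opE R al)).
  rewrite pt_exp pt_E bare_diag.
  by rewrite (bnd_pmulA hN bW (bnd_dm _ _ _) (bnd_dm _ _ _)).
case: b {bW} nobare barE => nobare barE; case: t nobare => -[[] al] n /= nobare.
- rewrite barE; have := eqD_pt (wave_dtbW wav al n) Dx.
  by rewrite /sg expr1 mulN1r.
- rewrite nobare // subr0; exact: eqD_pt (wave_dtW wav al n) Dx.
- rewrite nobare // subr0; exact: eqD_pt (wave_dtb wav al n) Dx.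
- rewrite barE; have := eqD_pt (wave_dt wav al n) Dx.
  by rewrite /sg expr0 mul1r.
Qed.

Let evolutionV b t x : D x -> pt x (dop t (V b)) =
  pmul (bare C b t) (pt x (V b)) - pmul (pt x (V b)) (pt x (B t)).
Proof.
move=> Dx.
apply: (inverse_evolution hN (ubnd_bnd (hW b) Dx) (ubnd_bnd (hV b) Dx)
  (ubnd_bnd (ubnd_dop hD t (hW b)) Dx) (ubnd_bnd (ubnd_dop hD t (hV b)) Dx)
  (ubnd_bnd (hB b t) Dx) (bE b t x) (WV b Dx) (VW b Dx) (evolution b t Dx)).
rewrite -(dopM hN hD t (hV b) (hW b) (sV b) (sW b) Dx).
have E : eqD D (V b *o W b) (const_op one) by move=> y Dy; exact: VW.
by rewrite (dop_eqD hD t E Dx) dop_const_op.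
Qed.

(** The operator is chosen before b, which is the point: the same C_m serves both sides. Induction
    on the total degree of m. *)
Let twistV K (m : mexp N K) : exists A : diffop R N,
  [/\ forall b, ubnd D b A, smop D A & forall b x, D x ->
      pt x (twist b m (V b)) = pmul (pt x (V b)) (pt x A)].
Proof.
have [n nE] := ubnP (\sum_i m i)%N; elim: n m nE => // n IH m nE.
have [->|[i mi]] : m = @mexp0 N K \/ exists i, (0 < m i)%N.
- have [/existsP[i mi]|/existsPn mz] := boolP [exists i, (0 < m i)%N].
    by right; exists i.
  left; apply/ffunP => i; rewrite ffunE; apply/eqP.
  by have := mz i; rewrite lt0n negbK.
- exists (const_op one); split=> [b||b x Dx].
  + exact: ubnd_dm.
  + exact: smop_const_op.
  + by rewrite pt_const_op muldm1; exact: twist_zero.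
pose m' : mexp N K := [ffun j => (m j - (j == i))%N].
have mE : m = madd m' i.
  apply/ffunP => j; rewrite !ffunE; case: eqP => [->|_] /=; rewrite ?subn0 ?addn0 //.
  by rewrite subnK.
have {}nE : (\sum_i m' i < n)%N.
  by move: nE; rewrite [in X in X -> _]mE total_madd ltnS.
have [A [hA sA AE]] := IH m' nE.
set t := tindex_of i.
pose k := dm (fun=> (m' i).+1%:R^-1 : C) (fun=> 0 : 'rV[int]_N).
have hBA b := ubnd_mul hN (hB b t) (hA b).
have sBA := smop_mul hN hD (hB false t) (hA false) (sB t) sA.
have hY b := ubnd_add (hBA b) (ubnd_opp (ubnd_dop hD t (hA b))).
have sY := smop_add hD sBA (smop_opp hD (smop_dop hD t sA)).
(* C_{m' + e_i} = (B C_{m'} - d C_{m'}) / (m'_i + 1), obtained from [twist_madd] after the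
   cancellation in [twist_step]. *)
exists ((B t *o A - dop t A) *o const_op k); split=> [b||b x Dx].
- exact: (ubnd_mul hN (hY b) (ubnd_dm _ _ _ _)).
- exact: (smop_mul hN hD (hY false) (ubnd_dm _ _ _ _) sY (smop_const_op _ _)).
have [bV bB bA] : [/\ bnd b (pt x (V b)), bnd b (pt x (B t)) & bnd b (pt x A)].
  by split; [exact: (ubnd_bnd (hV b) Dx)|exact: ubnd_bnd (hB b t) Dx|
             exact: (ubnd_bnd (hA b) Dx)].
have bdV := ubnd_bnd (ubnd_dop hD t (hV b)) Dx.
have bdA := ubnd_bnd (ubnd_dop hD t (hA b)) Dx.
have T := twist_madd hN hD m' i (hV b) (sV b) Dx.
rewrite -mE (AE b x Dx) in T.
have E : eqD D (twist b m' (V b)) (V b *o A) by move=> y Dy; exact: AE.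
rewrite (dop_eqD hD (tindex_of i) E Dx) in T.
rewrite (dopM hN hD (tindex_of i) (hV b) (hA b) (sV b) sA Dx) in T.
have S := twist_step hN bV bB bA bdV bdA (bE b t x) (evolutionV b t Dx).
rewrite (natmul_dm (etrans T S)) -(bnd_pmulA hN bV _ (bnd_dm b _ _)) //.
exact: (bnd_sub (bnd_mul hN bB bA) bdA).
Qed.

Let powb (A : diffop R N) (c : bool) x :
  pt x (oppow A c) = if c then pt x A else one.
Proof.
case: c; last exact: pt_1.
rewrite -[RHS]muldm1; exact: (congr1 (pmul (pt x A)) (pt_1 x)).
Qed.

Let deltaE (c : bool) : (if c then dm (fun=> 1) (fun=> const_mx 1) else one) =
  dm (fun=> 1 : C) (fun=> const_mx c%:Z).
Proof. by case: c => //; rewrite /dm1 const0. Qed.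

(** Meant for [A] equal to L or to the inverse of \bar L, since both intertwine with e^{d_s}; the
    two sides of the link condition thus become the same sector dressed by the two wave
    operators. *)
Let sector_of_link (b : bool) (P : 'I_N -> diffop R N) (X A : diffop R N) al x :
  D x -> bnd b (pt x X) -> bnd b (pt x A) -> (forall be, bnd b (pt x (P be))) ->
  pmul (pt x X) (pt x (W b)) =
    pmul (pt x (W b)) (dm (fun=> 1) (fun=> - delta_mx 0 al)) ->
  pmul (pt x A) (pt x (W b)) =
    pmul (pt x (W b)) (dm (fun=> 1) (fun=> const_mx 1)) ->
  (forall be, pmul (pt x (P be)) (pt x (W b)) =
    pmul (pt x (W b)) (dm (fun ga => (ga == be)%:R) (fun=> 0))) ->
  pt x (X *o (\sum_be P be *o oppow A (al == be))) =
  pmul (pmul (pt x (W b)) (sector C (- delta_mx 0 al))) (pt x (V b)).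
Proof.
move=> Dx bX bA bP XW AW PW.
have [bW bV] := (ubnd_bnd (hW b) Dx, ubnd_bnd (hV b) Dx).
have bpow (c : bool) : bnd b (pt x (oppow A c)).
  by rewrite powb; case: c => //; exact: bnd_dm.
have PowW (c : bool) : pmul (pt x (oppow A c)) (pt x (W b)) =
    pmul (pt x (W b)) (dm (fun=> 1) (fun=> const_mx c%:Z)).
  rewrite powb -deltaE; case: c => //; by rewrite mul1dm muldm1.
have bD a u : bnd b (dm a u : _ -> _ -> 'M[C]_N) := bnd_dm b a u.
rewrite -link_sector.
have bPp be := bnd_mul hN (bP be) (bpow (al == be)).
have bEe be := bnd_mul hN (bD (fun ga => (ga == be)%:R) (fun=> 0))
  (bD (fun=> 1) (fun=> const_mx (al == be)%:Z)).
have PpW be := intertwine_mul hN bW (bP be) (bpow (al == be)) (bD _ _) (bD _ _)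
  (PW be) (PowW (al == be)).
have bS (f : 'I_N -> 'rV[int]_N -> 'rV[int]_N -> 'M[C]_N) :
    (forall be, bnd b (f be)) -> bnd b (\sum_be f be) by exact: bnd_sum.
have SW := intertwine_sum hN (index_enum _) bW bPp bEe PpW.
have XSW := intertwine_mul hN bW bX (bS _ bPp) (bD _ _) (bS _ bEe) XW SW.
have := dressed hN bW bV (bnd_mul hN bX (bS _ bPp)) (WV b Dx) XSW.
by rewrite -(pt_sum _ (fun be => P be *o oppow A (al == be))).
Qed.

Lemma solution_to_bilinear : bilinear_identity D w wb ws wbs.
Proof.
apply/(bilinear_identity_sectors hN) => x Dx K m u.
have [A [hA sA AE]] := twistV m.
have [bW bV bA] : [/\ forall b, bnd b (pt x (W b)), forall b, bnd b (pt x (V b))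
    & forall b, bnd b (pt x A)].
  by split=> b; apply: (fun h => ubnd_bnd h Dx).
have bS b : bnd b (sector C u) := bnd_dm b _ _.
have T b := congr1 (pmul (pmul (pt x (W b)) (sector C u))) (AE b x Dx).
have T' b := etrans (T b)
  (bnd_pmulA hN (bnd_mul hN (bW b) (bS b)) (bV b) (bA b)).
apply: etrans (T' false) (etrans _ (esym (T' true))).
apply: (congr1 (fun Z => pmul Z (pt x A))).
apply: (sectors_agree hN (bW false) (bV false) (bW true) (bV true)
  (WV false Dx) (VW false Dx) (WV true Dx) (VW true Dx)) => al.
have [c [_ [invc1 invc2] link]] := toda_link (let: And3 _ a _ := sol in a).
have cLb := eqD_pt invc2 Dx; have Lbc := eqD_pt invc1 Dx.
have := eqD_pt (link al) Dx.
have [[hL _] [hLb _]] := (shapeL, shapeLb).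
rewrite (sector_of_link (b := false) Dx (ubnd_bnd (hQ al) Dx) (ubnd_bnd hL Dx)
  (fun be => ubnd_bnd (shapeU be).1 Dx)); last 3 first.
- by have := eqD_pt (wave_Q wav al) Dx; rewrite -(pt_down x al).
- by have := eqD_pt (wave_L wav) Dx; rewrite -(pt_exp x 1).
- by move=> be; have := eqD_pt (wave_U wav be) Dx; rewrite -(pt_E x be).
move=> ->; have bc : bnd true (pt x (upper 1 c)) by exact: (bnd_gen true).
apply: (sector_of_link (b := true) Dx (ubnd_bnd (hQb al) Dx) bc
  (fun be => ubnd_bnd (shapeUb be).1 Dx)).
- by have := eqD_pt (wave_Qb wav al) Dx; rewrite -(pt_down x al).
(* The wave equations concern \bar L; inserting 1 = \bar L^{-1} \bar L on the left transfers them to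
   [upper 1 c], with the inverse shift. *)
- have LW : pmul (pt x Lb) (pt x (W true)) =
      pmul (pt x (W true)) (dm (fun=> 1) (fun=> const_mx (-1))).
    by rewrite -(pt_exp x (-1)); exact: eqD_pt (wave_Lb wav) Dx.
  have bD a v : bnd true (dm a v : _ -> _ -> 'M[C]_N) := bnd_dm true a v.
  have bLb := ubnd_bnd hLb Dx.
  have e1 : pmul (dm (fun=> 1) (fun=> const_mx (-1)))
      (dm (fun=> 1) (fun=> const_mx 1)) = one.
    rewrite dm_mul; congr dm; apply/funext => be; first exact: mulr1.
    by apply/matrixP => i j; rewrite !mxE addNr.
  have cLb1 : pmul (pt x (upper 1 c)) (pt x Lb) = one by rewrite -(pt_1 x).
  rewrite -[RHS]mul1dm -cLb1 -(bnd_pmulA hN bc bLb (bnd_mul hN (bW _) (bD _ _))).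
  rewrite (bnd_pmulA hN bLb (bW true) (bD _ _)) LW -(bnd_pmulA hN (bW true) (bD _ _) (bD _ _)).
  by rewrite e1 muldm1.
- by move=> be; have := eqD_pt (wave_Ub wav be) Dx; rewrite -(pt_E x be).
Qed.

End SolutionToBilinear.

(** * From the bilinear identity to solutions *)

Section Conjugation.
Context (F : comNzRingType) (N : nat) (hN : (0 < N)%N).
Local Notation vec := ('rV[int]_N).
Local Notation pop := (vec -> vec -> 'M[F]_N).
Local Notation one := (@dm1 F N).
Implicit Types (A B C E W V X : pop) (b : bool) (d e : vec).

(** The parameters on the two rays satisfy j + k = 0, so only the two extreme terms meet at the
    shift d + e. *)
Lemma pmul_top b A B d e s : bandF b [:: d] A -> bandF b [:: e] B ->
  pmul A B (d + e) s = A d s *m B e (s + d).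
Proof.
move=> hA hB; rewrite /pmul (@fsum_seq _ _ [:: d]) // => [|u h].
  by rewrite big_seq1 [d + e]addrC addrK.
have [d' + [j uE]] := hA _ _ (mulmx_neq0l h); rewrite inE => /eqP dE.
have [e' + [k vE]] := hB _ _ (mulmx_neq0r h); rewrite inE => /eqP eE.
move: vE; rewrite uE dE eE => /matrixP/(_ 0 (Ordinal hN)); rewrite !mxE.
have aux (y z : int) : y + z - (y - sg b * j%:Z) = z - sg b * k%:Z -> j = 0%N.
  by have [->|->] := sgP b; lia.
by move=> /aux ->; rewrite mulr0 const0 subr0 mem_head.
Qed.

(* On the coefficients R_n, idempotency reads R_n = 2 R_n once R_j = 0 is known
   for 0 < j < n. *)
Lemma unipotent_idempotent b A : bandF b [:: 0] A ->
  (forall s, A 0 s = 1%:M) -> pmul A A = A -> A = one.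
Proof.
move=> hA A0 AA.
have supp v s : A v s <> 0 -> exists j : nat, v = - const_mx (sg b * j%:Z).
  move=> /hA[f]; rewrite inE => /eqP -> [j ->]; exists j; exact: sub0r.
have vanish n : forall s, (0 < n)%N -> A (- const_mx (sg b * n%:Z)) s = 0.
  elim/ltn_ind: n => n IH s n0; set v := - const_mx _.
  have vn0 : 0 != v.
    apply/eqP => /matrixP/(_ 0 (Ordinal hN)); rewrite !mxE.
    by have [->|->] := sgP b; lia.
  have : pmul A A v s = A v s by rewrite AA.
  rewrite /pmul (@fsum_seq _ _ [:: 0; v]); last 2 first.
  - by rewrite /= inE vn0.
  - move=> u h; have [j uE] := supp _ _ (mulmx_neq0l h).
    have [k vE] := supp _ _ (mulmx_neq0r h).
    have jk : (j + k = n)%N.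
      move: vE; rewrite uE => /matrixP/(_ 0 (Ordinal hN)); rewrite !mxE.
      by have [->|->] := sgP b; lia.
    case: (posnP j) => [j0|j0].
      by rewrite uE j0 mulr0 const0 oppr0 mem_head.
    case: (posnP k) => [k0|k0].
      have jn : j = n by rewrite -jk k0 addn0.
      by rewrite uE jn !inE eqxx orbT.
    case: (mulmx_neq0l h); rewrite uE; apply: IH => //; lia.
  rewrite big_cons big_seq1 subr0 addr0 subrr !A0 mul1mx mulmx1.
  by move/eqP; rewrite -subr_eq0 addrK => /eqP.
apply/funext => v; apply/funext => s.
have [->|v0] := eqVneq v 0.
  by rewrite A0; apply/matrixP => i j; rewrite !mxE eqxx.
have -> : A v s = 0.
  apply: contrapT => nz; have [j vE] := supp _ _ nz; apply: nz.
  rewrite vE; apply: vanish; rewrite lt0n; apply: contra v0 => /eqP j0.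
  by rewrite vE j0 mulr0 const0 oppr0.
by apply/matrixP => i j; rewrite !mxE (negPf v0) mulr0n mul0rn.
Qed.

Definition conjop W V X := pmul (pmul W X) V.

Section FixedPair.
Context (b : bool) (W V : pop).
Context (hW : bnd b W) (hV : bnd b V).
Context (WV : pmul W V = one) (VW : pmul V W = one).

Lemma conjM X Y : bnd b X -> bnd b Y ->
  pmul (conjop W V X) (conjop W V Y) = conjop W V (pmul X Y).
Proof. by move=> hX hY; exact: (conj_mul hN hW hV hX hY VW). Qed.

Lemma conj1 : conjop W V one = one.
Proof. by rewrite /conjop muldm1. Qed.

Lemma conj_sum (I : Type) (r : seq I) (f : I -> pop) :
  (forall k, bnd b (f k)) ->
  \sum_(k <- r) conjop W V (f k) = conjop W V (\sum_(k <- r) f k).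
Proof.
move=> hf; rewrite /conjop (pmul_sumr hN _ hf hW).
by rewrite (pmul_suml hN _ (fun k => bnd_mul hN hW (hf k)) hV).
Qed.

Lemma conj_intertwine X : bnd b X -> pmul (conjop W V X) W = pmul W X.
Proof.
move=> hX; rewrite /conjop -(bnd_pmulA hN (bnd_mul hN hW hX) hV hW) VW.
exact: muldm1.
Qed.

(** The bare terms W X E V and W E X V cancel because X commutes with E. *)
Lemma conj_lax dW dV B E X : bnd b dW -> bnd b dV -> bnd b B -> bnd b E ->
  bnd b X -> pmul X E = pmul E X ->
  dW = pmul B W - pmul W E -> dV = pmul E V - pmul V B ->
  pmul (pmul dW X) V + pmul (pmul W X) dV =
  pmul B (conjop W V X) - pmul (conjop W V X) B.
Proof.
move=> hdW hdV hB hE hX XE -> ->.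
have [hBW hWE] := (bnd_mul hN hB hW, bnd_mul hN hW hE).
have [hEV hVB] := (bnd_mul hN hE hV, bnd_mul hN hV hB).
have hWX := bnd_mul hN hW hX.
rewrite (pmulDl hN hBW (bnd_opp hWE) hX) (pmulNl hN hWE hX).
rewrite (pmulDl hN (bnd_mul hN hBW hX) (bnd_opp (bnd_mul hN hWE hX)) hV).
rewrite (pmulNl hN (bnd_mul hN hWE hX) hV).
rewrite (pmulDr hN hEV (bnd_opp hVB) hWX) (pmulNr hN hWX hVB).
have -> : pmul (pmul (pmul B W) X) V = pmul B (conjop W V X).
  by rewrite -(bnd_pmulA hN hB hW hX) -(bnd_pmulA hN hB hWX hV).
have -> : pmul (pmul W X) (pmul V B) = pmul (conjop W V X) B.
  by rewrite (bnd_pmulA hN hWX hV hB).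
have -> : pmul (pmul W X) (pmul E V) = pmul (pmul (pmul W E) X) V.
  rewrite (bnd_pmulA hN hWX hE hV) -(bnd_pmulA hN hW hX hE) XE.
  by rewrite (bnd_pmulA hN hW hE hX).
by rewrite -addrA addKr.
Qed.

End FixedPair.

Lemma evolution_of_product b W V dW B E :
  bnd b W -> bnd b V -> bnd b dW -> bnd b B -> bnd b E -> pmul V W = one ->
  pmul dW V = B - conjop W V E -> dW = pmul B W - pmul W E.
Proof.
move=> hW hV hdW hB hE VW dWV.
have hC : bnd b (conjop W V E) := bnd_mul hN (bnd_mul hN hW hE) hV.
rewrite -[LHS]muldm1 -VW (bnd_pmulA hN hdW hV hW) dWV.
rewrite (pmulDl hN hB (bnd_opp hC) hW) (pmulNl hN hC hW).
by rewrite (conj_intertwine hW hV VW hE).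
Qed.

(** The first-order bilinear identity differentiates V; d(W V) = 0 converts it into a statement on
    dW. *)
Lemma product_derivative b W V dW dV E :
  bnd b W -> bnd b V -> bnd b dW -> bnd b dV -> bnd b E ->
  pmul dW V + pmul W dV = 0 ->
  pmul W (pmul E V - dV) = conjop W V E + pmul dW V.
Proof.
move=> hW hV hdW hdV hE /eqP; rewrite addr_eq0 => /eqP ->.
rewrite (pmulDr hN (bnd_mul hN hE hV) (bnd_opp hdV) hW) (pmulNr hN hW hdV).
by rewrite (bnd_pmulA hN hW hE hV).
Qed.

End Conjugation.

Section DiagonalSums.
Context (F : comNzRingType) (N : nat).
Local Notation vec := ('rV[int]_N).

Lemma dm_sum (I : Type) (r : seq I) (a : I -> 'I_N -> F) (u : 'I_N -> vec) :
  \sum_(k <- r) dm (a k) u = dm (fun al => \sum_(k <- r) a k al) u.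
Proof.
apply/funext => v; apply/funext => s; apply/matrixP => i j.
rewrite !fct_sumE summxE !mxE -sumrMnl -sumrMnl.
by apply: eq_bigr => k _; rewrite !mxE.
Qed.

Lemma dm_units_sum : \sum_al dm (fun be => (be == al)%:R) (fun=> 0) = @dm1 F N.
Proof.
rewrite dm_sum; congr dm; apply/funext => be.
rewrite (bigD1 be) //= eqxx big1 ?addr0 // => al /negPf.
by rewrite eq_sym => ->.
Qed.

Lemma dm_units_mul (al be : 'I_N) :
  pmul (dm (fun ga => (ga == al)%:R) (fun=> 0))
       (dm (fun ga => (ga == be)%:R) (fun=> 0)) =
  if al == be then dm (fun ga => (ga == be)%:R : F) (fun=> 0 : vec) else 0.
Proof.
rewrite dm_mul; case: eqP => [->|ab].
  congr dm; apply/funext => ga; last exact: addr0.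
  by case: eqP => _; rewrite ?mulr1 ?mulr0.
apply/funext => v; apply/funext => s; apply/matrixP => i j; rewrite !mxE.
case: (i =P al) => [->|_]; last by rewrite mul0r !mul0rn.
by case: (al =P be) => // _; rewrite mulr0 !mul0rn.
Qed.

Lemma sum_down : \sum_al - delta_mx 0 al = const_mx (-1) :> vec.
Proof.
apply/matrixP => i j; rewrite summxE (bigD1 j) //= big1 => [|al aj].
  by rewrite !mxE ord1 !eqxx addr0.
by rewrite !mxE [j == al]eq_sym (negPf aj) andbF oppr0.
Qed.

End DiagonalSums.

Section BilinearToSolution.
#[local] Opaque pderiv smooth pmul dm.
Context (R : realType) (N : nat) (hN : (0 < N)%N).
Context (D : set (times R N)) (hD : line_open D).
Context (w wb ws wbs : nat -> coef R N).
Context (sw : forall j, smooth_coef D (w j)).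
Context (swb : forall j, smooth_coef D (wb j)).
Context (sws : forall j, smooth_coef D (ws j)).
Context (swbs : forall j, smooth_coef D (wbs j)).
Context (w0 : forall s x, D x -> w 0%N s x = 1%:M).
Context (ws0 : forall s x, D x -> ws 0%N s x = 1%:M).
Context (wb0 : forall s x, D x -> wb 0%N s x \in unitmx).
Context (wbs0 : forall s x, D x -> wbs 0%N s x \in unitmx).
Context (bil : bilinear_identity D w wb ws wbs).
Local Notation C := R[i].
Local Notation vec := ('rV[int]_N).
Local Notation one := (@dm1 C N).
Implicit Types (x : times R N) (b : bool) (t : tindex N) (u v s : vec).

Let W b := one_sided b 0 (if b then wb else w).
Let V b := adj_one_sided b (if b then wbs else ws).

Let hW b : ubnd D b (W b). Proof. exact: ubnd_gen. Qed.
Let hV b : ubnd D b (V b). Proof. exact: ubnd_adj. Qed.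
Let sW b : smop D (W b). Proof. by apply: (smop_gen hN hD); case: b. Qed.
Let sV b : smop D (V b). Proof. by apply: (smop_adj hN hD); case: b. Qed.

Let bW b x : bnd b (pt x (W b)). Proof. exact: bnd_gen. Qed.
Let bV b x : bnd b (pt x (V b)). Proof. exact: bnd_adj. Qed.
Let bD b (a : 'I_N -> C) (u : 'I_N -> vec) : bnd b (dm a u : vec -> vec -> 'M[C]_N). Proof. exact: bnd_dm. Qed.

Let bandW b x : bandF b [:: 0] (pt x (W b)).
Proof. by rewrite -const0; exact: bandF_gen. Qed.

Let bandV b x : bandF b [:: 0] (pt x (V b)). Proof. exact: bandF_adj. Qed.

Let topW b x s : pt x (W b) 0 s = (if b then wb else w) 0%N s x.
Proof.
have := gen_at hN b 0 (if b then wb else w) 0 s x.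
by rewrite mulr0 subr0 const0.
Qed.

Let topV b x s : pt x (V b) 0 s = (if b then wbs else ws) 0%N (s + const_mx 1) x.
Proof.
have := adj_at hN b (if b then wbs else ws) 0 s x.
by rewrite mulr0 oppr0 const0 addr0.
Qed.

Let agree0 x u : D x ->
  pmul (pmul (pt x (W false)) (sector C u)) (pt x (V false)) =
  pmul (pmul (pt x (W true)) (sector C u)) (pt x (V true)).
Proof.
move=> Dx.
(* With K = 0 there are no variables, and the only monomial is 1. *)
have T := (bilinear_identity_sectors hN D w wb ws wbs).1 bil x Dx 0%N (@mexp0 N 0) u.
have E b := congr1 (pmul (pmul (pt x (W b)) (sector C u)))
  (twist_zero 0 b (V b) x).
exact: etrans (esym (E false)) (etrans T (E true)).
Qed.

Let band0_mul b (A B : vec -> vec -> 'M[C]_N) : bandF b [:: 0] A ->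
  bandF b [:: 0] B -> bandF b [:: 0] (pmul A B).
Proof. by move=> hA hB; have := bandF_mul hN hA hB; rewrite /addS /= addr0. Qed.

Let top0 b (A B : vec -> vec -> 'M[C]_N) s : bandF b [:: 0] A ->
  bandF b [:: 0] B -> pmul A B 0 s = A 0 s *m B 0 s.
Proof. by move=> hA hB; have := pmul_top hN s hA hB; rewrite !addr0. Qed.

Let band0 b (A : vec -> vec -> 'M[C]_N) v s : bandF b [:: 0] A -> A v s <> 0 ->
  exists j : nat, v = const_mx (- (sg b * j%:Z)).
Proof.
move=> hA /hA[f]; rewrite inE => /eqP -> [j ->]; exists j.
by apply/matrixP => k l; rewrite !mxE add0r.
Qed.

(* W V is a series in e^{-d_s} and, being equal to its barred analogue, also a
   series in e^{d_s}. *)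
Let WV b x : D x -> pmul (pt x (W b)) (pt x (V b)) = one.
Proof.
move=> Dx; have E : pmul (pt x (W false)) (pt x (V false)) =
    pmul (pt x (W true)) (pt x (V true)).
  by have := agree0 0 Dx; rewrite sector0 !muldm1.
have WV0 : pmul (pt x (W false)) (pt x (V false)) = one.
  apply/funext => v; apply/funext => s; have [->|v0] := eqVneq v 0.
    rewrite (top0 _ (@bandW _ _) (@bandV _ _)) topW topV w0 // ws0 // mulmx1.
    by apply/matrixP => i j; rewrite !mxE eqxx.
  transitivity (0 : 'M[C]_N); last first.
    by apply/matrixP => i j; rewrite !mxE (negPf v0) mulr0n mul0rn.
  apply: contrapT => nz.
  have [j vE] := band0 (band0_mul (@bandW false x) (@bandV false x)) nz.
  move: nz; rewrite E => nz.
  have [k vE'] := band0 (band0_mul (@bandW true x) (@bandV true x)) nz.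
  case/eqP: v0; move: vE'; rewrite vE => /(const_inj hN).
  rewrite /sg expr0 expr1 => jk.
  have -> : j = 0%N by lia.
  by rewrite mulr0 oppr0 const0.
by case: b => //; rewrite -E.
Qed.

Let VW b x : D x -> pmul (pt x (V b)) (pt x (W b)) = one.
Proof.
move=> Dx; apply: (unipotent_idempotent hN (b := b)).
- exact: band0_mul.
(* For square matrices W_0 V_0 = 1 implies V_0 W_0 = 1, also on the barred side, where neither
   leading coefficient need be 1. *)
- move=> s; rewrite (top0 _ (@bandV _ _) (@bandW _ _)); apply: mulmx1C.
  rewrite -(top0 _ (@bandW _ _) (@bandV _ _)) WV //.
  by apply/matrixP => i j; rewrite !mxE eqxx.
rewrite -(bnd_pmulA hN (bV b x) (bW b x) (bnd_mul hN (bV b x) (bW b x))).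
by rewrite (bnd_pmulA hN (bW b x) (bV b x) (bW b x)) WV // mul1dm.
Qed.

Let cj b x X := conjop (pt x (W b)) (pt x (V b)) X.

Let cjM b x X Y : D x -> bnd b X -> bnd b Y ->
  pmul (cj b x X) (cj b x Y) = cj b x (pmul X Y).
Proof. by move=> Dx hX hY; exact: (conjM hN (bW b x) (bV b x) (VW b Dx) hX hY). Qed.

Let cj1 b x : D x -> cj b x one = one.
Proof. by move=> Dx; exact: (conj1 (WV b Dx)). Qed.

Let agree1 t x : D x ->
  pmul (pt x (W false)) (pmul (bare C false t) (pt x (V false))
                         - pt x (dop t (V false))) =
  pmul (pt x (W true)) (pmul (bare C true t) (pt x (V true))
                         - pt x (dop t (V true))).
Proof.
(* The monomial is the single variable of the flow t; K = t.2 + 1 is the least size that contains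
   it, as its last index. *)
move=> Dx; pose i : mindex N t.2.+1 := (t.1.1, t.1.2, ord_max).
have iE : tindex_of i = t by case: t @i => -[].
have T := (bilinear_identity_sectors hN D w wb ws wbs).1 bil x Dx t.2.+1
  (madd (@mexp0 N t.2.+1) i) 0.
have E b : pt x (twist b (madd (@mexp0 N t.2.+1) i) (V b)) =
    pmul (bare C b t) (pt x (V b)) - pt x (dop t (V b)).
  have H := twist_madd hN hD (@mexp0 N t.2.+1) i (hV b) (sV b) Dx.
  rewrite iE in H.
  have Z : eqD D (twist b (@mexp0 N t.2.+1) (V b)) (V b).
    by move=> y _; exact: twist_zero.
  rewrite (dop_eqD hD t Z Dx) (Z x Dx) ffunE in H.
  exact: H.
have E' b := congr1 (pmul (pmul (pt x (W b)) (sector C 0))) (E b).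
have := etrans (esym (E' false)) (etrans T (E' true)).
by rewrite sector0 !muldm1.
Qed.

Let bdW b t x : D x -> bnd b (pt x (dop t (W b))).
Proof. exact: (ubnd_bnd (ubnd_dop hD t (hW b))). Qed.

Let bdV b t x : D x -> bnd b (pt x (dop t (V b))).
Proof. exact: (ubnd_bnd (ubnd_dop hD t (hV b))). Qed.

Let dWV b t x : D x ->
  pmul (pt x (dop t (W b))) (pt x (V b)) +
  pmul (pt x (W b)) (pt x (dop t (V b))) = 0.
Proof.
move=> Dx; rewrite -(dopM hN hD t (hW b) (hV b) (sW b) (sV b) Dx).
have E : eqD D (W b *o V b) (const_op one) by move=> y Dy; exact: WV.
by rewrite (dop_eqD hD t E Dx) dop_const_op.
Qed.

Let dVW b t x : D x ->
  pmul (pt x (dop t (V b))) (pt x (W b)) +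
  pmul (pt x (V b)) (pt x (dop t (W b))) = 0.
Proof.
move=> Dx; rewrite -(dopM hN hD t (hV b) (hW b) (sV b) (sW b) Dx).
have E : eqD D (V b *o W b) (const_op one) by move=> y Dy; exact: VW.
by rewrite (dop_eqD hD t E Dx) dop_const_op.
Qed.

Let bare_bnd b t : bnd b (bare C b t). Proof. exact: bnd_dm. Qed.

Let agree_evolution t x : D x ->
  cj false x (bare C false t) + pmul (pt x (dop t (W false))) (pt x (V false)) =
  cj true x (bare C true t) + pmul (pt x (dop t (W true))) (pt x (V true)).
Proof.
move=> Dx; have P b := product_derivative hN (bW b x) (bV b x) (bdW b t Dx)
  (bdV b t Dx) (bare_bnd b t) (dWV b t Dx).
by rewrite -!P agree1.
Qed.

(* The coefficient of e^0 in (dW) V vanishes because w_0 = 1 is constant. *)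
Let dW_neg t x v s : D x ->
  pmul (pt x (dop t (W false))) (pt x (V false)) v s <> 0 ->
  exists j : nat, v = const_mx (- j.+1%:Z).
Proof.
move=> Dx nz.
have bdw : bandF false [:: 0] (pt x (dop t (W false))).
  by apply: (ubandF_dop hD) Dx => y _; exact: bandW.
have [j vE] := band0 (band0_mul bdw (@bandV false x)) nz.
case: j vE => [|j] vE; last by exists j; rewrite vE /sg expr0 mul1r.
case: nz; rewrite vE mulr0 oppr0 const0 (top0 _ bdw (@bandV false x)).
suff -> : pt x (dop t (W false)) 0 s = 0 by rewrite mul0mx.
apply/matrixP => k l; rewrite [RHS]mxE; apply: etrans (dopE _ _ _ _ _ _ _) _.
apply: etrans (pderiv_cst ((1%:M : 'M[C]_N) k l) t x).
apply: (pderiv_congr hD _ _ Dx) => y Dy.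
by have := topW false y s; rewrite /pt => ->; rewrite w0.
Qed.

(** The coefficient of e^0 may survive because \bar w_0 is merely invertible; this asymmetry with
    [dW_neg] matches the cut into parts >= 0 and < 0. *)
Let dW_pos t x v s : D x ->
  pmul (pt x (dop t (W true))) (pt x (V true)) v s <> 0 ->
  exists j : nat, v = const_mx j%:Z.
Proof.
move=> Dx nz.
have bdw : bandF true [:: 0] (pt x (dop t (W true))).
  by apply: (ubandF_dop hD) Dx => y _; exact: bandW.
have [j vE] := band0 (band0_mul bdw (@bandV true x)) nz.
by exists j; rewrite vE /sg expr1 mulN1r opprK.
Qed.

Let neg_pos (j k : nat) : const_mx (- j.+1%:Z) = const_mx k%:Z :> vec -> False.
Proof. by move=> /(const_inj hN); lia. Qed.

Let Lg b := W b *o opexp R N (if b then -1 else 1) *o V b.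
Let Ug b al := W b *o opE R al *o V b.
Let Qg b al := W b *o opdown R al *o V b.

Let LgE b x : pt x (Lg b) = cj b x (dm (fun=> 1) (fun=> const_mx (sg b))).
Proof.
by case: b; rewrite /sg ?expr0 ?expr1 /cj /conjop -(pt_exp x).
Qed.

Let UgE b al x : pt x (Ug b al) = cj b x (dm (fun be => (be == al)%:R) (fun=> 0)).
Proof. by rewrite -(pt_E x). Qed.

Let QgE b al x : pt x (Qg b al) = cj b x (dm (fun=> 1) (fun=> - delta_mx 0 al)).
Proof. by rewrite -(pt_down x). Qed.

Let powLg b n x : D x ->
  pt x (oppow (Lg b) n) = cj b x (dm (fun=> 1) (fun=> const_mx (sg b * n%:Z))).
Proof.
move=> Dx; elim: n => [|n IH].
  rewrite mulr0 const0 -/one cj1 //; exact: pt_1.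
have := congr2 (@pmul _ _) (LgE b x) IH; rewrite cjM // dm_mul => E.
apply: etrans E _; congr cj; congr dm; apply/funext => al; first exact: mulr1.
by apply/matrixP => i j; rewrite !mxE -[n.+1]add1n PoszD mulrDr mulr1.
Qed.

Let flow b (al : 'I_N) n := oppow (Lg b) n.+1 *o Ug b al.

Let flowE b al n x : D x -> pt x (flow b al n) = cj b x (bare C b (b, al, n)).
Proof.
move=> Dx; have := congr2 (@pmul _ _) (powLg b n.+1 Dx) (UgE b al x).
rewrite cjM // => E; rewrite bare_diag; exact: E.
Qed.

Let B t : diffop R N :=
  if t.1.1 then opneg (flow true t.1.2 t.2) else oppos (flow false t.1.2 t.2).

Let hflow b al n : ubnd D b (flow b al n).
Proof.
have hL : ubnd D b (Lg b).
  apply: (ubnd_mul hN) (hV b); apply: (ubnd_mul hN) (hW b) _.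
  exact: ubnd_const (fun x => pt_exp x _).
have hU : ubnd D b (Ug b al).
  apply: (ubnd_mul hN) (hV b); apply: (ubnd_mul hN) (hW b) _.
  exact: ubnd_const (fun x => pt_E x _).
exact: (ubnd_mul hN (ubnd_pow hN _ hL) hU).
Qed.

Let hB b t : ubnd D b (B t).
Proof.
by rewrite /B; case: ifP => _; [exact: ubnd_opneg|exact: ubnd_oppos].
Qed.

(** One of the two conjugated bare operators vanishes, so the other, L^n U_alpha or its barred
    analogue, is up to sign the difference of the products (dW) V of the two sides. One of these has
    shifts < 0 and the other shifts >= 0, so the cut recovers them. *)
Let product_evolution b t x : D x ->
  pmul (pt x (dop t (W b))) (pt x (V b)) =
  pt x (B t) - cj b x (bare C b t).
Proof.
move=> Dx; pose P b := pmul (pt x (dop t (W b))) (pt x (V b)).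
have ag : cj false x (bare C false t) + P false =
    cj true x (bare C true t) + P true := agree_evolution t Dx.
suff H : P b = pt x (B t) - cj b x (bare C b t) by exact: H.
have off c : t.1.1 != c -> cj c x (bare C c t) = 0.
  by move=> tc; rewrite bare_off // /cj /conjop pmul0r pmul0l.
have flowt : pt x (flow t.1.1 t.1.2 t.2) = cj t.1.1 x (bare C t.1.1 t).
  have tE (r : tindex N) : (r.1.1, r.1.2, r.2) = r by case: r => -[].
  by rewrite flowE // tE.
case tb : t.1.1 off flowt => off flowt.
- have cf0 := off false isT.
  have agP : P false = cj true x (bare C true t) + P true.
    by rewrite -ag cf0 add0r.
  have BE : pt x (B t) = P false.
    apply/funext => v; apply/funext => s; rewrite /B tb /pt /opneg.
    case: asboolP => [[j vE]|nv]; last first.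
      by apply: esym; apply: contrapT => /(dW_neg Dx).
    apply: etrans (congr1 (fun X => X v s) flowt) _.
    rewrite agP popD [X in _ + X](_ : _ = 0) ?addr0 //.
    by apply: contrapT => /(dW_pos Dx)[k]; rewrite vE; exact: neg_pos.
  rewrite BE; case: b; last by rewrite cf0 subr0.
  by rewrite agP addrC addKr.
have ct0 := off true isT.
have agP : P true = cj false x (bare C false t) + P false.
  by rewrite ag ct0 add0r.
have BE : pt x (B t) = P true.
  apply/funext => v; apply/funext => s; rewrite /B tb /pt /oppos.
  case: asboolP => [[j vE]|nv]; last first.
    by apply: esym; apply: contrapT => /(dW_pos Dx).
  apply: etrans (congr1 (fun X => X v s) flowt) _.
  rewrite agP popD [X in _ + X](_ : _ = 0) ?addr0 //.
  by apply: contrapT => /(dW_neg Dx)[k]; rewrite vE => /esym; exact: neg_pos.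
rewrite BE; case: b; first by rewrite ct0 subr0.
by rewrite agP addrC addKr.
Qed.

Let evolution b t x : D x -> pt x (dop t (W b)) =
  pmul (pt x (B t)) (pt x (W b)) - pmul (pt x (W b)) (bare C b t).
Proof.
move=> Dx; exact: (evolution_of_product hN (bW b x) (bV b x) (bdW b t Dx)
  (ubnd_bnd (hB b t) Dx) (bare_bnd b t) (VW b Dx) (product_evolution b t Dx)).
Qed.

Let evolutionV b t x : D x -> pt x (dop t (V b)) =
  pmul (bare C b t) (pt x (V b)) - pmul (pt x (V b)) (pt x (B t)).
Proof.
move=> Dx; exact: (inverse_evolution hN (bW b x) (bV b x) (bdW b t Dx)
  (bdV b t Dx) (ubnd_bnd (hB b t) Dx) (bare_bnd b t) (WV b Dx) (VW b Dx)
  (evolution b t Dx) (dVW b t Dx)).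
Qed.

Let BE_true al n : opBb (Lg true) (Ug true) al n.+1 = B (true, al, n).
Proof. by []. Qed.

Let BE_false al n : opB (Lg false) (Ug false) al n.+1 = B (false, al, n).
Proof. by []. Qed.

Let inter b (X : diffop R N) (a : 'I_N -> C) (u : 'I_N -> vec) :
  (forall x, pt x X = dm a u) -> opeq D (W b *o X *o V b *o W b) (W b *o X).
Proof.
move=> XE; apply/opeqP => x Dx.
have hX : bnd b (pt x X) by rewrite XE.
exact: (conj_intertwine hN (bW b x) (bV b x) (VW b Dx) hX).
Qed.

Let bareE b al n x : pmul (pt x (W b)) (bare C b (b, al, n)) =
  pmul (pmul (pt x (W b)) (pt x (opexp R N (if b then - n.+1%:Z else n.+1%:Z))))
       (pt x (opE R al)).
Proof.
rewrite pt_exp pt_E bare_diag (bnd_pmulA hN (bW b x) (bD b _ _) (bD b _ _)).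
by case: b; rewrite /sg ?expr0 ?expr1 ?mul1r ?mulN1r.
Qed.

Lemma bilinear_wave_operators :
  wave_operators D (Lg false) (Lg true) (Ug false) (Ug true)
    (Qg false) (Qg true) w wb.
Proof.
split=> //.
- exact: inter (fun x => pt_exp x 1).
- by move=> al; exact: inter (fun x => pt_E x al).
- by move=> al; exact: inter (fun x => pt_down x al).
- exact: inter (fun x => pt_exp x (-1)).
- by move=> al; exact: inter (fun x => pt_E x al).
- by move=> al; exact: inter (fun x => pt_down x al).
- move=> al n; apply/opeqP => x Dx; rewrite BE_false.
  apply: etrans (evolution false (false, al, n) Dx) _.
  by rewrite (bareE false).
- move=> al n; apply/opeqP => x Dx; rewrite BE_true.
  apply: etrans (evolution false (true, al, n) Dx) _.
  by rewrite bare_off // pmul0r subr0.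
- move=> al n; apply/opeqP => x Dx; rewrite BE_false.
  apply: etrans (evolution true (false, al, n) Dx) _.
  by rewrite bare_off // pmul0r subr0.
- move=> al n; apply/opeqP => x Dx; rewrite BE_true.
  apply: etrans (evolution true (true, al, n) Dx) _.
  by rewrite (bareE true).
Qed.

Let band_conj b x (a : 'I_N -> C) (u : vec) :
  bandF b [:: u] (cj b x (dm a (fun=> u))).
Proof.
have bX : bandF b [:: u] (dm a (fun=> u)).
  move=> v s nz; exists u; rewrite ?mem_head //; exists 0%N.
  rewrite mulr0 const0 subr0; apply: contrapT => vu; apply: nz.
  by apply/matrixP => i j; rewrite !mxE; case: (v =P u) => // _; rewrite mulr0n mul0rn.
have := bandF_mul hN (bandF_mul hN (@bandW b x) bX) (@bandV b x).
by rewrite /addS /= add0r addr0.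
Qed.

Let top_conj b x (a : 'I_N -> C) (u s : vec) :
  cj b x (dm a (fun=> u)) u s =
  (if b then wb else w) 0%N s x *m diag_mx (\row_al a al)
  *m (if b then wbs else ws) 0%N (s + u + const_mx 1) x.
Proof.
have bX : bandF b [:: u] (dm a (fun=> u)).
  move=> v s' nz; exists u; rewrite ?mem_head //; exists 0%N.
  rewrite mulr0 const0 subr0; apply: contrapT => vu; apply: nz.
  by apply/matrixP => i j; rewrite !mxE; case: (v =P u) => // _; rewrite mulr0n mul0rn.
have bWX : bandF b [:: u] (pmul (pt x (W b)) (dm a (fun=> u))).
  by have := bandF_mul hN (@bandW b x) bX; rewrite /addS /= add0r.
have E1 := pmul_top hN s bWX (@bandV b x).
have E2 := pmul_top hN s (@bandW b x) bX.
rewrite addr0 in E1; rewrite add0r addr0 in E2.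
rewrite /cj /conjop E1 E2 topW topV; congr (_ *m _ *m _).
by apply/matrixP => i j; rewrite !mxE eqxx mulr1n.
Qed.

Let smop_conj b (X : diffop R N) (a : 'I_N -> C) (u : 'I_N -> vec) :
  (forall x, pt x X = dm a u) -> smop D (W b *o X *o V b).
Proof.
move=> XE; have hX := ubnd_const D b XE; have sX := smop_const hD XE.
exact: (smop_mul hN hD (ubnd_mul hN (hW b) hX) (hV b)
  (smop_mul hN hD (hW b) hX (sW b) sX) (sV b)).
Qed.

(** Covers L, U_alpha, their barred analogues and the inverse of \bar L; the formula for the leading
    coefficient yields the required normalizations. *)
Let conj_shape b (d : int) (X : diffop R N) (a : 'I_N -> C) :
  (forall x, pt x X = dm a (fun=> const_mx d)) ->
  exists c : nat -> coef R N,
    [/\ forall j, smooth_coef D (c j),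
        forall s x, D x -> c 0%N s x =
          (if b then wb else w) 0%N s x *m diag_mx (\row_al a al)
          *m (if b then wbs else ws) 0%N (s + const_mx d + const_mx 1) x
      & opeq D (W b *o X *o V b) (one_sided b d c)].
Proof.
move=> XE; set A := W b *o X *o V b.
have AE x : pt x A = cj b x (dm a (fun=> const_mx d)) by rewrite -(XE x).
exists (fun j => A (const_mx (d - sg b * j%:Z))); split.
- by move=> j; exact: smop_conj XE _.
- move=> s x Dx; rewrite mulr0 subr0 -top_conj.
  exact: (congr1 (fun Y => Y (const_mx d) s) (AE x)).
apply: (gen_intro hN) => v s x Dx nz.
have nz' : cj b x (dm a (fun=> const_mx d)) v s <> 0.
  by rewrite -AE.
have [f + [j vE]] := band_conj nz'; rewrite inE => /eqP fE.
exists j; rewrite vE fE; apply/matrixP => k l; by rewrite !mxE.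
Qed.

Let diag_one : diag_mx (\row_(al < N) 1) = 1%:M :> 'M[C]_N.
Proof. by apply/matrixP => i j; rewrite !mxE. Qed.

Let down_shape b al : exists p : nat -> coef R N,
  [/\ forall j, smooth_coef D (p j),
      forall s x, D x -> p 0%N s x =
        (if b then wb else w) 0%N (s + delta_mx 0 al) x
        *m (if b then wbs else ws) 0%N (s + const_mx 1) x
    & opeq D (Qg b al) (opdown R al *o one_sided b 0 p)].
Proof.
(* [A] is e^{d_{s_alpha}} Q_alpha, or its barred analogue: undoing the left factor e^{-d_{s_alpha}}
   of the prescribed shape moves the shift and the point s together. *)
pose A := fun v s x => Qg b al (v - delta_mx 0 al) (s + delta_mx 0 al) x.
have sA : smop D A by move=> v s; exact: (smop_conj b (fun x => pt_down x al)).
pose p j := A (const_mx (0 - sg b * j%:Z)).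
have AE : opeq D A (one_sided b 0 p).
  apply: (gen_intro hN) => v s x Dx nz.
  have nz' : cj b x (dm (fun=> 1) (fun=> - delta_mx 0 al))
      (v - delta_mx 0 al) (s + delta_mx 0 al) <> 0 by rewrite -QgE.
  have [f + [j vE]] := band_conj nz'; rewrite inE => /eqP fE.
  exists j; rewrite -[v](subrK (delta_mx 0 al)) vE fE.
  by apply/matrixP => k l; rewrite !mxE addrAC addNr.
exists p; split; first by move=> j; exact: sA.
  move=> s x Dx; rewrite /p /A mulr0 subr0 const0 sub0r.
  have := congr1 (fun Y => Y (- delta_mx 0 al) (s + delta_mx 0 al)) (QgE b al x).
  by rewrite top_conj diag_one mulmx1 addrK.
apply/opeqP => x Dx; rewrite pt_mul pt_down; apply/funext => v; apply/funext => s.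
apply/matrixP => i j; rewrite dmul_dmE mul1r /pt -AE // /A.
by rewrite opprK addrK subrK.
Qed.

Lemma bilinear_toda_shape :
  toda_shape D (Lg false) (Lg true) (Ug false) (Ug true) (Qg false) (Qg true).
Proof.
split.
- have [c [sc c0 E]] := conj_shape false (fun x => pt_exp x 1).
  exists c; split=> // s x Dx.
  by rewrite c0 // w0 // ws0 // diag_one !mulmx1.
- have [c [sc c0 E]] := conj_shape true (fun x => pt_exp x (-1)).
  exists c; split=> // s x Dx.
  by rewrite c0 // diag_one mulmx1 unitmx_mul wb0 // wbs0.
- move=> al; have [c [sc c0 E]] := @conj_shape false 0 (opE R al)
    (fun be => (be == al)%:R) (fun x => etrans (pt_E x al) (congr1 _ (funext (fun=> esym (const0 _))))).
  exists c; split=> // s x Dx.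
  rewrite c0 // w0 // ws0 // mul1mx mulmx1.
  apply/matrixP => i j; rewrite !mxE [j == al]eq_sym.
  by case: (i =P al) => [->|]; rewrite /= ?mul0rn //; case: eqP.
- move=> al; have [c [sc c0 E]] := @conj_shape true 0 (opE R al)
    (fun be => (be == al)%:R) (fun x => etrans (pt_E x al) (congr1 _ (funext (fun=> esym (const0 _))))).
  by exists c.
- move=> al; have [p [sp p0 E]] := down_shape false al.
  by exists p; split=> // s x Dx; rewrite p0 // w0 // ws0 // mulmx1.
- move=> al; have [p [sp p0 E]] := down_shape true al.
  by exists p.
Qed.

Let comm_conj b (X Y : diffop R N) (a a' : 'I_N -> C) (u u' : 'I_N -> vec) :
  (forall x, pt x X = cj b x (dm a u)) ->
  (forall x, pt x Y = cj b x (dm a' u')) -> opeq D (opcomm X Y) 0.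
Proof.
move=> XE YE; apply/opeqP => x Dx.
have E1 := congr2 (@pmul _ _) (XE x) (YE x).
have E2 := congr2 (@pmul _ _) (YE x) (XE x).
have S := congr2 (fun f g => f - g) E1 E2.
apply: etrans S _; rewrite !cjM // [pmul (dm a' _) _]dm_comm; exact: subrr.
Qed.

Let mul_units b al be x : D x -> pt x (Ug b al *o Ug b be) =
  pt x (if al == be then Ug b be else 0).
Proof.
move=> Dx; have E := congr2 (@pmul _ _) (UgE b al x) (UgE b be x).
apply: etrans E _; rewrite cjM // dm_units_mul; case: eqP => _.
  exact: esym (UgE b be x).
by rewrite /cj /conjop pmul0r pmul0l.
Qed.

Let sum_units b x : D x -> pt x (\sum_al Ug b al) = one.
Proof.
move=> Dx; rewrite pt_sum (eq_bigr _ (fun al _ => UgE b al x)).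
apply: etrans (conj_sum hN (bW b x) (bV b x) _ (fun al => bD b _ _)) _.
rewrite dm_units_sum; exact: (cj1 b Dx).
Qed.

Let prod_down b (r : seq 'I_N) x : D x ->
  pt x (\big[@opmul R N/op1 R N]_(al <- r) Qg b al) =
  cj b x (dm (fun=> 1) (fun=> \sum_(al <- r) - delta_mx 0 al)).
Proof.
move=> Dx; elim: r => [|al r IH].
  by rewrite !big_nil; apply: etrans (pt_1 x) (esym (cj1 b Dx)).
rewrite !big_cons; have E := congr2 (@pmul _ _) (QgE b al x) IH.
apply: etrans E _; rewrite cjM // dm_mul; congr cj; congr dm.
by apply/funext => be; exact: mulr1.
Qed.

Let prod_all_down b x : D x ->
  pt x (\big[@opmul R N/op1 R N]_al Qg b al) =
  cj b x (dm (fun=> 1) (fun=> const_mx (-1))).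
Proof. by move=> Dx; rewrite prod_down // sum_down. Qed.

Let shift_cancel (e e' : int) : e + e' = 0 ->
  pmul (dm (fun=> 1) (fun=> const_mx e)) (dm (fun=> 1) (fun=> const_mx e')) = one.
Proof.
move=> ee'; rewrite dm_mul; congr dm; apply/funext => al; first exact: mulr1.
by apply/matrixP => i j; rewrite !mxE ee'.
Qed.

Let inverse_conj b (X Y : diffop R N) (e e' : int) : e + e' = 0 ->
  (forall x, D x -> pt x X = cj b x (dm (fun=> 1) (fun=> const_mx e))) ->
  (forall x, D x -> pt x Y = cj b x (dm (fun=> 1) (fun=> const_mx e'))) ->
  opinverse D X Y.
Proof.
move=> ee' XE YE; split; apply/opeqP => x Dx; rewrite pt_1.
  apply: etrans (congr2 (@pmul _ _) (XE x Dx) (YE x Dx)) _.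
  by rewrite cjM // shift_cancel //; exact: cj1.
apply: etrans (congr2 (@pmul _ _) (YE x Dx) (XE x Dx)) _.
by rewrite cjM // shift_cancel 1?addrC //; exact: cj1.
Qed.

Let link_conj b (A : diffop R N) al x : D x ->
  pt x A = cj b x (dm (fun=> 1) (fun=> const_mx 1)) ->
  pt x (Qg b al *o (\sum_be Ug b be *o oppow A (al == be))) =
  cj b x (sector C (- delta_mx 0 al)).
Proof.
move=> Dx AE.
have powE (c : bool) : pt x (oppow A c) =
    cj b x (dm (fun=> 1) (fun=> const_mx c%:Z)).
  case: c.
    apply: etrans (congr2 (@pmul _ _) AE (pt_1 x)) _; exact: muldm1.
  apply: etrans (pt_1 x) _; rewrite const0; exact: esym (cj1 b Dx).
pose f be := pmul (dm (fun ga => (ga == be)%:R : C) (fun=> 0 : vec))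
  (dm (fun=> 1) (fun=> const_mx (al == be)%:Z)).
have bf be : bnd b (f be) := bnd_mul hN (bD b _ _) (bD b _ _).
have UE be : pt x (Ug b be *o oppow A (al == be)) = cj b x (f be).
  apply: etrans (congr2 (@pmul _ _) (UgE b be x) (powE (al == be))) _.
  exact: (cjM Dx (bD b _ _) (bD b _ _)).
have SE : pt x (\sum_be Ug b be *o oppow A (al == be)) =
    cj b x (\sum_be f be).
  rewrite pt_sum (eq_bigr _ (fun be _ => UE be)).
  exact: (conj_sum hN (bW b x) (bV b x) _ bf).
apply: etrans (congr2 (@pmul _ _) (QgE b al x) SE) _.
have bS : bnd b (\sum_be f be) by exact: bnd_sum.
rewrite (cjM Dx (bD b _ _) bS); congr (cj b x _).
exact: link_sector.
Qed.

Lemma bilinear_toda_algebra :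
  toda_algebra D (Lg false) (Lg true) (Ug false) (Ug true) (Qg false) (Qg true).
Proof.
split.
- by move=> al; exact: comm_conj (LgE false) (UgE false al).
- by move=> al; exact: comm_conj (LgE false) (QgE false al).
- by move=> al be; exact: comm_conj (UgE false be) (QgE false al).
- by move=> al be; exact: comm_conj (QgE false al) (QgE false be).
- by move=> al be; apply/opeqP => x; exact: mul_units.
- by apply/opeqP => x Dx; rewrite pt_1; exact: sum_units.
- apply: (@inverse_conj false _ _ 1 (-1) (addrN 1)) => x Dx.
    exact: LgE.
  exact: prod_all_down.
- by move=> al; exact: comm_conj (LgE true) (UgE true al).
- by move=> al; exact: comm_conj (LgE true) (QgE true al).
- by move=> al be; exact: comm_conj (UgE true be) (QgE true al).
- by move=> al be; exact: comm_conj (QgE true al) (QgE true be).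
- by move=> al be; apply/opeqP => x; exact: mul_units.
- by apply/opeqP => x Dx; rewrite pt_1; exact: sum_units.
- by apply/opeqP => x Dx; rewrite prod_all_down // LgE /sg expr1.
(* The inverse of \bar L is \bar W e^{d_s} \bar W^{-1}, and [c] collects its coefficients. *)
have [c [sc c0 E]] := conj_shape true (fun x => pt_exp x 1).
have cE x : D x -> pt x (upper 1 c) = cj true x (dm (fun=> 1) (fun=> const_mx 1)).
  by move=> Dx; rewrite -(pt_exp x 1); exact: esym (eqD_pt E Dx).
exists c; split; first exact: sc.
  by apply: (@inverse_conj true _ _ (-1) 1 (addNr 1)) => x Dx;
    [exact: LgE|exact: cE].
move=> al; apply/opeqP => x Dx.
apply: etrans (link_conj al Dx (LgE false x)) _.
apply: etrans (agree0 _ Dx) _.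
exact: esym (link_conj al Dx (cE x Dx)).
Qed.

(** Every operator of the solution is W X V with X diagonal and constant in the times, so dX = 0 and
    X commutes with the bare operators. *)
Let lax b (X : diffop R N) (a : 'I_N -> C) (u : 'I_N -> vec) :
  (forall x, pt x X = dm a u) ->
  lax_equations D (Lg false) (Lg true) (Ug false) (Ug true) (W b *o X *o V b).
Proof.
move=> XE.
suff lt t : eqD D (dop t (W b *o X *o V b)) (opcomm (B t) (W b *o X *o V b)).
  by move=> al n; split; apply/opeqP; exact: lt.
move=> x Dx; have hX := ubnd_const D b XE; have sX := smop_const hD XE.
have bX : bnd b (pt x X) by rewrite XE; exact: bD.
have hWX := ubnd_mul hN (hW b) hX.
have sWX := smop_mul hN hD (hW b) hX (sW b) sX.
have E1 := dopM hN hD t hWX (hV b) sWX (sV b) Dx.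
have E2 := dopM hN hD t (hW b) hX (sW b) sX Dx.
have dX : pt x (dop t X) = 0.
  have XE' : eqD D X (const_op (dm a u)) by move=> y _; exact: XE.
  by rewrite (dop_eqD hD t XE' Dx) dop_const_op.
have E3 : pt x (dop t (W b *o X)) = pmul (pt x (dop t (W b))) (pt x X).
  have Z : pmul (pt x (W b)) (pt x (dop t X)) = 0 :=
    etrans (congr1 (pmul (pt x (W b))) dX) (pmul0r _).
  apply: etrans E2 _.
  apply: etrans (congr1 (fun Y => pmul (pt x (dop t (W b))) (pt x X) + Y) Z) _.
  exact: addr0.
apply: etrans E1 _.
apply: etrans (congr1 (fun Y => pmul Y (pt x (V b)) +
  pmul (pmul (pt x (W b)) (pt x X)) (pt x (dop t (V b)))) E3) _.
have XE' : pmul (pt x X) (bare C b t) = pmul (bare C b t) (pt x X).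
  by rewrite XE; exact: dm_comm.
exact: (conj_lax hN (bW b x) (bV b x) (bdW b t Dx) (bdV b t Dx)
  (ubnd_bnd (hB b t) Dx) (bare_bnd b t) bX XE' (evolution b t Dx)
  (evolutionV b t Dx)).
Qed.

Lemma bilinear_toda_lax :
  toda_lax D (Lg false) (Lg true) (Ug false) (Ug true) (Qg false) (Qg true).
Proof.
split.
- exact: lax (fun x => pt_exp x 1).
- exact: lax (fun x => pt_exp x (-1)).
- by move=> al; exact: lax (fun x => pt_E x al).
- by move=> al; exact: lax (fun x => pt_E x al).
- by move=> al; exact: lax (fun x => pt_down x al).
- by move=> al; exact: lax (fun x => pt_down x al).
Qed.

Lemma bilinear_inverse b : opinverse D (W b) (V b).
Proof.
by split; apply/opeqP => x Dx; rewrite pt_1; [exact: WV|exact: VW].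
Qed.

End BilinearToSolution.

Theorem proposition4p1 (R : realType) (N : nat) (hN : (0 < N)%N)
    (D : set (times R N)) (hD : line_open D) :
  (forall (L Lb : diffop R N) (U Ub Q Qb : 'I_N -> diffop R N)
          (w wb ws wbs : nat -> coef R N),
     toda_solution D L Lb U Ub Q Qb ->
     wave_operators D L Lb U Ub Q Qb w wb ->
     (forall j, smooth_coef D (ws j)) ->
     (forall j, smooth_coef D (wbs j)) ->
     opinverse D (lower 0 w) (adj_lower ws) ->
     opinverse D (upper 0 wb) (adj_upper wbs) ->
     bilinear_identity D w wb ws wbs)
  /\
  (forall w wb ws wbs : nat -> coef R N,
     (forall j, smooth_coef D (w j)) ->
     (forall j, smooth_coef D (wb j)) ->
     (forall j, smooth_coef D (ws j)) ->
     (forall j, smooth_coef D (wbs j)) ->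
     (forall s x, D x -> w 0%N s x = 1%:M) ->
     (forall s x, D x -> ws 0%N s x = 1%:M) ->
     (forall s x, D x -> wb 0%N s x \in unitmx) ->
     (forall s x, D x -> wbs 0%N s x \in unitmx) ->
     bilinear_identity D w wb ws wbs ->
     let W := lower 0 w in
     let Winv := adj_lower ws in
     let Wb := upper 0 wb in
     let Wbinv := adj_upper wbs in
     let L := W *o opexp R N 1 *o Winv in
     let U := fun alpha => W *o opE R alpha *o Winv in
     let Q := fun alpha => W *o opdown R alpha *o Winv in
     let Lb := Wb *o opexp R N (- 1) *o Wbinv in
     let Ub := fun alpha => Wb *o opE R alpha *o Wbinv in
     let Qb := fun alpha => Wb *o opdown R alpha *o Wbinv in
     [/\ opinverse D W Winv,
         opinverse D Wb Wbinv,
         wave_operators D L Lb U Ub Q Qb w wb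
       & toda_solution D L Lb U Ub Q Qb]).
Proof.
split.
  move=> L Lb U Ub Q Qb w wb ws wbs sol wav sws swbs inv invb.
  exact: (solution_to_bilinear hN hD sol wav sws swbs inv invb).
move=> w wb ws wbs sw swb sws swbs w0 ws0 wb0 wbs0 bil W Winv Wb Wbinv L U Q.
move=> Lb Ub Qb.
have invE := bilinear_inverse hN w0 ws0 bil.
split.
- exact: (invE false).
- exact: (invE true).
- exact: (bilinear_wave_operators hN hD sw swb sws swbs w0 ws0 wb0 bil).
split.
- exact: (bilinear_toda_shape hN hD sw swb sws swbs w0 ws0 wb0 wbs0).
- exact: (bilinear_toda_algebra hN hD sw swb sws swbs w0 ws0 bil).
- exact: (bilinear_toda_lax hN hD sw swb sws swbs w0 ws0 bil).
Qed.
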